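(* Let $m$ be a nonnegative integer and let $0<d<\pi$. Assume that $f$ is analytic in $\phi_4(\mathscr{D}_d)$, and that there exist positive constants $K$, $\alpha$ and $\beta$ such that $$|f(z)|\leq K|e^{-z}|^{\beta}\quad\text{for all } z\in\phi_4(\mathscr{D}_d^{+}),\qquad |f(z)|\leq K\frac{1}{|z|^{\alpha}}\quad\text{for all } z\in\phi_4(\mathscr{D}_d^{-}).$$ Let $\mu=\min\{\alpha,\beta\}$, and for each positive integer $n$ let $$M=\left\lceil\frac{\mu}{\alpha}n\right\rceil,\quad N=\left\lceil\frac{\mu}{\beta}n\right\rceil,\quad h=\sqrt{\frac{\pi d}{\mu n}}.$$ Then there exists a constant $C$ independent of $n$ such that, for all positive integers $n$, $$\sup_{t\in(-\infty,\infty)}\left|f^{(m)}(t)-\sum_{k=-M}^{N}f(\phi_4(kh))\left(\frac{\mathrm{d}}{\mathrm{d}t}\right)^m\left\{S(k,h)(\phi_4^{-1}(t))\right\}\right|\leq C n^{(m+1)/2}\exp\left(-\sqrt{\pi d\mu n}\right).$$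
   Context: For $d>0$, $\mathscr{D}_d=\{\zeta\in\mathbb{C}:|\operatorname{Im}\zeta|<d\}$, $\mathscr{D}_d^{-}=\{\zeta\in\mathscr{D}_d:\operatorname{Re}\zeta<0\}$ and $\mathscr{D}_d^{+}=\{\zeta\in\mathscr{D}_d:\operatorname{Re}\zeta\geq 0\}$. The map $\phi_4$ is $\phi_4(\zeta)=2\sinh(\log(\log(1+e^{\zeta})))=\log(1+e^\zeta)-\dfrac{1}{\log(1+e^\zeta)}$ (principal logarithm), considered on $\mathscr{D}_d$ with $d<\pi$; it maps $\mathbb{R}$ onto $\mathbb{R}$, and for $t\in\mathbb{R}$, $\phi_4^{-1}(t)=\log(e^{p(t)}-1)$ with $p(t)=(t+\sqrt{4+t^2})/2$. For $h>0$ and an integer $k$, the Sinc function is $S(k,h)(x)=\dfrac{\sin[\pi(x-kh)/h]}{\pi(x-kh)/h}$ for $x\neq kh$, and $S(k,h)(kh)=1$. *)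

(* Defs.v *)
From Stdlib Require Export Reals ZArith Zfloor.
From Stdlib Require Import Lra Lia.
From Coquelicot Require Export Coquelicot.
Open Scope R_scope.

Definition Cexp (z : C) : C :=
  (exp (Re z) * cos (Im z), exp (Re z) * sin (Im z)).

Definition Csinh (z : C) : C := ((Cexp z - Cexp (- z)) / 2)%C.

(** Principal argument, in (-PI, PI]; the value at 0 is irrelevant. *)
Definition Carg (z : C) : R :=
  if Rle_dec 0 (Im z) then acos (Re z / Cmod z) else - acos (Re z / Cmod z).

Definition Clog (z : C) : C := (ln (Cmod z), Carg z).

Definition strip (d : R) (z : C) : Prop := Rabs (Im z) < d.
Definition strip_neg (d : R) (z : C) : Prop := strip d z /\ Re z < 0.
Definition strip_pos (d : R) (z : C) : Prop := strip d z /\ 0 <= Re z.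

Definition image (g : C -> C) (D : C -> Prop) (z : C) : Prop :=
  exists zeta : C, D zeta /\ g zeta = z.

(** Complex differentiability at every point; this is used for [D] open. *)
Definition analytic_in (D : C -> Prop) (f : C -> C) : Prop :=
  forall z : C, D z -> @ex_derive C_AbsRing C_NormedModule f z.

(** Iterated complex derivative, the analogue of [Derive_n] for [C_derive]. *)
Definition C_derive_n (f : C -> C) (m : nat) : C -> C := Nat.iter m C_derive f.

(** Sum of [F k] over the integers [a <= k <= b] (zero if [b < a]). *)
Definition Csum_Z (F : Z -> C) (a b : Z) : C :=
  sum_n_m (G := C_AbelianMonoid)
    (fun j : nat => F (a + Z.of_nat j - 1)%Z) 1 (Z.to_nat (b - a + 1)).

Definition phi4 (zeta : C) : C :=
  (2 * Csinh (Clog (Clog (1 + Cexp zeta))))%C.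

Definition phi4_inv (t : R) : R :=
  ln (exp ((t + sqrt (4 + t ^ 2)) / 2) - 1).

Definition Sinc (k : Z) (h x : R) : R :=
  if Req_EM_T x (IZR k * h) then 1
  else sin (PI * (x - IZR k * h) / h) / (PI * (x - IZR k * h) / h).

Lemma Cexp_Clog (z : C) : z <> 0%C -> Cexp (Clog z) = z.
Proof.
intros Hz.
assert (Hm : 0 < Cmod z) by now apply Cmod_gt_0.
assert (Hsq := Cmod2_alt z).
assert (Hre := re_le_Cmod z).
assert (Hb : -1 <= Re z / Cmod z <= 1).
{ apply Rabs_le_between in Hre. split.
  - apply Rmult_le_reg_r with (Cmod z); [lra|].
    unfold Rdiv. rewrite Rmult_assoc, Rinv_l by lra. lra.
  - apply Rmult_le_reg_r with (Cmod z); [lra|].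
    unfold Rdiv. rewrite Rmult_assoc, Rinv_l by lra. lra. }
assert (Hs : Cmod z * sqrt (1 - (Re z / Cmod z)²) = Rabs (Im z)).
{ rewrite <- (sqrt_Rsqr (Cmod z)) at 1 by lra.
  rewrite <- sqrt_mult_alt by apply Rle_0_sqr.
  rewrite <- sqrt_Rsqr_abs. f_equal. unfold Rsqr in *.
  replace (Cmod z * Cmod z * (1 - Re z / Cmod z * (Re z / Cmod z)))
    with (Cmod z ^ 2 - Re z ^ 2) by (field; lra).
  rewrite Hsq. ring. }
destruct z as [x y]; unfold Cexp, Clog, Carg; simpl Re in *; simpl Im in *;
  unfold Re, Im; cbn [fst snd].
rewrite exp_ln by assumption.
destruct (Rle_dec 0 y) as [Hy|Hy].
- rewrite cos_acos, sin_acos by assumption. rewrite Hs, Rabs_pos_eq by lra.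
  f_equal. field. lra.
- rewrite cos_neg, sin_neg, cos_acos, sin_acos by assumption.
  rewrite Ropp_mult_distr_r_reverse, Hs, Rabs_left by lra.
  f_equal; [field; lra | ring].
Qed.

Lemma Cexp_opp (z : C) : (Cexp z * Cexp (- z) = 1)%C.
Proof.
destruct z as [x y]. unfold Cexp, Cmult, Copp, RtoC; simpl.
rewrite cos_neg, sin_neg, exp_Ropp.
assert (He := exp_pos x). assert (H := sin2_cos2 y). unfold Rsqr in H.
f_equal.
- transitivity (sin y * sin y + cos y * cos y); [field; lra | lra].
- field; lra.
Qed.

Lemma phi4_alt (zeta : C) :
  Clog (1 + Cexp zeta)%C <> 0%C ->
  phi4 zeta = (Clog (1 + Cexp zeta) - / Clog (1 + Cexp zeta))%C.
Proof.
intros Hw. unfold phi4, Csinh. set (w := Clog (1 + Cexp zeta)%C) in *.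
assert (H := Cexp_opp (Clog w)). rewrite Cexp_Clog in H |- * by assumption.
replace (Cexp (- Clog w)) with (/ w)%C.
- field. assumption.
- rewrite <- (Cmult_1_r (/ w)), <- H. field. assumption.
Qed.

Lemma Clog_RtoC (x : R) : 0 < x -> Clog x = RtoC (ln x).
Proof.
intros Hx. unfold Clog, Carg. rewrite Cmod_R, Rabs_pos_eq by lra.
unfold RtoC; simpl. destruct (Rle_dec 0 0) as [_|]; [|lra].
unfold Rdiv. rewrite Rinv_r, acos_1 by lra. reflexivity.
Qed.

Lemma phi4_RtoC (x : R) :
  phi4 x = RtoC (ln (1 + exp x) - / ln (1 + exp x)).
Proof.
assert (He := exp_pos x).
assert (Hl : 0 < ln (1 + exp x)) by (rewrite <- ln_1; apply ln_increasing; lra).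
assert (E : Clog (1 + Cexp x)%C = RtoC (ln (1 + exp x))).
{ rewrite <- Clog_RtoC by lra. f_equal. unfold Cexp, Cplus, RtoC; simpl.
  rewrite cos_0, sin_0. f_equal; ring. }
rewrite phi4_alt; rewrite E.
- rewrite RtoC_minus, RtoC_inv by lra. reflexivity.
- intros H; apply RtoC_inj in H; lra.
Qed.

Lemma phi4_inv_r (t : R) : phi4 (phi4_inv t) = RtoC t.
Proof.
assert (Hq : 0 <= 4 + t ^ 2) by nra.
assert (Hs := sqrt_sqrt _ Hq). assert (Hs0 := sqrt_pos (4 + t ^ 2)).
set (p := (t + sqrt (4 + t ^ 2)) / 2).
assert (Hp : 0 < p) by (unfold p; nra).
assert (Hpp : p * p = t * p + 1) by (unfold p; nra).
assert (Hep : 1 < exp p) by (rewrite <- exp_0; now apply exp_increasing).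
rewrite phi4_RtoC. unfold phi4_inv. fold p.
rewrite exp_ln by lra. replace (1 + (exp p - 1)) with (exp p) by ring.
rewrite ln_exp. f_equal.
apply Rmult_eq_reg_r with p; [|lra].
rewrite Rmult_minus_distr_r, Rinv_l by lra. lra.
Qed.

Lemma phi4_inv_l (x y : R) : phi4 x = RtoC y -> phi4_inv y = x.
Proof.
rewrite phi4_RtoC. intros H; apply RtoC_inj in H.
assert (He := exp_pos x).
assert (Hl : 0 < ln (1 + exp x)) by (rewrite <- ln_1; apply ln_increasing; lra).
unfold phi4_inv. set (p := ln (1 + exp x)) in *.
replace (sqrt (4 + y ^ 2)) with (p + / p).
- replace ((y + (p + / p)) / 2) with p by (rewrite <- H; field; lra).
  unfold p. rewrite exp_ln by lra.
  replace (1 + exp x - 1) with (exp x) by ring. apply ln_exp.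
- symmetry. apply sqrt_lem_1.
  + nra.
  + assert (0 < / p) by now apply Rinv_0_lt_compat. lra.
  + rewrite <- H. field. lra.
Qed.

(* Main.v *)
Require Import Defs.
From Stdlib Require Import Reals ZArith Zfloor Lra Lia List Classical ClassicalEpsilon.
From Coquelicot Require Import Coquelicot.
Open Scope R_scope.

(** Put [F = f o phi4], holomorphic and exponentially decaying on the strip [|Im z| < d].
The inverse of [phi4] on the real line extends to a holomorphic [psi] on a strip
[|Im z| < rho] with [|Im (psi z)| <= 6 |Im z|].  On [|Im x| <= h] the sinc interpolation
error of [F] is a Cauchy integral of [F w sin (PI x / h) / ((w - x) sin (PI w / h))]
along two lines near [|Im w| = d], hence [O (exp (- PI d / h))], and truncating the
series costs [O (exp (- PI d / h) / h)].  So the holomorphic error function is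
[O (exp (- PI d / h) / h)] on a strip around the real line whose width is proportional
to [h], and [m] applications of Cauchy's estimate cost only a factor [h ^ (- m)]: no
derivative of a sinc function or of [phi4_inv] ever has to be computed. *)

(** * Complex derivatives *)

(** Boundary values of [F] on [|Im w| = d] need not exist, so the integration lines are drawn
    inwards by at most [h / PI], which costs only a factor [e] against [exp (PI d / h)]. They are
    closed into a finite rectangle whose vertical sides run midway between two nodes and whose
    length is chosen after the point [x], so no infinite series and no improper integral occurs. On
    [|Im x| <= h] the factor [sin (PI x / h)] stays below [cosh PI]; this ties the width to [h]. The
    delicate point is [psi]: as [t] tends to minus infinity, [p = (t + sqrt (4 + t^2)) / 2] tends to
    0 and [log (e^p - 1)] approaches its singularity, so the bound [6 |Im z|] forces [Im p] to
    shrink together with [Re p]. Goursat's theorem is proved with finitely many points of mere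
    continuity, which covers at once the removable singularities of Cauchy's formula and of the
    interpolation quotient. Since [h] is proportional to [n ^ (-1/2)], the [1 / h] of the truncation
    and the [h ^ (-m)] of the derivatives make up [n ^ ((m+1)/2)]. *)

Notation Cabs := (AbsRing_NormedModule C_AbsRing).
Notation is_Cder := (@is_derive C_AbsRing Cabs).
Notation ex_Cder := (@ex_derive C_AbsRing Cabs).
Notation Ccont := (@continuous (AbsRing_UniformSpace C_AbsRing) (AbsRing_UniformSpace C_AbsRing)).

Lemma is_Cder_eps (g : C -> C) (z l : C) :
  is_Cder g z l <->
  forall eps, 0 < eps -> exists delta, 0 < delta /\ forall w : C,
    Cmod (w - z) < delta -> Cmod (g w - g z - (w - z) * l) <= eps * Cmod (w - z).
Proof.
split.
- intros [_ H] eps He.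
  destruct (H z (fun P HP => HP) (mkposreal eps He)) as [del Hdel].
  exists del; split; [apply cond_pos|]. intros w Hw.
  apply (Hdel w). exact Hw.
- intros H. split; [apply is_linear_scal_l|].
  intros x Hx. assert (E := is_filter_lim_locally_unique (V := Cabs) z x Hx). subst x.
  intros eps. destruct (H eps (cond_pos eps)) as [del [Hd Hdel]].
  exists (mkposreal del Hd). intros w Hw. apply (Hdel w). exact Hw.
Qed.

(** The product rule lives on [AbsRing_NormedModule C_AbsRing], whereas [analytic_in] and the
    uniqueness lemma for [C_derive] refer to [C_NormedModule]. Both structures lead to the same
    epsilon-delta condition, which serves as the bridge. *)
Lemma is_Cder_is_derive (g : C -> C) (z l : C) :
  is_Cder g z l <-> @is_derive C_AbsRing C_NormedModule g z l.
Proof.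
rewrite is_Cder_eps. split.
- intros H. split; [apply is_linear_scal_l|].
  intros x Hx. assert (E := is_filter_lim_locally_unique (V := Cabs) z x Hx). subst x.
  intros eps. destruct (H eps (cond_pos eps)) as [del [Hd Hdel]].
  exists (mkposreal del Hd). intros w Hw.
  exact (Hdel w Hw).
- intros [_ H] eps He.
  destruct (H z (fun P HP => HP) (mkposreal eps He)) as [del Hdel].
  exists del; split; [apply cond_pos|]. intros w Hw.
  exact (Hdel w Hw).
Qed.

Lemma C_derive_is_Cder (g : C -> C) (z l : C) : is_Cder g z l -> C_derive g z = l.
Proof. intros H. apply is_C_derive_unique. now apply is_Cder_is_derive. Qed.

Lemma is_Cder_C_derive (g : C -> C) (z : C) : ex_Cder g z -> is_Cder g z (C_derive g z).
Proof. intros [l H]. now rewrite (C_derive_is_Cder _ _ _ H). Qed.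

Lemma Ccont_eps (g : C -> C) (z : C) :
  Ccont g z <-> forall eps, 0 < eps -> exists delta, 0 < delta /\ forall w : C,
    Cmod (w - z) < delta -> Cmod (g w - g z) < eps.
Proof.
split.
- intros H eps He.
  destruct (H (fun y => Cmod (y - g z) < eps)%C) as [del Hdel].
  { now exists (mkposreal eps He). }
  exists del; split; [apply cond_pos|exact Hdel].
- intros H P [eps HP]. destruct (H eps (cond_pos eps)) as [del [Hd Hdel]].
  exists (mkposreal del Hd). intros w Hw. apply HP. exact (Hdel w Hw).
Qed.

Lemma ex_Cder_cont (g : C -> C) (z : C) : ex_Cder g z -> Ccont g z.
Proof. apply (ex_derive_continuous (V := Cabs)). Qed.

Lemma locally_Cmod (z : C) (P : C -> Prop) :
  (exists delta, 0 < delta /\ forall w : C, Cmod (w - z) < delta -> P w) ->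
  @locally (AbsRing_UniformSpace C_AbsRing) z P.
Proof. intros [del [Hd H]]. exists (mkposreal del Hd). exact H. Qed.

Lemma is_Cder_ext_loc (f g : C -> C) (z l : C) :
  (exists delta, 0 < delta /\ forall w : C, Cmod (w - z) < delta -> f w = g w) ->
  is_Cder f z l -> is_Cder g z l.
Proof. intros H. apply (is_derive_ext_loc (V := Cabs)). now apply locally_Cmod. Qed.

Lemma is_Cder_const (c z : C) : is_Cder (fun _ => c) z (RtoC 0).
Proof. apply (is_derive_const (V := Cabs)). Qed.

Lemma is_Cder_id (z : C) : is_Cder (fun w => w) z (RtoC 1).
Proof. apply (is_derive_id (K := C_AbsRing)). Qed.

Lemma is_Cder_plus (f g : C -> C) (z a b : C) :
  is_Cder f z a -> is_Cder g z b -> is_Cder (fun w => f w + g w)%C z (a + b)%C.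
Proof. apply (is_derive_plus (V := Cabs)). Qed.

Lemma is_Cder_minus (f g : C -> C) (z a b : C) :
  is_Cder f z a -> is_Cder g z b -> is_Cder (fun w => f w - g w)%C z (a - b)%C.
Proof. apply (is_derive_minus (V := Cabs)). Qed.

Lemma is_Cder_mult (f g : C -> C) (z a b : C) :
  is_Cder f z a -> is_Cder g z b -> is_Cder (fun w => f w * g w)%C z (a * g z + f z * b)%C.
Proof.
intros H1 H2. apply (is_derive_mult (K := C_AbsRing) f g z a b H1 H2).
intros n m. apply Cmult_comm.
Qed.

Lemma is_Cder_comp (f g : C -> C) (z a b : C) :
  is_Cder f (g z) a -> is_Cder g z b -> is_Cder (fun w => f (g w)) z (b * a)%C.
Proof. apply (is_derive_comp (V := Cabs)). Qed.

Lemma Cmod_triangle_rev (x y : C) : Cmod x - Cmod y <= Cmod (x + y).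
Proof.
assert (H := Cmod_triangle (x + y) (- y)).
replace (x + y + - y)%C with x in H by ring. rewrite Cmod_opp in H. lra.
Qed.

Lemma Cmod_minus_sym (x y : C) : Cmod (x - y) = Cmod (y - x).
Proof. rewrite <- Cmod_opp. f_equal. ring. Qed.

Lemma is_Cder_inv (z : C) : z <> 0%C -> is_Cder Cinv z (- / (z * z))%C.
Proof.
intros Hz. apply is_Cder_eps. intros eps He.
assert (Hm : 0 < Cmod z) by now apply Cmod_gt_0.
assert (H3 : 0 < Cmod z ^ 3) by (apply pow_lt; lra).
(* The remainder is [(w - z)^2 / (w z^2)], and [|w| >= |z| / 2] on the chosen disc. *)
set (M := 2 / Cmod z ^ 3).
assert (HM : 0 < M) by (unfold M; apply Rdiv_lt_0_compat; lra).
exists (Rmin (Cmod z / 2) (eps / M)). split.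
{ apply Rmin_pos; [lra|]. now apply Rdiv_lt_0_compat. }
intros w Hw.
assert (Hw1 : Cmod (w - z) < Cmod z / 2) by (eapply Rlt_le_trans; [exact Hw|apply Rmin_l]).
assert (Hw2 : Cmod (w - z) < eps / M) by (eapply Rlt_le_trans; [exact Hw|apply Rmin_r]).
assert (Hwm : Cmod z / 2 <= Cmod w).
{ assert (H := Cmod_triangle_rev z (w - z)). replace (z + (w - z))%C with w in H by ring. lra. }
assert (Hw0 : w <> 0%C) by (apply Cmod_gt_0; lra).
replace (/ w - / z - (w - z) * - / (z * z))%C with ((w - z) * ((w - z) / (w * (z * z))))%C.
2: { field. now split. }
rewrite Cmod_mult, Rmult_comm. apply Rmult_le_compat_r; [apply Cmod_ge_0|].
rewrite Cmod_div, !Cmod_mult by (repeat apply Cmult_neq_0; assumption).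
apply Rmult_lt_compat_r with (r := M) in Hw2; [|assumption].
replace (eps / M * M) with eps in Hw2 by (field; lra).
apply Rle_trans with (2 := Rlt_le _ _ Hw2).
unfold M, Rdiv. apply Rmult_le_compat_l; [apply Cmod_ge_0|].
replace (2 * / Cmod z ^ 3) with (/ (Cmod z / 2 * (Cmod z * Cmod z))) by (field; lra).
apply Rinv_le_contravar.
- apply Rmult_lt_0_compat; [lra|nra].
- apply Rmult_le_compat_r; [nra|assumption].
Qed.

Lemma is_Cder_div (f g : C -> C) (z a b : C) :
  g z <> 0%C -> is_Cder f z a -> is_Cder g z b ->
  is_Cder (fun w => f w / g w)%C z ((a * g z - f z * b) / (g z * g z))%C.
Proof.
intros Hg Hf Hb.
assert (H := is_Cder_mult f (fun w => / g w)%C z a _ Hf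
   (is_Cder_comp Cinv g z _ b (is_Cder_inv _ Hg) Hb)).
replace ((a * g z - f z * b) / (g z * g z))%C with
  (a * / g z + f z * (b * - / (g z * g z)))%C; [exact H|].
field. assumption.
Qed.

Lemma ex_Cder_const (c z : C) : ex_Cder (fun _ => c) z.
Proof. exists (RtoC 0). apply is_Cder_const. Qed.

Lemma ex_Cder_id (z : C) : ex_Cder (fun w => w) z.
Proof. exists (RtoC 1). apply is_Cder_id. Qed.

Lemma ex_Cder_plus (f g : C -> C) (z : C) :
  ex_Cder f z -> ex_Cder g z -> ex_Cder (fun w => f w + g w)%C z.
Proof. intros [a Ha] [b Hb]. eexists. apply is_Cder_plus; eassumption. Qed.

Lemma ex_Cder_minus (f g : C -> C) (z : C) :
  ex_Cder f z -> ex_Cder g z -> ex_Cder (fun w => f w - g w)%C z.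
Proof. intros [a Ha] [b Hb]. eexists. apply is_Cder_minus; eassumption. Qed.

Lemma ex_Cder_mult (f g : C -> C) (z : C) :
  ex_Cder f z -> ex_Cder g z -> ex_Cder (fun w => f w * g w)%C z.
Proof. intros [a Ha] [b Hb]. eexists. apply is_Cder_mult; eassumption. Qed.

Lemma ex_Cder_div (f g : C -> C) (z : C) :
  g z <> 0%C -> ex_Cder f z -> ex_Cder g z -> ex_Cder (fun w => f w / g w)%C z.
Proof. intros Hz [a Ha] [b Hb]. eexists. apply is_Cder_div; eassumption. Qed.

Lemma ex_Cder_comp (f g : C -> C) (z : C) :
  ex_Cder f (g z) -> ex_Cder g z -> ex_Cder (fun w => f (g w)) z.
Proof. intros [a Ha] [b Hb]. eexists. apply is_Cder_comp; eassumption. Qed.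

Lemma ex_Cder_ext_loc (f g : C -> C) (z : C) :
  (exists delta, 0 < delta /\ forall w : C, Cmod (w - z) < delta -> f w = g w) ->
  ex_Cder f z -> ex_Cder g z.
Proof. intros H [a Ha]. exists a. eapply is_Cder_ext_loc; eassumption. Qed.

Lemma Ccont_plus (f g : C -> C) (z : C) :
  Ccont f z -> Ccont g z -> Ccont (fun w => f w + g w)%C z.
Proof. apply (continuous_plus (V := Cabs)). Qed.

Lemma Ccont_mult (f g : C -> C) (z : C) :
  Ccont f z -> Ccont g z -> Ccont (fun w => f w * g w)%C z.
Proof. apply (continuous_mult (K := C_AbsRing)). Qed.

Lemma Ccont_minus (f g : C -> C) (z : C) :
  Ccont f z -> Ccont g z -> Ccont (fun w => f w - g w)%C z.
Proof. apply (continuous_minus (V := Cabs)). Qed.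

Lemma Ccont_div (f g : C -> C) (z : C) :
  g z <> 0%C -> Ccont f z -> Ccont g z -> Ccont (fun w => f w / g w)%C z.
Proof.
intros Hz Hf Hg. apply Ccont_mult; [assumption|].
apply (@continuous_comp (AbsRing_UniformSpace C_AbsRing) (AbsRing_UniformSpace C_AbsRing)
  (AbsRing_UniformSpace C_AbsRing) g Cinv); [assumption|].
apply ex_Cder_cont. eexists. now apply is_Cder_inv.
Qed.

Lemma Ccont_ext_loc (f g : C -> C) (z : C) :
  (exists delta, 0 < delta /\ forall w : C, Cmod (w - z) < delta -> f w = g w) ->
  Ccont f z -> Ccont g z.
Proof.
intros H. apply continuous_ext_loc. apply locally_Cmod in H.
revert H. apply filter_imp. auto.
Qed.

Definition diff_quot (g : C -> C) (a l w : C) : C :=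
  if excluded_middle_informative (w = a) then l else ((g w - g a) / (w - a))%C.

Lemma diff_quot_same (g : C -> C) (a l : C) : diff_quot g a l a = l.
Proof. unfold diff_quot. now destruct excluded_middle_informative. Qed.

Lemma diff_quot_neq (g : C -> C) (a l w : C) :
  w <> a -> diff_quot g a l w = ((g w - g a) / (w - a))%C.
Proof. intros H. unfold diff_quot. now destruct excluded_middle_informative. Qed.

Lemma Ccont_diff_quot (g : C -> C) (a l : C) : is_Cder g a l -> Ccont (diff_quot g a l) a.
Proof.
unfold diff_quot. intros H. apply Ccont_eps. intros eps He. rewrite is_Cder_eps in H.
destruct (H (eps / 2)) as [del [Hd Hdel]]; [lra|].
exists del; split; [assumption|]. intros w Hw.
destruct (excluded_middle_informative (a = a)) as [_|n]; [|easy].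
destruct (excluded_middle_informative (w = a)) as [e|n].
- apply Rle_lt_trans with (Cmod 0); [right; f_equal; ring|now rewrite Cmod_0].
- specialize (Hdel w Hw).
  assert (Hn : (w - a)%C <> 0%C).
  { intros E. apply n. replace w with (w - a + a)%C by ring. rewrite E. ring. }
  assert (Hm : 0 < Cmod (w - a)) by now apply Cmod_gt_0.
  replace ((g w - g a) / (w - a) - l)%C with ((g w - g a - (w - a) * l) / (w - a))%C
    by now field.
  rewrite Cmod_div by assumption.
  apply Rle_lt_trans with (eps / 2); [|lra].
  apply Rmult_le_reg_r with (Cmod (w - a)); [assumption|].
  unfold Rdiv at 1. rewrite Rmult_assoc, Rinv_l; lra.
Qed.

(** * Exponential and logarithm *)

Lemma Cmod_le_Re_Im (z : C) : Cmod z <= Rabs (Re z) + Rabs (Im z).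
Proof.
destruct z as [x y]. replace (x, y) with (RtoC x + RtoC y * Ci)%C.
2: { unfold Ci, RtoC, Cplus, Cmult; simpl; f_equal; ring. }
eapply Rle_trans; [apply Cmod_triangle|].
rewrite Cmod_mult, Cmod_Ci, !Cmod_R. unfold Re, Im; simpl.
apply Req_le. f_equal; [|rewrite Rmult_1_r]; f_equal; ring.
Qed.

Lemma Im_le_Cmod (z : C) : Rabs (Im z) <= Cmod z.
Proof. eapply Rle_trans; [apply Rmax_r|apply (Rmax_Cmod z)]. Qed.

Lemma Cexp_plus (u v : C) : Cexp (u + v) = (Cexp u * Cexp v)%C.
Proof.
destruct u as [a b], v as [c d]. unfold Cexp, Cplus, Cmult, Re, Im; simpl.
rewrite exp_plus, cos_plus, sin_plus. f_equal; ring.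
Qed.

Lemma Cexp_RtoC (x : R) : Cexp x = RtoC (exp x).
Proof. unfold Cexp, RtoC; simpl. rewrite cos_0, sin_0. f_equal; ring. Qed.

Lemma Cmod_Cexp (z : C) : Cmod (Cexp z) = exp (Re z).
Proof.
destruct z as [a b]. unfold Cexp, Cmod, Re, Im; simpl.
replace (_ + _) with (exp a * exp a * ((sin b)² + (cos b)²)) by (unfold Rsqr; ring).
rewrite sin2_cos2, Rmult_1_r. apply sqrt_square, Rlt_le, exp_pos.
Qed.

Lemma Cexp_neq_0 (z : C) : Cexp z <> 0%C.
Proof. apply Cmod_gt_0. rewrite Cmod_Cexp. apply exp_pos. Qed.

Lemma Rabs_sin_le (b : R) : Rabs (sin b) <= Rabs b.
Proof.
destruct (MVT_gen sin 0 b cos) as [c [_ Hc]].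
- intros x _. auto_derive; trivial; ring.
- intros x _. apply continuity_sin.
- rewrite sin_0, !Rminus_0_r in Hc. rewrite Hc, Rabs_mult.
  assert (H := COS_bound c). assert (H1 : Rabs (cos c) <= 1) by (apply Rabs_le; lra).
  assert (H2 := Rabs_pos b). nra.
Qed.

Lemma one_minus_cos_bounds (b : R) : 0 <= 1 - cos b <= b ^ 2 / 2.
Proof.
split; [assert (H := COS_bound b); lra|].
replace b with (2 * (b / 2)) at 1 by field. rewrite cos_2a_sin.
assert (H := Rabs_sin_le (b / 2)).
assert (H2 : Rabs (sin (b / 2)) ^ 2 <= Rabs (b / 2) ^ 2).
{ apply pow_incr. split; [apply Rabs_pos|assumption]. }
rewrite !pow2_abs in H2. nra.
Qed.

Lemma sin_minus_id_bound (b : R) : Rabs b <= 1 -> Rabs (sin b - b) <= b ^ 2 / 2.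
Proof.
intros Hb.
destruct (MVT_gen sin 0 b cos) as [c [Hc Ec]].
- intros x _. auto_derive; trivial; ring.
- intros x _. apply continuity_sin.
- rewrite sin_0, !Rminus_0_r in Ec. rewrite Ec.
  replace (cos c * b - b) with (- ((1 - cos c) * b)) by ring.
  rewrite Rabs_Ropp, Rabs_mult.
  destruct (one_minus_cos_bounds c) as [H1 H2].
  rewrite (Rabs_pos_eq (1 - cos c)) by assumption.
  assert (H3 : c ^ 2 <= b ^ 2).
  { unfold Rmin, Rmax in Hc. destruct (Rle_dec 0 b); nra. }
  assert (H4 := Rabs_pos b). nra.
Qed.

(** Everything follows from [1 + t <= exp t] at [t = a] and [t = - a]: the second gives
    [exp a * (1 - a) <= 1]. *)
Lemma exp_minus_1_bounds (a : R) : Rabs a <= 1 / 2 ->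
  0 <= exp a - 1 - a <= 2 * a ^ 2 /\ exp a <= 2.
Proof.
intros Ha. apply Rabs_le_between in Ha.
assert (H1 := exp_ineq1_le a). assert (H2 := exp_ineq1_le (- a)).
assert (H3 : exp a * exp (- a) = 1) by (rewrite <- exp_plus, Rplus_opp_r; apply exp_0).
assert (H4 := exp_pos a).
assert (H5 : exp a * (1 - a) <= 1) by nra.
assert (H6 : exp a <= 2) by nra.
repeat split; try lra. nra.
Qed.

(** A crude quadratic remainder is enough: the functional equation carries it to every point for the
    derivative of [Cexp], and inversion carries it to [Clog] at 1. The constant is 3 for the real
    part plus 5 for the imaginary part. *)
Lemma Cexp_taylor (v : C) : Cmod v <= 1 / 2 ->
  Cmod (Cexp v - 1 - v) <= 8 * Cmod v ^ 2.
Proof.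
intros Hv. destruct v as [a b].
assert (Ha := re_le_Cmod (a, b)). assert (Hb := Im_le_Cmod (a, b)).
unfold Re, Im in Ha, Hb; simpl fst in Ha; simpl snd in Hb.
set (r := Cmod (a, b)) in *.
eapply Rle_trans; [apply Cmod_le_Re_Im|]. unfold Cexp, Re, Im; simpl.
replace (exp a * cos b + - (1) + - a) with ((exp a - 1 - a) + - (exp a * (1 - cos b))) by ring.
replace (exp a * sin b + - 0 + - b) with ((exp a - 1 - a) * sin b + a * sin b + (sin b - b)) by ring.
destruct (exp_minus_1_bounds a) as [H1 H2]; [lra|].
assert (H3 := one_minus_cos_bounds b).
assert (H4 := sin_minus_id_bound b ltac:(lra)).
assert (H5 := Rabs_sin_le b). assert (H6 := exp_pos a).
assert (Ha2 : a ^ 2 <= r ^ 2) by (rewrite <- (pow2_abs a); apply pow_incr; split; [apply Rabs_pos|lra]).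
assert (Hb2 : b ^ 2 <= r ^ 2) by (rewrite <- (pow2_abs b); apply pow_incr; split; [apply Rabs_pos|lra]).
assert (Hr : 0 <= r) by apply Cmod_ge_0.
assert (E1 : Rabs (exp a - 1 - a + - (exp a * (1 - cos b))) <= 3 * r ^ 2).
{ eapply Rle_trans; [apply Rabs_triang|]. rewrite Rabs_Ropp.
  rewrite (Rabs_pos_eq (exp a - 1 - a)) by lra.
  rewrite Rabs_pos_eq by (apply Rmult_le_pos; lra).
  assert (exp a * (1 - cos b) <= 2 * (r ^ 2 / 2)) by (apply Rmult_le_compat; lra). lra. }
assert (E2 : Rabs ((exp a - 1 - a) * sin b + a * sin b + (sin b - b)) <= 5 * r ^ 2).
{ eapply Rle_trans; [apply Rabs_triang|].
  assert (Rabs ((exp a - 1 - a) * sin b + a * sin b) <= 2 * r ^ 2 * 1 + r * r).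
  { eapply Rle_trans; [apply Rabs_triang|]. rewrite !Rabs_mult.
    rewrite (Rabs_pos_eq (exp a - 1 - a)) by lra.
    apply Rplus_le_compat; apply Rmult_le_compat; try apply Rabs_pos; lra. }
  lra. }
simpl in *. lra.
Qed.

Lemma Cexp_minus_1_bound (v : C) : Cmod v <= 1 / 2 -> Cmod (Cexp v - 1) <= 5 * Cmod v.
Proof.
intros Hv. assert (H := Cexp_taylor v Hv). assert (H0 := Cmod_ge_0 v).
assert (H1 := Cmod_triangle (Cexp v - 1 - v) v).
replace (Cexp v - 1 - v + v)%C with (Cexp v - 1)%C in H1 by ring. nra.
Qed.

Lemma is_Cder_Cexp (z : C) : is_Cder Cexp z (Cexp z).
Proof.
apply is_Cder_eps. intros eps He.
assert (Hm : 0 < Cmod (Cexp z)) by apply Cmod_gt_0, Cexp_neq_0.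
set (M := Cmod (Cexp z) * 8). assert (HM : 0 < M) by (unfold M; lra).
exists (Rmin (1 / 2) (eps / M)). split.
{ apply Rmin_pos; [lra|]. now apply Rdiv_lt_0_compat. }
intros w Hw.
assert (Hw1 : Cmod (w - z) < 1 / 2) by (eapply Rlt_le_trans; [exact Hw|apply Rmin_l]).
assert (Hw2 : Cmod (w - z) < eps / M) by (eapply Rlt_le_trans; [exact Hw|apply Rmin_r]).
set (v := (w - z)%C) in *.
replace w with (z + v)%C by (unfold v; ring). rewrite Cexp_plus.
replace (Cexp z * Cexp v - Cexp z - v * Cexp z)%C with (Cexp z * (Cexp v - 1 - v))%C by ring.
rewrite Cmod_mult.
assert (H := Cexp_taylor v ltac:(lra)). assert (H0 := Cmod_ge_0 v).
apply Rle_trans with (Cmod (Cexp z) * (8 * Cmod v ^ 2)); [apply Rmult_le_compat_l; lra|].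
replace (Cmod (Cexp z) * (8 * Cmod v ^ 2)) with (M * Cmod v * Cmod v) by (unfold M; ring).
apply Rmult_le_compat_r; [assumption|].
apply Rmult_lt_compat_l with (r := M) in Hw2; [|assumption].
replace (M * (eps / M)) with eps in Hw2 by (field; lra). lra.
Qed.

Lemma ex_Cder_Cexp (z : C) : ex_Cder Cexp z.
Proof. exists (Cexp z). apply is_Cder_Cexp. Qed.

Lemma Re_div_Cmod_bound (z : C) : z <> 0%C -> -1 <= Re z / Cmod z <= 1.
Proof.
intros Hz. apply Cmod_gt_0 in Hz. assert (H := re_le_Cmod z).
apply Rabs_le_between in H. split; apply Rmult_le_reg_r with (Cmod z); trivial;
unfold Rdiv; rewrite Rmult_assoc, Rinv_l; lra.
Qed.

Lemma Carg_bound (z : C) : - PI <= Carg z <= PI.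
Proof.
unfold Carg. assert (H := acos_bound (Re z / Cmod z)). assert (H0 := PI_RGT_0).
destruct (Rle_dec 0 (Im z)); lra.
Qed.

Lemma Carg_slit (z : C) : Im z <> 0 \/ 0 < Re z -> Rabs (Carg z) < PI.
Proof.
intros Hz.
assert (Hz0 : z <> 0%C).
{ intros E. rewrite E in Hz. unfold Re, Im in Hz; simpl in Hz. lra. }
assert (Hm : 0 < Cmod z) by now apply Cmod_gt_0.
assert (H1 := Re_div_Cmod_bound z Hz0).
assert (H : acos (Re z / Cmod z) < PI).
{ destruct (proj2 (acos_bound (Re z / Cmod z))) as [H2|H2]; [assumption|exfalso].
  apply (f_equal cos) in H2. rewrite cos_acos, cos_PI in H2 by assumption.
  assert (E : Re z = - Cmod z).
  { replace (Re z) with (Re z / Cmod z * Cmod z) by (field; lra). rewrite H2. ring. }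
    assert (S := Cmod2_alt z). rewrite E in S.
    assert (Im z = 0) by nra. lra. }
assert (H0 := acos_bound (Re z / Cmod z)). assert (Hpi := PI_RGT_0).
unfold Carg. destruct (Rle_dec 0 (Im z)); apply Rabs_def1; lra.
Qed.

Lemma Clog_Cexp (v : C) : Rabs (Im v) < PI -> Clog (Cexp v) = v.
Proof.
intros Hv. unfold Clog. rewrite Cmod_Cexp, ln_exp. destruct v as [a b].
unfold Im in Hv; simpl in Hv. apply Rabs_def2 in Hv. f_equal.
unfold Carg. rewrite Cmod_Cexp. unfold Cexp, Re, Im; simpl.
assert (He := exp_pos a).
replace (exp a * cos b / exp a) with (cos b) by (field; lra).
destruct (Rle_dec 0 b) as [Hb|Hb].
- assert (Hs := sin_ge_0 b Hb ltac:(lra)).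
  destruct (Rle_dec 0 (exp a * sin b)) as [_|n]; [apply acos_cos; lra|nra].
- assert (Hs := sin_gt_0 (- b) ltac:(lra) ltac:(lra)). rewrite sin_neg in Hs.
  destruct (Rle_dec 0 (exp a * sin b)) as [n|_]; [nra|].
  rewrite <- cos_neg, acos_cos by lra. ring.
Qed.

Lemma Re_polar (z : C) : z <> 0%C -> Re z = Cmod z * cos (Carg z).
Proof.
intros Hz. assert (H := Cexp_Clog z Hz). apply (f_equal fst) in H.
unfold Cexp, Clog, Re, Im in H; simpl in H. rewrite exp_ln in H; [now rewrite H|now apply Cmod_gt_0].
Qed.

Lemma Im_polar (z : C) : z <> 0%C -> Im z = Cmod z * sin (Carg z).
Proof.
intros Hz. assert (H := Cexp_Clog z Hz). apply (f_equal snd) in H.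
unfold Cexp, Clog, Re, Im in H; simpl in H. rewrite exp_ln in H; [now rewrite H|now apply Cmod_gt_0].
Qed.

Lemma Re_pos_neq_0 (z : C) : 0 < Re z -> z <> 0%C.
Proof. intros H E. rewrite E in H. unfold Re in H; simpl in H. lra. Qed.

Lemma Carg_bound_half (z : C) : 0 < Re z -> Rabs (Carg z) < PI / 2.
Proof.
intros Hz. assert (H0 := Re_pos_neq_0 z Hz).
assert (Hm : 0 < Cmod z) by now apply Cmod_gt_0.
assert (H := Carg_slit z (or_intror Hz)). rewrite (Re_polar z H0) in Hz.
assert (Hc : 0 < cos (Carg z)) by nra.
rewrite <- (cos_neg (Carg z)) in Hc. 
destruct (Rlt_le_dec (Rabs (Carg z)) (PI / 2)) as [Hl|Hl]; [assumption|exfalso].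
assert (Hcc : cos (Rabs (Carg z)) <= 0) by (apply cos_le_0; lra).
unfold Rabs in Hcc. destruct (Rcase_abs (Carg z)); [|rewrite cos_neg in Hc]; lra.
Qed.

(* [theta cos theta <= sin theta] by the mean value theorem *)
Lemma Carg_le_ratio (z : C) : 0 < Re z -> Rabs (Carg z) <= Rabs (Im z) / Re z.
Proof.
intros Hz. assert (H0 := Re_pos_neq_0 z Hz).
assert (Hm : 0 < Cmod z) by now apply Cmod_gt_0.
assert (H := Carg_bound_half z Hz).
set (t := Rabs (Carg z)) in *. assert (Ht : 0 <= t) by apply Rabs_pos.
assert (Hc : Re z = Cmod z * cos t).
{ rewrite (Re_polar z H0). unfold t, Rabs. destruct (Rcase_abs (Carg z)); now rewrite ?cos_neg. }
assert (Hst : 0 <= sin t) by (apply sin_ge_0; lra).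
assert (Hs : Rabs (Im z) = Cmod z * sin t).
{ rewrite (Im_polar z H0), Rabs_mult, (Rabs_pos_eq (Cmod z)) by lra. f_equal.
  rewrite <- (Rabs_pos_eq (sin t)) by assumption.
  unfold t, Rabs at 3. destruct (Rcase_abs (Carg z)); rewrite ?sin_neg, ?Rabs_Ropp; reflexivity. }
destruct (MVT_gen sin 0 t cos) as [c [Hcc Ec]].
- intros x _. auto_derive; trivial; ring.
- intros x _. apply continuity_sin.
- rewrite sin_0, !Rminus_0_r in Ec. rewrite Rmin_left, Rmax_right in Hcc by assumption.
  assert (Hcos : cos t <= cos c) by (apply cos_decr_1; lra).
  apply Rmult_le_reg_r with (Re z); [assumption|].
  unfold Rdiv. rewrite Rmult_assoc, Rinv_l, Rmult_1_r by lra.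
  rewrite Hs, Hc, Ec.
  replace (t * (Cmod z * cos t)) with (Cmod z * (cos t * t)) by ring.
  apply Rmult_le_compat_l; [lra|]. now apply Rmult_le_compat_r.
Qed.

(** Modulus and argument contribute [2 r] each: [ln] is controlled on both sides by
    [1 + t <= exp t], the argument by [Carg_le_ratio] with [Re u >= 1 / 2]. *)
Lemma Clog_small (u : C) : Cmod (u - 1) <= 1 / 2 -> Cmod (Clog u) <= 4 * Cmod (u - 1).
Proof.
intros Hu. set (r := Cmod (u - 1)) in *.
assert (H0 : 0 <= r) by apply Cmod_ge_0.
assert (Hr := re_le_Cmod (u - 1)). assert (Hi := Im_le_Cmod (u - 1)). fold r in Hr, Hi.
replace (Re (u - 1)) with (Re u - 1) in Hr by (destruct u; unfold Re; simpl; ring).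
replace (Im (u - 1)) with (Im u) in Hi by (destruct u; unfold Im; simpl; ring).
apply Rabs_le_between in Hr.
assert (Hpos : 0 < Re u) by lra.
assert (Ha := Carg_le_ratio u Hpos).
assert (Ha' : Rabs (Carg u) <= 2 * r).
{ apply Rle_trans with (1 := Ha). apply Rmult_le_reg_r with (Re u); [assumption|].
  unfold Rdiv. rewrite Rmult_assoc, Rinv_l by lra. nra. }
assert (Hm1 := Cmod_triangle 1 (u - 1)). replace (1 + (u - 1))%C with u in Hm1 by ring.
assert (Hm2 := Cmod_triangle_rev 1 (u - 1)). replace (1 + (u - 1))%C with u in Hm2 by ring.
rewrite Cmod_1 in Hm1, Hm2. fold r in Hm1, Hm2.
assert (Hl : Rabs (ln (Cmod u)) <= 2 * r).
{ assert (Hmu : 0 < Cmod u) by lra.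
  assert (H1 := exp_ineq1_le (ln (Cmod u))). rewrite exp_ln in H1 by assumption.
  assert (H2 := exp_ineq1_le (- ln (Cmod u))). rewrite exp_Ropp, exp_ln in H2 by assumption.
  assert (H3 : / Cmod u <= 1 + 2 * r).
  { apply Rmult_le_reg_r with (Cmod u); [assumption|]. rewrite Rinv_l by lra. nra. }
  apply Rabs_le. lra. }
eapply Rle_trans; [apply Cmod_le_Re_Im|]. unfold Clog, Re, Im; simpl. lra.
Qed.

(** With [w = Cexp v] the linearisation error of [Clog] is, up to sign, the Taylor remainder of
    [Cexp] at [v], and [|v| <= 4 |w - 1|]. Hence 128, which is [8 * 4^2]. *)
Lemma is_Cder_Clog_1 : is_Cder Clog (RtoC 1) (RtoC 1).
Proof.
apply is_Cder_eps. intros eps He.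
exists (Rmin (1 / 8) (eps / 128)). split; [apply Rmin_pos; lra|].
intros w Hw.
assert (Hw1 : Cmod (w - 1) < 1 / 8) by (eapply Rlt_le_trans; [exact Hw|apply Rmin_l]).
assert (Hw2 : Cmod (w - 1) < eps / 128) by (eapply Rlt_le_trans; [exact Hw|apply Rmin_r]).
rewrite Clog_RtoC, ln_1 by lra.
set (v := Clog w).
assert (Hv : Cmod v <= 4 * Cmod (w - 1)) by (apply Clog_small; lra).
assert (Hw0 : w <> 0%C).
{ intros E. rewrite E in Hw1. replace (0 - 1)%C with (- (1))%C in Hw1 by ring.
  rewrite Cmod_m1 in Hw1. lra. }
assert (E : w = Cexp v) by (symmetry; now apply Cexp_Clog).
replace (v - 0 - (w - 1) * 1)%C with (- (Cexp v - 1 - v))%C by (rewrite <- E; ring).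
rewrite Cmod_opp. assert (H := Cexp_taylor v ltac:(lra)).
assert (H0 := Cmod_ge_0 v). assert (H1 := Cmod_ge_0 (w - 1)).
set (r := Cmod (w - 1)) in *.
assert (Cmod v ^ 2 <= 16 * r * r).
{ replace (16 * r * r) with ((4 * r) ^ 2) by ring. apply pow_incr; lra. }
nra.
Qed.

Lemma Clog_mult (u v : C) : u <> 0%C -> v <> 0%C -> Rabs (Carg u + Carg v) < PI ->
  Clog (u * v) = (Clog u + Clog v)%C.
Proof.
intros Hu Hv H. rewrite <- (Clog_Cexp (Clog u + Clog v)) by assumption.
rewrite Cexp_plus, !Cexp_Clog by assumption. reflexivity.
Qed.

(** Differentiability is transported from 1 by [Clog w = Clog z + Clog (w / z)], valid for [w] near
    [z] because [z] keeps a positive angular distance from the cut. *)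
Lemma ex_Cder_Clog (z : C) : Im z <> 0 \/ 0 < Re z -> ex_Cder Clog z.
Proof.
intros Hz. assert (Ha := Carg_slit z Hz).
assert (Hz0 : z <> 0%C).
{ intros E. rewrite E in Hz. unfold Re, Im in Hz; simpl in Hz. lra. }
apply ex_Cder_ext_loc with (fun w => Clog z + Clog (w / z))%C.
2: { apply ex_Cder_plus; [apply ex_Cder_const|]. apply (ex_Cder_comp Clog (fun w => w / z)%C).
  - assert (E1 : (z / z)%C = RtoC 1) by now field.
    assert (G : ex_Cder Clog (z / z)%C) by (rewrite E1; exists (RtoC 1); apply is_Cder_Clog_1).
    exact G.
  - apply ex_Cder_div; [assumption|apply ex_Cder_id|apply ex_Cder_const]. }
(* By [Clog_small], [|w / z - 1| < e] gives [|Carg (w / z)| < 4 e <= PI - |Carg z|], so the sum of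
   the arguments stays within [(-PI, PI)]. *)
set (e := Rmin (1 / 2) ((PI - Rabs (Carg z)) / 4)).
assert (He : 0 < e) by (apply Rmin_pos; lra).
assert (Hm : 0 < Cmod z) by now apply Cmod_gt_0.
exists (e * Cmod z). split; [now apply Rmult_lt_0_compat|].
intros w Hw.
assert (Hd : Cmod (w / z - 1) < e).
{ replace (w / z - 1)%C with ((w - z) / z)%C by now field.
  rewrite Cmod_div by assumption. apply Rmult_lt_reg_r with (Cmod z); [assumption|].
  unfold Rdiv. rewrite Rmult_assoc, Rinv_l by lra. lra. }
assert (He1 : e <= 1 / 2) by apply Rmin_l.
assert (He2 : e <= (PI - Rabs (Carg z)) / 4) by apply Rmin_r.
assert (Hs := Clog_small (w / z) ltac:(lra)).
assert (Hi := Im_le_Cmod (Clog (w / z))). unfold Clog at 1, Im in Hi; simpl in Hi.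
assert (Hwz : (w / z)%C <> 0%C).
{ intros E. rewrite E in Hd. replace (0 - 1)%C with (- (1))%C in Hd by ring.
  rewrite Cmod_m1 in Hd. lra. }
rewrite <- Clog_mult; trivial.
- f_equal. now field.
- eapply Rle_lt_trans; [apply Rabs_triang|]. lra.
Qed.

(** A quarter turn takes the open fourth quadrant to the first without meeting the cut. This is the
    increment picked up at each corner in the winding number of a rectangle. *)
Lemma Clog_mult_Ci (u : C) : 0 < Re u -> Im u < 0 -> (Clog (Ci * u) - Clog u)%C = (Ci * (PI / 2))%C.
Proof.
intros Hr Hi. assert (H0 := Re_pos_neq_0 u Hr). assert (H := Carg_bound_half u Hr).
assert (Hpi := PI_RGT_0). apply Rabs_def2 in H.
assert (E : Clog Ci = (Ci * (PI / 2))%C).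
{ rewrite <- (Clog_Cexp (Ci * (PI / 2))).
  - f_equal. unfold Cexp, Ci, RtoC, Cmult, Cdiv, Cinv, Re, Im; simpl.
    replace (_ * _ - _) with 0 by field.
    replace (0 * _ + _) with (PI / 2) by field. rewrite exp_0, cos_PI2, sin_PI2. f_equal; ring.
  - unfold Ci, RtoC, Cmult, Cdiv, Cinv, Re, Im; simpl.
    replace (0 * _ + _) with (PI / 2) by field. rewrite Rabs_pos_eq; lra. }
assert (Ea : Carg Ci = PI / 2).
{ apply (f_equal snd) in E. unfold Clog in E. simpl snd in E at 1. rewrite E.
  unfold Ci, RtoC, Cmult, Cdiv, Cinv, Re, Im; simpl. field. }
rewrite Clog_mult, E; trivial.
- ring.
- intros e. apply (f_equal snd) in e. unfold Ci in e; simpl in e. lra.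
- rewrite Ea. apply Rabs_def1; lra.
Qed.

(** * Integrals over boundaries of rectangles *)

Lemma is_derive_eps (g : R -> R) (x l : R) :
  (forall eps, 0 < eps -> exists delta, 0 < delta /\ forall t,
     Rabs (t - x) < delta -> Rabs (g t - g x - (t - x) * l) <= eps * Rabs (t - x)) ->
  is_derive g x l.
Proof.
intros H. split; [apply is_linear_scal_l|].
intros y Hy. assert (E := is_filter_lim_locally_unique (V := AbsRing_NormedModule R_AbsRing) x y Hy).
subst y. intros eps. destruct (H eps (cond_pos eps)) as [del [Hd Hdel]].
exists (mkposreal del Hd). intros w Hw. exact (Hdel w Hw).
Qed.

Lemma continuous_eps (g : R -> R) (x : R) :
  (forall eps, 0 < eps -> exists delta, 0 < delta /\ forall t,
     Rabs (t - x) < delta -> Rabs (g t - g x) < eps) ->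
  continuous g x.
Proof.
intros H P [eps HP]. destruct (H eps (cond_pos eps)) as [del [Hd Hdel]].
exists (mkposreal del Hd). intros w Hw. apply HP. exact (Hdel w Hw).
Qed.

Lemma fst_le_Cmod (z : C) : Rabs (fst z) <= Cmod z.
Proof. exact (re_le_Cmod z). Qed.

Lemma snd_le_Cmod (z : C) : Rabs (snd z) <= Cmod z.
Proof. exact (Im_le_Cmod z). Qed.

Lemma Cmod_horizontal (t x c : R) : Cmod ((t, c) - (x, c)) = Rabs (t - x).
Proof.
replace ((t, c) - (x, c))%C with (RtoC (t - x)).
- apply Cmod_R.
- unfold RtoC, Cminus, Cplus, Copp; simpl; f_equal; ring.
Qed.

Lemma Cmod_vertical (t y b : R) : Cmod ((b, t) - (b, y)) = Rabs (t - y).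
Proof.
replace ((b, t) - (b, y))%C with (Ci * RtoC (t - y))%C.
- rewrite Cmod_mult, Cmod_Ci, Cmod_R. ring.
- unfold Ci, RtoC, Cminus, Cmult, Cplus, Copp; simpl; f_equal; ring.
Qed.

Definition continuous2 (f : R -> C) (t : R) : Prop :=
  continuous (fun t => fst (f t)) t /\ continuous (fun t => snd (f t)) t.

Lemma continuous2_horizontal (g : C -> C) (x c : R) :
  Ccont g (x, c) -> continuous2 (fun t => g (t, c)) x.
Proof.
intros H. rewrite Ccont_eps in H. split; apply continuous_eps; intros eps He;
destruct (H eps He) as [del [Hd Hdel]]; exists del; split; trivial; intros t Ht;
specialize (Hdel (t, c)); rewrite Cmod_horizontal in Hdel; specialize (Hdel Ht).
- eapply Rle_lt_trans; [apply (fst_le_Cmod (g (t, c) - g (x, c)))|assumption].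
- eapply Rle_lt_trans; [apply (snd_le_Cmod (g (t, c) - g (x, c)))|assumption].
Qed.

Lemma continuous2_vertical (g : C -> C) (b y : R) :
  Ccont g (b, y) -> continuous2 (fun t => g (b, t)) y.
Proof.
intros H. rewrite Ccont_eps in H. split; apply continuous_eps; intros eps He;
destruct (H eps He) as [del [Hd Hdel]]; exists del; split; trivial; intros t Ht;
specialize (Hdel (b, t)); rewrite Cmod_vertical in Hdel; specialize (Hdel Ht).
- eapply Rle_lt_trans; [apply (fst_le_Cmod (g (b, t) - g (b, y)))|assumption].
- eapply Rle_lt_trans; [apply (snd_le_Cmod (g (b, t) - g (b, y)))|assumption].
Qed.

Lemma is_derive_horizontal (G : C -> C) (x c : R) (l : C) :
  is_Cder G (x, c) l ->
  is_derive (fun t => fst (G (t, c))) x (fst l) /\ is_derive (fun t => snd (G (t, c))) x (snd l).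
Proof.
intros H. rewrite is_Cder_eps in H. split; apply is_derive_eps; intros eps He;
destruct (H eps He) as [del [Hd Hdel]]; exists del; split; trivial; intros t Ht;
specialize (Hdel (t, c)); rewrite Cmod_horizontal in Hdel; specialize (Hdel Ht);
eapply Rle_trans; [|exact Hdel| |exact Hdel];
[eapply Rle_trans; [|apply fst_le_Cmod]|eapply Rle_trans; [|apply snd_le_Cmod]];
apply Req_le; f_equal; simpl; ring.
Qed.

Lemma is_derive_vertical (G : C -> C) (b y : R) (l : C) :
  is_Cder G (b, y) l ->
  is_derive (fun t => fst (G (b, t))) y (fst (Ci * l)%C) /\
  is_derive (fun t => snd (G (b, t))) y (snd (Ci * l)%C).
Proof.
intros H. rewrite is_Cder_eps in H. split; apply is_derive_eps; intros eps He;
destruct (H eps He) as [del [Hd Hdel]]; exists del; split; trivial; intros t Ht;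
specialize (Hdel (b, t)); rewrite Cmod_vertical in Hdel; specialize (Hdel Ht);
eapply Rle_trans; [|exact Hdel| |exact Hdel];
[eapply Rle_trans; [|apply fst_le_Cmod]|eapply Rle_trans; [|apply snd_le_Cmod]];
apply Req_le; f_equal; simpl; ring.
Qed.

Definition RIntC (f : R -> C) (a b : R) : C :=
  (RInt (fun t => fst (f t)) a b, RInt (fun t => snd (f t)) a b).

Definition ex_RIntC (f : R -> C) (a b : R) : Prop :=
  ex_RInt (fun t => fst (f t)) a b /\ ex_RInt (fun t => snd (f t)) a b.

Lemma ex_RIntC_continuous (f : R -> C) (a b : R) :
  a <= b -> (forall t, a <= t <= b -> continuous2 f t) -> ex_RIntC f a b.
Proof.
intros Hab H. split; apply (@ex_RInt_continuous R_CompleteNormedModule); intros t Ht;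
rewrite Rmin_left, Rmax_right in Ht by assumption; now apply H.
Qed.

Lemma RIntC_ext (f g : R -> C) (a b : R) :
  a <= b -> (forall t, a <= t <= b -> f t = g t) -> RIntC f a b = RIntC g a b.
Proof.
intros Hab H. unfold RIntC. f_equal; apply RInt_ext; intros t Ht;
rewrite Rmin_left, Rmax_right in Ht by assumption; rewrite H; lra.
Qed.

Lemma RIntC_plus (f g : R -> C) (a b : R) :
  ex_RIntC f a b -> ex_RIntC g a b -> RIntC (fun t => f t + g t)%C a b = (RIntC f a b + RIntC g a b)%C.
Proof.
intros [H1 H2] [H3 H4]. unfold RIntC, Cplus; simpl.
f_equal; now apply (@RInt_plus R_CompleteNormedModule).
Qed.

Lemma RIntC_scal (k : C) (f : R -> C) (a b : R) :
  ex_RIntC f a b -> RIntC (fun t => k * f t)%C a b = (k * RIntC f a b)%C.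
Proof.
intros [H1 H2]. destruct k as [p q]. unfold RIntC, Cmult; simpl.
f_equal.
- transitivity (RInt (fun t => minus (scal p (fst (f t))) (scal q (snd (f t)))) a b); [reflexivity|].
  rewrite (@RInt_minus R_CompleteNormedModule);
    try now apply (@ex_RInt_scal R_CompleteNormedModule).
  rewrite !(@RInt_scal R_CompleteNormedModule) by assumption. reflexivity.
- transitivity (RInt (fun t => plus (scal p (snd (f t))) (scal q (fst (f t)))) a b); [reflexivity|].
  rewrite (@RInt_plus R_CompleteNormedModule);
    try now apply (@ex_RInt_scal R_CompleteNormedModule).
  rewrite !(@RInt_scal R_CompleteNormedModule) by assumption. reflexivity.
Qed.

Lemma RIntC_Chasles (f : R -> C) (a m b : R) :
  ex_RIntC f a m -> ex_RIntC f m b -> RIntC f a b = (RIntC f a m + RIntC f m b)%C.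
Proof.
intros [H1 H2] [H3 H4]. unfold RIntC, Cplus; simpl.
f_equal; symmetry; now apply (@RInt_Chasles R_CompleteNormedModule).
Qed.

(** The factor 2 comes from bounding the real and the imaginary integrals separately; it only enters
    constants. *)
Lemma RIntC_le (f : R -> C) (g : R -> R) (a b : R) :
  a <= b -> ex_RIntC f a b -> ex_RInt g a b -> (forall t, a <= t <= b -> Cmod (f t) <= g t) ->
  Cmod (RIntC f a b) <= 2 * RInt g a b.
Proof.
intros Hab [H1 H2] Hg H.
eapply Rle_trans; [apply Cmod_le_Re_Im|]. unfold RIntC, Re, Im; simpl.
assert (A : forall u : R -> R, ex_RInt u a b -> (forall t, a <= t <= b -> Rabs (u t) <= g t) ->
  Rabs (RInt u a b) <= RInt g a b).
{ intros u Hu Hl. apply (norm_RInt_le (V := R_NormedModule) u g a b); trivial;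
    apply (@RInt_correct R_CompleteNormedModule); assumption. }
assert (A1 := A _ H1 (fun t Ht => Rle_trans _ _ _ (fst_le_Cmod _) (H t Ht))).
assert (A2 := A _ H2 (fun t Ht => Rle_trans _ _ _ (snd_le_Cmod _) (H t Ht))).
lra.
Qed.

Lemma RIntC_bound (f : R -> C) (M a b : R) :
  a <= b -> ex_RIntC f a b -> (forall t, a <= t <= b -> Cmod (f t) <= M) ->
  Cmod (RIntC f a b) <= 2 * M * (b - a).
Proof.
intros Hab Hf H. assert (A := RIntC_le f (fun _ => M) a b Hab Hf (ex_RInt_const a b M) H).
rewrite RInt_const in A. unfold scal, mult in A; simpl in A. unfold mult in A; simpl in A. lra.
Qed.

Lemma RIntC_derive (f F : R -> C) (a b : R) :
  a <= b -> (forall t, a <= t <= b -> continuous2 f t) ->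
  (forall t, a <= t <= b -> is_derive (fun t => fst (F t)) t (fst (f t)) /\
                            is_derive (fun t => snd (F t)) t (snd (f t))) ->
  RIntC f a b = (F b - F a)%C.
Proof.
intros Hab Hc Hd. unfold RIntC.
apply injective_projections; simpl; apply is_RInt_unique;
[apply (is_RInt_derive (V := R_CompleteNormedModule) (fun t => fst (F t)) (fun t => fst (f t)))
|apply (is_RInt_derive (V := R_CompleteNormedModule) (fun t => snd (F t)) (fun t => snd (f t)))];
intros t Ht; rewrite Rmin_left, Rmax_right in Ht by assumption;
first [apply (Hd t Ht) | apply (Hc t Ht)].
Qed.

(** The counterclockwise contour integral over the boundary of [[a, b] x [c, d]]; the factor [Ci] is
    [dz = i dy] on the vertical sides. *)
Definition RIntC_rect (g : C -> C) (a b c d : R) : C :=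
  (RIntC (fun x => g (x, c)) a b + Ci * RIntC (fun y => g (b, y)) c d
   - RIntC (fun x => g (x, d)) a b - Ci * RIntC (fun y => g (a, y)) c d)%C.

Definition on_boundary (P : C -> Prop) (a b c d : R) : Prop :=
  (forall x, a <= x <= b -> P (x, c) /\ P (x, d)) /\
  (forall y, c <= y <= d -> P (a, y) /\ P (b, y)).

Definition on_rect (P : C -> Prop) (a b c d : R) : Prop :=
  forall x y, a <= x <= b -> c <= y <= d -> P (x, y).

Lemma on_rect_boundary (P : C -> Prop) (a b c d : R) :
  a <= b -> c <= d -> on_rect P a b c d -> on_boundary P a b c d.
Proof. intros Hab Hcd H. split; intros; split; apply H; lra. Qed.

Lemma on_boundary_imp (P Q : C -> Prop) (a b c d : R) :
  (forall z, P z -> Q z) -> on_boundary P a b c d -> on_boundary Q a b c d.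
Proof. intros H [H1 H2]. split; intros t Ht; split; apply H; now (apply H1 || apply H2). Qed.

Lemma on_boundary_and (P Q : C -> Prop) (a b c d : R) :
  on_boundary P a b c d -> on_boundary Q a b c d -> on_boundary (fun z => P z /\ Q z) a b c d.
Proof.
intros [H1 H2] [H3 H4]. split; intros t Ht; repeat split;
now (apply H1 || apply H2 || apply H3 || apply H4).
Qed.

Lemma ex_RIntC_boundary (g : C -> C) (a b c d : R) :
  a <= b -> c <= d -> on_boundary (Ccont g) a b c d ->
  ex_RIntC (fun x => g (x, c)) a b /\ ex_RIntC (fun x => g (x, d)) a b /\
  ex_RIntC (fun y => g (a, y)) c d /\ ex_RIntC (fun y => g (b, y)) c d.
Proof.
intros Hab Hcd [H1 H2]. repeat split;
apply (@ex_RInt_continuous R_CompleteNormedModule); intros t Ht;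
rewrite Rmin_left, Rmax_right in Ht by assumption;
first [apply (continuous2_horizontal g) | apply (continuous2_vertical g)];
now (apply H1 || apply H2).
Qed.

Section Rect_integral.
Variables (a b c d : R).
Hypotheses (Hab : a <= b) (Hcd : c <= d).

Lemma RIntC_rect_ext (f g : C -> C) :
  on_boundary (fun z => f z = g z) a b c d -> RIntC_rect f a b c d = RIntC_rect g a b c d.
Proof.
intros [H1 H2]. unfold RIntC_rect.
rewrite (RIntC_ext (fun x => f (x, c)) (fun x => g (x, c))),
  (RIntC_ext (fun x => f (x, d)) (fun x => g (x, d))),
  (RIntC_ext (fun x => f (a, x)) (fun x => g (a, x))),
  (RIntC_ext (fun x => f (b, x)) (fun x => g (b, x))); trivial; intros t Ht;
now (apply H1 || apply H2).
Qed.

Lemma RIntC_rect_plus (f g : C -> C) :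
  on_boundary (Ccont f) a b c d -> on_boundary (Ccont g) a b c d ->
  RIntC_rect (fun z => f z + g z)%C a b c d = (RIntC_rect f a b c d + RIntC_rect g a b c d)%C.
Proof.
intros Hf Hg. apply ex_RIntC_boundary in Hf; apply ex_RIntC_boundary in Hg; trivial.
unfold RIntC_rect. rewrite !RIntC_plus by tauto. ring.
Qed.

Lemma RIntC_rect_scal (k : C) (f : C -> C) :
  on_boundary (Ccont f) a b c d ->
  RIntC_rect (fun z => k * f z)%C a b c d = (k * RIntC_rect f a b c d)%C.
Proof.
intros Hf. apply ex_RIntC_boundary in Hf; trivial.
unfold RIntC_rect. rewrite !RIntC_scal by tauto. ring.
Qed.

Lemma RIntC_rect_bound (f : C -> C) (M : R) :
  on_boundary (Ccont f) a b c d -> on_boundary (fun z => Cmod (f z) <= M) a b c d ->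
  Cmod (RIntC_rect f a b c d) <= 4 * M * ((b - a) + (d - c)).
Proof.
intros Hf [H1 H2]. apply ex_RIntC_boundary in Hf; trivial. unfold RIntC_rect.
assert (B1 := RIntC_bound (fun x => f (x, c)) M a b Hab ltac:(tauto) (fun t Ht => proj1 (H1 t Ht))).
assert (B2 := RIntC_bound (fun x => f (x, d)) M a b Hab ltac:(tauto) (fun t Ht => proj2 (H1 t Ht))).
assert (B3 := RIntC_bound (fun x => f (a, x)) M c d Hcd ltac:(tauto) (fun t Ht => proj1 (H2 t Ht))).
assert (B4 := RIntC_bound (fun x => f (b, x)) M c d Hcd ltac:(tauto) (fun t Ht => proj2 (H2 t Ht))).
unfold Cminus.
eapply Rle_trans; [apply Cmod_triangle|]. rewrite Cmod_opp, Cmod_mult, Cmod_Ci, Rmult_1_l.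
eapply Rle_trans; [apply Rplus_le_compat_r, Cmod_triangle|]. rewrite Cmod_opp.
eapply Rle_trans; [apply Rplus_le_compat_r, Rplus_le_compat_r, Cmod_triangle|].
rewrite Cmod_mult, Cmod_Ci, Rmult_1_l. lra.
Qed.

Lemma RIntC_rect_primitive (g G : C -> C) :
  on_boundary (Ccont g) a b c d -> on_boundary (fun z => is_Cder G z (g z)) a b c d ->
  RIntC_rect g a b c d = 0%C.
Proof.
intros Hg [H1 H2]. assert (Hx := ex_RIntC_boundary g a b c d Hab Hcd Hg). destruct Hg as [Hg1 Hg2].
unfold RIntC_rect. rewrite <- !RIntC_scal by tauto.
rewrite (RIntC_derive (fun x => g (x, c)) (fun x => G (x, c))),
  (RIntC_derive (fun x => g (x, d)) (fun x => G (x, d))),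
  (RIntC_derive (fun x => Ci * g (a, x))%C (fun x => G (a, x))),
  (RIntC_derive (fun x => Ci * g (b, x))%C (fun x => G (b, x))); trivial.
{ ring. }
all: intros t Ht.
2,4: apply is_derive_vertical; now apply H2.
3,5: apply continuous2_horizontal; now apply Hg1.
3,4: apply is_derive_horizontal; now apply H1.
all: apply (continuous2_vertical (fun z => Ci * g z)%C), Ccont_mult;
  [apply ex_Cder_cont, ex_Cder_const|now apply Hg2].
Qed.

End Rect_integral.

Lemma RIntC_rect_affine (k l : C) (a b c d : R) :
  a <= b -> c <= d -> RIntC_rect (fun z => k + l * z)%C a b c d = 0%C.
Proof.
intros Hab Hcd. apply RIntC_rect_primitive with (fun z => k * z + l / 2 * (z * z))%C; trivial;
apply on_rect_boundary; trivial; intros x y _ _.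
- apply ex_Cder_cont, ex_Cder_plus; [apply ex_Cder_const|].
  apply ex_Cder_mult; [apply ex_Cder_const|apply ex_Cder_id].
- set (z := (x, y) : C).
  assert (H : is_Cder (fun z => k * z + l / 2 * (z * z))%C z
     ((0 * z + k * 1) + (0 * (z * z) + l / 2 * (1 * z + z * 1)))%C).
  { apply is_Cder_plus.
    - apply (is_Cder_mult (fun _ => k) (fun z => z)); [apply is_Cder_const|apply is_Cder_id].
    - apply (is_Cder_mult (fun _ => l / 2)%C (fun z => z * z)%C); [apply is_Cder_const|].
      apply (is_Cder_mult (fun z => z) (fun z => z)); apply is_Cder_id. }
  replace (k + l * z)%C with ((0 * z + k * 1) + (0 * (z * z) + l / 2 * (1 * z + z * 1)))%C;
    [exact H|]. field. 
Qed.

Lemma RIntC_rect_split (g : C -> C) (a b c d m n : R) :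
  a <= m <= b -> c <= n <= d -> on_rect (Ccont g) a b c d ->
  RIntC_rect g a b c d = (RIntC_rect g a m c n + RIntC_rect g m b c n + RIntC_rect g a m n d + RIntC_rect g m b n d)%C.
Proof.
intros Hm Hn H.
assert (Hh : forall y u v, c <= y <= d -> a <= u -> u <= v -> v <= b -> ex_RIntC (fun x => g (x, y)) u v).
{ intros y u v Hy Hu Huv Hv. apply ex_RIntC_continuous; trivial. intros t Ht.
  apply continuous2_horizontal, H; lra. }
assert (Hv : forall x u v, a <= x <= b -> c <= u -> u <= v -> v <= d -> ex_RIntC (fun y => g (x, y)) u v).
{ intros x u v Hx Hu Huv Hv. apply ex_RIntC_continuous; trivial. intros t Ht.
  apply continuous2_vertical, H; lra. }
unfold RIntC_rect.
rewrite (RIntC_Chasles (fun x => g (x, c)) a m b) by (apply Hh; lra).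
rewrite (RIntC_Chasles (fun x => g (x, d)) a m b) by (apply Hh; lra).
rewrite (RIntC_Chasles (fun x => g (a, x)) c n d) by (apply Hv; lra).
rewrite (RIntC_Chasles (fun x => g (b, x)) c n d) by (apply Hv; lra).
ring.
Qed.

(** * Repeated quartering of rectangles and point masses *)

Definition half_of (a b a' b' : R) : Prop :=
  (a' = a /\ b' = (a + b) / 2) \/ (a' = (a + b) / 2 /\ b' = b).

Lemma nested_halves (s : nat -> R * R) :
  fst (s 0%nat) < snd (s 0%nat) ->
  (forall n, half_of (fst (s n)) (snd (s n)) (fst (s (S n))) (snd (s (S n)))) ->
  exists x, forall n, fst (s n) <= x <= snd (s n) /\ fst (s n) < snd (s n) /\
    fst (s 0%nat) <= fst (s n) /\ snd (s n) <= snd (s 0%nat) /\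
    snd (s n) - fst (s n) = (snd (s 0%nat) - fst (s 0%nat)) * (/ 2) ^ n.
Proof.
intros H0 Hs.
assert (W : forall n, snd (s n) - fst (s n) = (snd (s 0%nat) - fst (s 0%nat)) * (/ 2) ^ n).
{ induction n as [|n IH]; [simpl; ring|].
  replace ((/ 2) ^ S n) with ((/ 2) ^ n * / 2) by (simpl; ring).
  rewrite <- Rmult_assoc, <- IH. destruct (Hs n) as [[-> ->]|[-> ->]]; field. }
assert (L : forall n, fst (s n) < snd (s n)).
{ intros n. specialize (W n).
  assert (0 < (snd (s 0%nat) - fst (s 0%nat)) * (/ 2) ^ n).
  { apply Rmult_lt_0_compat; [lra|]. apply pow_lt. lra. }
  lra. }
assert (M : forall n k, fst (s n) <= fst (s (k + n)%nat) /\ snd (s (k + n)%nat) <= snd (s n)).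
{ intros n k. induction k as [|k IH]; simpl; [lra|].
  assert (Lk := L (k + n)%nat). destruct (Hs (k + n)%nat) as [[E1 E2]|[E1 E2]];
  change (S k + n)%nat with (S (k + n)); rewrite E1, E2; lra. }
assert (B : forall n k, fst (s n) <= snd (s k)).
{ intros n k. assert (M1 := M n k). assert (M2 := M k n). rewrite (Nat.add_comm n k) in M2.
  assert (Lk := L (k + n)%nat). lra. }
destruct (ex_finite_lim_seq_incr (fun n => fst (s n)) (snd (s 0%nat))) as [x Hx].
- intros n. apply (M n 1%nat).
- intros n. apply B.
- exists x. intros n. split; [|split; [apply L|split; [|split; [|apply W]]]].
  + split.
    * apply (is_lim_seq_incr_compare _ _ Hx). intros k. apply (M k 1%nat).
    * assert (H := is_lim_seq_le (fun k => fst (s k)) (fun _ => snd (s n)) x (snd (s n))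
                    (fun k => B k n) Hx (is_lim_seq_const _)). exact H.
  + assert (H := M 0%nat n). rewrite Nat.add_0_r in H. lra.
  + assert (H := M 0%nat n). rewrite Nat.add_0_r in H. lra.
Qed.

(** A compactness principle for properties that pass from the four quarters to the whole. If [P]
    failed, some quarter would fail, then a quarter of that one, and so on; the failing rectangles
    shrink to a point and contradict the local hypothesis there. *)
Lemma quartering (P : R -> R -> R -> R -> Prop) (a b c d : R) :
  a < b -> c < d ->
  (forall a b c d, a < b -> c < d ->
     (forall a' b' c' d', half_of a b a' b' -> half_of c d c' d' -> P a' b' c' d') -> P a b c d) ->
  (forall x y, a <= x <= b -> c <= y <= d -> exists delta, 0 < delta /\
     forall a' b' c' d', a <= a' <= x -> x <= b' <= b -> c <= c' <= y -> y <= d' <= d ->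
       a' < b' -> c' < d' -> b' - a' < delta -> d' - c' < delta -> P a' b' c' d') ->
  P a b c d.
Proof.
intros Hab Hcd Hq Hl. apply NNPP. intros Hbad.
set (bad := fun r : (R * R) * (R * R) =>
  fst (fst r) < snd (fst r) /\ fst (snd r) < snd (snd r) /\
  ~ P (fst (fst r)) (snd (fst r)) (fst (snd r)) (snd (snd r))).
set (quarter := fun r r' : (R * R) * (R * R) =>
  half_of (fst (fst r)) (snd (fst r)) (fst (fst r')) (snd (fst r')) /\
  half_of (fst (snd r)) (snd (snd r)) (fst (snd r')) (snd (snd r'))).
assert (Hnext : forall r, bad r -> exists r', quarter r r' /\ bad r').
{ intros r [H1 [H2 H3]]. apply NNPP. intros Hn. apply H3, Hq; trivial.
  intros a' b' c' d' Ha Hc. apply NNPP. intros HP. apply Hn.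
  exists ((a', b'), (c', d')). split; [now split|].
  split; [|split; [|exact HP]]; simpl.
  - destruct Ha as [[-> ->]|[-> ->]]; lra.
  - destruct Hc as [[-> ->]|[-> ->]]; lra. }
set (r0 := ((a, b), (c, d))).
(* Choice of a failing quarter; [r0] merely shows that the type is inhabited. *)
set (next := fun r => epsilon (inhabits r0) (fun r' => quarter r r' /\ bad r')).
set (s := fun n => Nat.iter n next r0).
assert (Hs : forall n, bad (s n)).
{ induction n as [|n IH]; [split; [|split]; assumption|].
  apply (epsilon_spec (inhabits r0) (fun r' => quarter (s n) r' /\ bad r')). now apply Hnext. }
assert (Hs' : forall n, quarter (s n) (s (S n))).
{ intros n. apply (epsilon_spec (inhabits r0) (fun r' => quarter (s n) r' /\ bad r')).
  now apply Hnext. }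
destruct (nested_halves (fun n => fst (s n))) as [x Hx]; [exact Hab|intros n; apply (Hs' n)|].
destruct (nested_halves (fun n => snd (s n))) as [y Hy]; [exact Hcd|intros n; apply (Hs' n)|].
destruct (Hl x y) as [del [Hd Hdel]]; [apply (Hx 0%nat)|apply (Hy 0%nat)|].
set (W := Rmax (b - a) (d - c)).
assert (HW : 0 < W) by (eapply Rlt_le_trans; [|apply Rmax_l]; lra).
destruct (pow_lt_1_zero (/ 2)) with (y := del / W) as [N HN].
{ rewrite Rabs_pos_eq; lra. }
{ now apply Rdiv_lt_0_compat. }
specialize (HN N (le_n N)). rewrite Rabs_pos_eq in HN by (apply pow_le; lra).
assert (HN' : W * (/ 2) ^ N < del).
{ apply Rmult_lt_compat_l with (r := W) in HN; [|assumption].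
  replace (W * (del / W)) with del in HN by (field; lra). exact HN. }
assert (Hp : 0 < (/ 2) ^ N) by (apply pow_lt; lra).
assert (W1 : (b - a) * (/ 2) ^ N <= W * (/ 2) ^ N) by (apply Rmult_le_compat_r; [lra|apply Rmax_l]).
assert (W2 : (d - c) * (/ 2) ^ N <= W * (/ 2) ^ N) by (apply Rmult_le_compat_r; [lra|apply Rmax_r]).
destruct (Hs N) as [_ [_ HP]]. apply HP.
destruct (Hx N) as [X1 [X2 [X3 [X4 X5]]]]. destruct (Hy N) as [Y1 [Y2 [Y3 [Y4 Y5]]]].
simpl in X3, X4, X5, Y3, Y4, Y5.
apply Hdel; lra.
Qed.

(* [1/2] at the jump, so that a point on the boundary of a rectangle is shared
   between the adjacent rectangles of a subdivision. *)
Definition jump (u t : R) : R :=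
  if Rlt_dec t u then 0 else if Rlt_dec u t then 1 else / 2.

(** The share of a unit mass at [z]: 1 inside the rectangle, 1/2 on an open side, 1/4 at a corner, 0
    outside. Being a product of increments, it is exactly additive under subdivision. *)
Definition weight (z : C) (a b c d : R) : R :=
  (jump (Re z) b - jump (Re z) a) * (jump (Im z) d - jump (Im z) c).

Lemma jump_incr (u a b : R) : a <= b -> 0 <= jump u b - jump u a.
Proof. intros H. unfold jump. repeat destruct Rlt_dec; lra. Qed.

Lemma jump_in (u a b : R) : a < b -> a <= u <= b -> / 2 <= jump u b - jump u a.
Proof. intros H Hu. unfold jump. repeat destruct Rlt_dec; lra. Qed.

Lemma weight_ge_0 (z : C) (a b c d : R) : a <= b -> c <= d -> 0 <= weight z a b c d.
Proof. intros H1 H2. apply Rmult_le_pos; now apply jump_incr. Qed.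

Lemma weight_in (z : C) (a b c d : R) : a < b -> c < d ->
  a <= Re z <= b -> c <= Im z <= d -> / 4 <= weight z a b c d.
Proof.
intros H1 H2 H3 H4. assert (J1 := jump_in _ _ _ H1 H3). assert (J2 := jump_in _ _ _ H2 H4).
unfold weight. nra.
Qed.

Definition weights (l : list C) (a b c d : R) : R :=
  fold_right (fun z s => weight z a b c d + s) 0 l.

Lemma weights_ge_0 (l : list C) (a b c d : R) : a <= b -> c <= d -> 0 <= weights l a b c d.
Proof.
intros H1 H2. induction l as [|z l IH]; simpl; [lra|].
assert (H := weight_ge_0 z a b c d H1 H2). lra.
Qed.

Lemma weights_in (l : list C) (z : C) (a b c d : R) : In z l -> a < b -> c < d ->
  a <= Re z <= b -> c <= Im z <= d -> / 4 <= weights l a b c d.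
Proof.
intros Hz H1 H2 H3 H4. induction l as [|z' l IH]; [easy|]. simpl.
destruct Hz as [->|Hz].
- assert (H := weight_in z a b c d H1 H2 H3 H4).
  assert (H' := weights_ge_0 l a b c d ltac:(lra) ltac:(lra)). lra.
- specialize (IH Hz). assert (H := weight_ge_0 z' a b c d ltac:(lra) ltac:(lra)). lra.
Qed.

Lemma weights_split (l : list C) (a b c d m n : R) :
  weights l a b c d = weights l a m c n + weights l m b c n + weights l a m n d + weights l m b n d.
Proof.
induction l as [|z l IH]; simpl; [ring|]. rewrite IH. unfold weight. ring.
Qed.

Lemma Cmod_rect_le (x y x' y' r s : R) :
  Rabs (x - x') <= r -> Rabs (y - y') <= s -> Cmod ((x, y) - (x', y')) <= r + s.
Proof.
intros H1 H2. eapply Rle_trans; [apply Cmod_le_Re_Im|]. unfold Re, Im; simpl.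
unfold Rminus in *. lra.
Qed.

(** * Cauchy's theorem for rectangles *)

(** At the points of [l] continuity is enough. The integral is compared with
    [eps * (s^2 + weights)], where [s] is half the perimeter, a budget that is additive under
    quartering. At a point of differentiability the [s^2] part pays for the error of the affine
    approximation; at a point of [l] the weight, at least 1/4, leaves a fixed amount that small
    rectangles do not exhaust. *)
Theorem Goursat (g : C -> C) (l : list C) (a b c d : R) :
  a < b -> c < d -> on_rect (Ccont g) a b c d ->
  on_rect (fun z => In z l \/ ex_Cder g z) a b c d ->
  RIntC_rect g a b c d = 0%C.
Proof.
intros Hab Hcd Hc Hd.
(* Affine functions integrate to zero, so any affine approximation of [g] may be subtracted before
   estimating. *)
assert (HRI : forall k1 k2 z0 a' b' c' d', a <= a' < b' -> b' <= b -> c <= c' < d' -> d' <= d ->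
  RIntC_rect g a' b' c' d' = RIntC_rect (fun z => g z + (k1 + k2 * (z - z0)))%C a' b' c' d').
{ intros k1 k2 z0 a' b' c' d' H1 H2 H3 H4.
  rewrite RIntC_rect_plus; try lra.
  - rewrite (RIntC_rect_ext a' b' c' d' ltac:(lra) ltac:(lra) (fun z => k1 + k2 * (z - z0))%C
      (fun z => (k1 - k2 * z0) + k2 * z)%C).
    + rewrite RIntC_rect_affine by lra. ring.
    + apply on_rect_boundary; try lra. intros x y _ _. ring.
  - apply on_rect_boundary; try lra. intros x y Hx Hy. apply Hc; lra.
  - apply on_rect_boundary; try lra. intros x y _ _.
    apply ex_Cder_cont, ex_Cder_plus; [apply ex_Cder_const|].
    apply ex_Cder_mult; [apply ex_Cder_const|].
    apply ex_Cder_minus; [apply ex_Cder_id|apply ex_Cder_const]. }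
assert (HC : forall k1 k2 z0 a' b' c' d', a <= a' < b' -> b' <= b -> c <= c' < d' -> d' <= d ->
  on_boundary (Ccont (fun z => g z + (k1 + k2 * (z - z0)))%C) a' b' c' d').
{ intros k1 k2 z0 a' b' c' d' H1 H2 H3 H4.
  apply on_rect_boundary; try lra. intros x y Hx Hy. apply Ccont_plus; [apply Hc; lra|].
  apply ex_Cder_cont, ex_Cder_plus; [apply ex_Cder_const|].
  apply ex_Cder_mult; [apply ex_Cder_const|].
  apply ex_Cder_minus; [apply ex_Cder_id|apply ex_Cder_const]. }
assert (Heps : forall eps, 0 < eps ->
  Cmod (RIntC_rect g a b c d) <= eps * (((b - a) + (d - c)) ^ 2 + weights l a b c d)).
{ intros eps He.
  set (P := fun a' b' c' d' => a <= a' < b' -> b' <= b -> c <= c' < d' -> d' <= d ->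
    Cmod (RIntC_rect g a' b' c' d') <= eps * (((b' - a') + (d' - c')) ^ 2 + weights l a' b' c' d')).
  assert (HP : P a b c d); [|apply HP; lra].
  apply quartering; trivial.
  - intros a' b' c' d' H1 H2 HP Ha Hb Hc' Hd'.
    set (m := (a' + b') / 2). set (n := (c' + d') / 2).
    assert (Hm : a' < m < b') by (unfold m; lra). assert (Hn : c' < n < d') by (unfold n; lra).
    rewrite (RIntC_rect_split g a' b' c' d' m n); try lra.
    2: { intros x y Hx Hy. apply Hc; lra. }
    assert (Q1 := HP a' m c' n ltac:(left; tauto) ltac:(left; tauto) ltac:(lra) ltac:(lra) ltac:(lra) ltac:(lra)).
    assert (Q2 := HP m b' c' n ltac:(right; tauto) ltac:(left; tauto) ltac:(lra) ltac:(lra) ltac:(lra) ltac:(lra)).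
    assert (Q3 := HP a' m n d' ltac:(left; tauto) ltac:(right; tauto) ltac:(lra) ltac:(lra) ltac:(lra) ltac:(lra)).
    assert (Q4 := HP m b' n d' ltac:(right; tauto) ltac:(right; tauto) ltac:(lra) ltac:(lra) ltac:(lra) ltac:(lra)).
    eapply Rle_trans; [apply Cmod_triangle|].
    eapply Rle_trans; [apply Rplus_le_compat_r, Cmod_triangle|].
    eapply Rle_trans; [apply Rplus_le_compat_r, Rplus_le_compat_r, Cmod_triangle|].
    eapply Rle_trans; [apply Rplus_le_compat; [apply Rplus_le_compat; [apply Rplus_le_compat; [exact Q1|exact Q2]|exact Q3]|exact Q4]|].
    (* The budget is exactly additive: [4 (s / 2)^2 = s^2], and the weights add up. *)
    rewrite (weights_split l a' b' c' d' m n). right. unfold m, n. field.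
  - intros x y Hx Hy. destruct (Hd x y Hx Hy) as [Hin|[k Hk]].
    + assert (Hcz := Hc x y Hx Hy). rewrite Ccont_eps in Hcz.
      destruct (Hcz 1 Rlt_0_1) as [del [Hdel0 Hdel]].
      (* [del / 4] keeps the rectangle where [|g - g (x, y)| < 1]; with sides below [eps / 32] the
         integral is at most [4 * (eps / 32 + eps / 32) = eps / 4], which the weight of the point
         covers. *)
      exists (Rmin (del / 4) (eps / 32)). split; [apply Rmin_pos; lra|].
      intros a' b' c' d' A1 A2 A3 A4 A5 A6 A7 A8 _ _ _ _.
      assert (M1 := Rmin_l (del / 4) (eps / 32)). assert (M2 := Rmin_r (del / 4) (eps / 32)).
      rewrite (HRI (- g (x, y))%C 0%C 0%C) by lra.
      eapply Rle_trans.
      * apply RIntC_rect_bound with (M := 1); try lra; [apply HC; lra|].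
        apply on_rect_boundary; try lra. intros u v Hu Hv.
        replace (g (u, v) + (- g (x, y) + 0 * ((u, v) - 0)))%C with (g (u, v) - g (x, y))%C by ring.
        left. apply Hdel. apply Rle_lt_trans with (del / 4 + del / 4); [|lra].
        apply Cmod_rect_le; apply Rabs_le; lra.
      * assert (HW := weights_in l (x, y) a' b' c' d' Hin A5 A6 ltac:(unfold Re; simpl; lra) ltac:(unfold Im; simpl; lra)).
        assert (HS := pow2_ge_0 (b' - a' + (d' - c'))).
        apply Rle_trans with (eps * / 4); [lra|]. apply Rmult_le_compat_l; lra.
    + rewrite is_Cder_eps in Hk.
      (* [eps / 4] compensates the 4 in [RIntC_rect_bound], so that exactly [eps * s^2] results. *)
      destruct (Hk (eps / 4)) as [del [Hdel0 Hdel]]; [lra|].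
      exists (del / 4). split; [lra|].
      intros a' b' c' d' A1 A2 A3 A4 A5 A6 A7 A8 _ _ _ _.
      rewrite (HRI (- g (x, y))%C (- k)%C (x, y)) by lra.
      eapply Rle_trans.
      * apply RIntC_rect_bound with (M := eps / 4 * ((b' - a') + (d' - c'))); try lra; [apply HC; lra|].
        apply on_rect_boundary; try lra. intros u v Hu Hv.
        replace (g (u, v) + (- g (x, y) + - k * ((u, v) - (x, y))))%C
          with (g (u, v) - g (x, y) - ((u, v) - (x, y)) * k)%C by ring.
        assert (B : Cmod ((u, v) - (x, y)) <= (b' - a') + (d' - c')) by
          (apply Cmod_rect_le; apply Rabs_le; lra).
        eapply Rle_trans; [apply Hdel; lra|]. apply Rmult_le_compat_l; lra.
      * assert (HW := weights_ge_0 l a' b' c' d' ltac:(lra) ltac:(lra)).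
        apply Rle_trans with (eps * (b' - a' + (d' - c')) ^ 2); [right; field|].
        apply Rmult_le_compat_l; lra. }
apply Cmod_eq_0. apply Rle_antisym; [|apply Cmod_ge_0].
apply Rnot_lt_le. intros Hpos.
set (K := (b - a + (d - c)) ^ 2 + weights l a b c d) in *.
assert (HK : 0 < K).
{ assert (HW := weights_ge_0 l a b c d ltac:(lra) ltac:(lra)).
  assert (0 < (b - a + (d - c)) ^ 2) by (apply pow_lt; lra). unfold K; lra. }
assert (H := Heps (Cmod (RIntC_rect g a b c d) / (2 * K)) ltac:(apply Rdiv_lt_0_compat; lra)).
replace (Cmod (RIntC_rect g a b c d) / (2 * K) * K) with (Cmod (RIntC_rect g a b c d) / 2) in H by (field; lra).
lra.
Qed.

(** * Cauchy's formula and its consequences *)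

Lemma is_Cder_unique (g : C -> C) (z k l : C) : is_Cder g z k -> is_Cder g z l -> k = l.
Proof. intros Hk Hl. rewrite <- (C_derive_is_Cder _ _ _ Hk). now apply C_derive_is_Cder. Qed.

(** Existence being known, differentiating [Cexp (Clog w) = w] forces the value. *)
Lemma is_Cder_Clog (z : C) : Im z <> 0 \/ 0 < Re z -> is_Cder Clog z (/ z)%C.
Proof.
intros Hz. destruct (ex_Cder_Clog z Hz) as [l Hl].
assert (Hz0 : z <> 0%C).
{ intros E. rewrite E in Hz. unfold Re, Im in Hz; simpl in Hz. lra. }
assert (H1 : is_Cder (fun w => w) z (l * z)%C).
{ apply is_Cder_ext_loc with (fun w => Cexp (Clog w)).
  - exists (Cmod z). split; [now apply Cmod_gt_0|]. intros w Hw. apply Cexp_Clog.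
    intros E. rewrite E in Hw. replace (0 - z)%C with (- z)%C in Hw by ring.
    rewrite Cmod_opp in Hw. lra.
  - rewrite <- (Cexp_Clog z Hz0) at 2. apply (is_Cder_comp Cexp Clog); [|exact Hl].
    apply is_Cder_Cexp. }
assert (E := is_Cder_unique _ _ _ _ H1 (is_Cder_id z)).
assert (E2 : @eq C l (/ z)%C).
{ revert E. generalize (l : C). intros k E. transitivity ((k * z) * / z)%C; [now field|]. rewrite E. ring. }
rewrite <- E2. exact Hl.
Qed.

Lemma RIntC_horizontal (g G : C -> C) (a b c : R) :
  a <= b -> (forall t, a <= t <= b -> Ccont g (t, c) /\ is_Cder G (t, c) (g (t, c))) ->
  RIntC (fun x => g (x, c)) a b = (G (b, c) - G (a, c))%C.
Proof.
intros Hab H. apply (RIntC_derive _ (fun x => G (x, c))); trivial; intros t Ht.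
- apply continuous2_horizontal, H; lra.
- apply is_derive_horizontal, H; lra.
Qed.

Lemma RIntC_vertical (g G : C -> C) (b c d : R) :
  c <= d -> (forall t, c <= t <= d -> Ccont g (b, t) /\ is_Cder G (b, t) (g (b, t))) ->
  (Ci * RIntC (fun y => g (b, y)) c d)%C = (G (b, d) - G (b, c))%C.
Proof.
intros Hcd H. rewrite <- RIntC_scal.
- apply (RIntC_derive _ (fun x => G (b, x))); trivial; intros t Ht.
  + apply (continuous2_vertical (fun z => Ci * g z)%C), Ccont_mult;
    [apply ex_Cder_cont, ex_Cder_const|now apply H].
  + apply is_derive_vertical, H; lra.
- apply ex_RIntC_continuous; trivial. intros t Ht. now apply continuous2_vertical, H.
Qed.

Lemma Cminus_neq_0 (w z : C) : w <> z -> (w - z)%C <> 0%C.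
Proof. intros H E. apply H. replace w with (w - z + z)%C by ring. rewrite E. ring. Qed.

Lemma Ccont_inv_minus (z w : C) : w <> z -> Ccont (fun w => / (w - z))%C w.
Proof.
intros H. apply ex_Cder_cont. eexists. apply (is_Cder_comp Cinv (fun w => w - z)%C).
- now apply is_Cder_inv, Cminus_neq_0.
- apply is_Cder_minus; [apply is_Cder_id|apply is_Cder_const].
Qed.

(** The factor [k] turns the cut of the logarithm away from the side of integration and leaves the
    derivative unchanged. *)
Lemma is_Cder_log_rotated (k z w : C) :
  k <> 0%C -> w <> z -> 0 < Re (k * (w - z)) ->
  is_Cder (fun w => Clog (k * (w - z)))%C w (/ (w - z))%C.
Proof.
intros Hk Hw H.
assert (H1 : is_Cder (fun w => k * (w - z))%C w (0 * (w - z) + k * (1 - 0))%C).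
{ apply (is_Cder_mult (fun _ => k) (fun w => w - z)%C); [apply is_Cder_const|].
  apply is_Cder_minus; [apply is_Cder_id|apply is_Cder_const]. }
assert (H2 := is_Cder_comp Clog _ w _ _ (is_Cder_Clog _ (or_intror H)) H1).
replace (/ (w - z))%C with ((0 * (w - z) + k * (1 - 0)) * / (k * (w - z)))%C; [exact H2|].
field. split; [now apply Cminus_neq_0|assumption].
Qed.

Definition in_rect (z : C) (a b c d : R) : Prop := a < Re z < b /\ c < Im z < d.

Lemma boundary_neq (z : C) (a b c d : R) :
  in_rect z a b c d -> on_boundary (fun w => w <> z) a b c d.
Proof.
intros [H1 H2]. split; intros t Ht; split; intros E; rewrite <- E in H1, H2;
unfold Re, Im in H1, H2; simpl in H1, H2; lra.
Qed.

(* On each side a rotated branch of the logarithm is a primitive; consecutive branches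
   differ by [i pi / 2] at the common corner. *)
Lemma RIntC_rect_winding (z : C) (a b c d : R) :
  in_rect z a b c d -> RIntC_rect (fun w => / (w - z))%C a b c d = (2 * PI * Ci)%C.
Proof.
intros Hz. destruct (boundary_neq _ _ _ _ _ Hz) as [N1 N2]. destruct Hz as [H1 H2].
assert (Hab : a <= b) by lra. assert (Hcd : c <= d) by lra.
assert (HCi : Ci <> 0%C) by (intros E; apply (f_equal snd) in E; simpl in E; lra).
assert (HR1 : (1 : C) <> 0%C) by (intros E; apply (f_equal fst) in E; simpl in E; lra).
assert (HmCi : (- Ci)%C <> 0%C) by (intros E; apply (f_equal snd) in E; simpl in E; lra).
assert (HmR1 : (- (1))%C <> 0%C) by (intros E; apply (f_equal fst) in E; simpl in E; lra).
destruct z as [x y]. unfold Re, Im in H1, H2; simpl in H1, H2.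
unfold RIntC_rect.
rewrite (RIntC_horizontal (fun w => / (w - (x, y)))%C (fun w => Clog (Ci * (w - (x, y))))%C); trivial.
2: { intros t Ht. split; [apply Ccont_inv_minus; now apply N1|].
  apply is_Cder_log_rotated; trivial; [now apply N1|]. unfold Ci, Re; simpl. lra. }
rewrite (RIntC_horizontal (fun w => / (w - (x, y)))%C (fun w => Clog (- Ci * (w - (x, y))))%C); trivial.
2: { intros t Ht. split; [apply Ccont_inv_minus; now apply N1|].
  apply is_Cder_log_rotated; trivial; [now apply N1|]. unfold Ci, Re; simpl. lra. }
rewrite (RIntC_vertical (fun w => / (w - (x, y)))%C (fun w => Clog (1 * (w - (x, y))))%C); trivial.
2: { intros t Ht. split; [apply Ccont_inv_minus; now apply N2|].
  apply is_Cder_log_rotated; trivial; [now apply N2|]. unfold Re; simpl. lra. }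
rewrite (RIntC_vertical (fun w => / (w - (x, y)))%C (fun w => Clog (- (1) * (w - (x, y))))%C); trivial.
2: { intros t Ht. split; [apply Ccont_inv_minus; now apply N2|].
  apply is_Cder_log_rotated; trivial; [now apply N2|]. unfold Re; simpl. lra. }
assert (E1 := Clog_mult_Ci (1 * ((b, c) - (x, y)))%C ltac:(unfold Re; simpl; lra) ltac:(unfold Im; simpl; lra)).
assert (E2 := Clog_mult_Ci (- Ci * ((b, d) - (x, y)))%C ltac:(unfold Re; simpl; lra) ltac:(unfold Im; simpl; lra)).
assert (E3 := Clog_mult_Ci (- (1) * ((a, d) - (x, y)))%C ltac:(unfold Re; simpl; lra) ltac:(unfold Im; simpl; lra)).
assert (E4 := Clog_mult_Ci (Ci * ((a, c) - (x, y)))%C ltac:(unfold Re; simpl; lra) ltac:(unfold Im; simpl; lra)).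
assert (I2 : (Ci * Ci = - (1))%C) by (unfold Ci, Cmult, Copp, RtoC; simpl; f_equal; ring).
replace (Ci * (1 * ((b, c) - (x, y))))%C with (Ci * ((b, c) - (x, y)))%C in E1 by ring.
replace (Ci * (- Ci * ((b, d) - (x, y))))%C with (1 * ((b, d) - (x, y)))%C in E2.
2: { replace (Ci * (- Ci * ((b, d) - (x, y))))%C with (- (Ci * Ci) * ((b, d) - (x, y)))%C by ring.
  rewrite I2. ring. }
replace (Ci * (- (1) * ((a, d) - (x, y))))%C with (- Ci * ((a, d) - (x, y)))%C in E3 by ring.
replace (Ci * (Ci * ((a, c) - (x, y))))%C with (- (1) * ((a, c) - (x, y)))%C in E4.
2: { replace (Ci * (Ci * ((a, c) - (x, y))))%C with ((Ci * Ci) * ((a, c) - (x, y)))%C by ring.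
  rewrite I2. ring. }
transitivity (Ci * (PI / 2) + Ci * (PI / 2) + Ci * (PI / 2) + Ci * (PI / 2))%C; [|field].
rewrite <- E1 at 1. rewrite <- E2 at 1. rewrite <- E3 at 1. rewrite <- E4. ring.
Qed.

(** The difference quotient of [g] at [z], completed by the derivative, is continuous and
    differentiable off [z :: l], so Goursat's theorem applies with [z] as one more exceptional
    point. What remains is [g z] times the winding integral. *)
Theorem Cauchy_formula (g : C -> C) (l : list C) (z : C) (a b c d : R) :
  in_rect z a b c d -> on_rect (Ccont g) a b c d ->
  on_rect (fun z => In z l \/ ex_Cder g z) a b c d -> ex_Cder g z ->
  RIntC_rect (fun w => g w / (w - z))%C a b c d = (2 * PI * Ci * g z)%C.
Proof.
intros Hz Hc Hd Hgz. assert (N := boundary_neq _ _ _ _ _ Hz).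
assert (Hab : a < b) by (destruct Hz; lra). assert (Hcd : c < d) by (destruct Hz; lra).
set (q := diff_quot g z (C_derive g z)).
assert (Hq : forall w, w <> z -> exists delta, 0 < delta /\ forall v : C, Cmod (v - w) < delta ->
  ((g v - g z) / (v - z))%C = q v).
{ intros w Hw. exists (Cmod (w - z)). split; [now apply Cmod_gt_0, Cminus_neq_0|].
  intros v Hv. unfold q, diff_quot. destruct (excluded_middle_informative (v = z)) as [e|_]; [|reflexivity].
  rewrite e, Cmod_minus_sym in Hv. lra. }
assert (Hqc : on_rect (Ccont q) a b c d).
{ intros x y Hx Hy. destruct (classic (((x, y) : C) = z)) as [e|n].
  - rewrite e. apply (Ccont_diff_quot g z (C_derive g z)). now apply is_Cder_C_derive.
  - apply Ccont_ext_loc with (1 := Hq _ n). apply Ccont_div; [now apply Cminus_neq_0| |].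
    + apply Ccont_minus; [now apply Hc|]. apply ex_Cder_cont, ex_Cder_const.
    + apply ex_Cder_cont, ex_Cder_minus; [apply ex_Cder_id|apply ex_Cder_const]. }
assert (HG : RIntC_rect q a b c d = 0%C).
{ apply Goursat with (z :: l); trivial. intros x y Hx Hy.
  destruct (classic (((x, y) : C) = z)) as [e|n]; [now left; left|].
  destruct (Hd x y Hx Hy) as [Hin|Hex]; [now left; right|right].
  apply ex_Cder_ext_loc with (1 := Hq _ n). apply ex_Cder_div; [now apply Cminus_neq_0| |].
  + apply ex_Cder_minus; [assumption|apply ex_Cder_const].
  + apply ex_Cder_minus; [apply ex_Cder_id|apply ex_Cder_const]. }
assert (Hinv : on_boundary (Ccont (fun w => / (w - z))%C) a b c d).
{ revert N. apply on_boundary_imp. intros w. apply Ccont_inv_minus. }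
rewrite (RIntC_rect_ext a b c d ltac:(lra) ltac:(lra) _ (fun w => q w + g z * / (w - z))%C).
- rewrite RIntC_rect_plus, RIntC_rect_scal, HG, RIntC_rect_winding; trivial; try lra.
  + ring.
  + apply on_rect_boundary; trivial; lra.
  + revert Hinv. apply on_boundary_imp. intros w Hw.
    apply (Ccont_mult (fun _ => g z)); [apply ex_Cder_cont, ex_Cder_const|exact Hw].
- revert N. apply on_boundary_imp. intros w Hw. unfold q, diff_quot.
  destruct (excluded_middle_informative (w = z)) as [e|_]; [easy|].
  field. now apply Cminus_neq_0.
Qed.

(** Differentiation under the integral sign. The boundary integral is linear and bounded by the
    supremum of the integrand times a constant, so a second-order remainder of the kernel that is
    uniform along the boundary passes to the integral. *)
Lemma RIntC_rect_differentiable (phi : C -> C) (k : C -> C -> C) (k' : C -> C) (z : C)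
    (a b c d delta M : R) :
  a <= b -> c <= d -> 0 < delta -> 0 <= M ->
  (forall z', Cmod (z' - z) < delta -> on_boundary (Ccont (fun w => phi w * k w z')%C) a b c d) ->
  on_boundary (Ccont (fun w => phi w * k' w)%C) a b c d ->
  on_boundary (fun w => forall z', Cmod (z' - z) < delta ->
    Cmod (phi w * (k w z' - k w z - (z' - z) * k' w)) <= M * Cmod (z' - z) ^ 2) a b c d ->
  is_Cder (fun z => RIntC_rect (fun w => phi w * k w z)%C a b c d) z (RIntC_rect (fun w => phi w * k' w)%C a b c d).
Proof.
intros Hab Hcd Hdel HM Hk Hk' H. apply is_Cder_eps. intros eps He.
set (L := 4 * M * (b - a + (d - c)) + 1).
assert (HL : 0 < L).
{ assert (0 <= 4 * M * (b - a + (d - c))) by (apply Rmult_le_pos; lra). unfold L; lra. }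
exists (Rmin delta (eps / L)). split; [apply Rmin_pos; trivial; now apply Rdiv_lt_0_compat|].
intros z' Hz'.
assert (Hz1 : Cmod (z' - z) < delta) by (eapply Rlt_le_trans; [exact Hz'|apply Rmin_l]).
assert (Hz2 : Cmod (z' - z) < eps / L) by (eapply Rlt_le_trans; [exact Hz'|apply Rmin_r]).
assert (Hzz : Cmod (z - z) < delta) by (unfold Cminus; now rewrite Cplus_opp_r, Cmod_0).
set (r := Cmod (z' - z)) in *. assert (Hr : 0 <= r) by apply Cmod_ge_0.
assert (C1 : on_boundary (Ccont (fun w => - (1) * (phi w * k w z))%C) a b c d).
{ generalize (Hk z Hzz). apply on_boundary_imp. intros w Hw.
  apply (Ccont_mult (fun _ => - (1))%C); [apply ex_Cder_cont, ex_Cder_const|exact Hw]. }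
assert (C2 : on_boundary (Ccont (fun w => - (z' - z) * (phi w * k' w))%C) a b c d).
{ revert Hk'. apply on_boundary_imp. intros w Hw.
  apply (Ccont_mult (fun _ => - (z' - z))%C); [apply ex_Cder_cont, ex_Cder_const|exact Hw]. }
assert (C3 : on_boundary (Ccont (fun w => phi w * k w z' + (- (1) * (phi w * k w z)
                 + - (z' - z) * (phi w * k' w)))%C) a b c d).
{ generalize (on_boundary_and _ _ _ _ _ _ (Hk z' Hz1) (on_boundary_and _ _ _ _ _ _ C1 C2)).
  apply on_boundary_imp. intros w [A1 [A2 A3]]. apply Ccont_plus; [exact A1|].
  now apply Ccont_plus. }
replace (RIntC_rect (fun w => phi w * k w z')%C a b c d - RIntC_rect (fun w => phi w * k w z)%C a b c d -
         (z' - z) * RIntC_rect (fun w => phi w * k' w)%C a b c d)%C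
  with (RIntC_rect (fun w => phi w * k w z' + (- (1) * (phi w * k w z)
                 + - (z' - z) * (phi w * k' w)))%C a b c d).
2: { rewrite !RIntC_rect_plus, !RIntC_rect_scal; trivial.
  - ring.
  - now apply Hk.
  - now apply Hk.
  - generalize (on_boundary_and _ _ _ _ _ _ C1 C2).
    apply on_boundary_imp. intros w [A1 A2]. now apply Ccont_plus. }
apply Rle_trans with (4 * (M * r ^ 2) * (b - a + (d - c))).
- apply RIntC_rect_bound; trivial. revert H. apply on_boundary_imp. intros w Hw.
  replace (phi w * k w z' + (- (1) * (phi w * k w z) + - (z' - z) * (phi w * k' w)))%C
    with (phi w * (k w z' - k w z - (z' - z) * k' w))%C by ring. now apply Hw.
- replace (4 * (M * r ^ 2) * (b - a + (d - c))) with ((L - 1) * r * r) by (unfold L; ring).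
  apply Rmult_le_compat_r; [assumption|].
  apply Rmult_lt_compat_l with (r := L) in Hz2; [|assumption].
  replace (L * (eps / L)) with eps in Hz2 by (field; lra). lra.
Qed.

Lemma Cmod_inv_le (u : C) (r : R) : 0 < r -> r <= Cmod u -> Cmod (/ u) <= / r.
Proof.
intros Hr H. rewrite Cmod_inv by (apply Cmod_gt_0; lra). apply Rinv_le_contravar; lra.
Qed.

Lemma square_boundary_dist (x y r : R) : 0 < r ->
  on_boundary (fun w => r <= Cmod (w - (x, y))) (x - r) (x + r) (y - r) (y + r).
Proof.
intros Hr. split; intros t Ht; split.
- eapply Rle_trans; [|apply snd_le_Cmod]. simpl. rewrite Rabs_left; lra.
- eapply Rle_trans; [|apply snd_le_Cmod]. simpl. rewrite Rabs_pos_eq; lra.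
- eapply Rle_trans; [|apply fst_le_Cmod]. simpl. rewrite Rabs_left; lra.
- eapply Rle_trans; [|apply fst_le_Cmod]. simpl. rewrite Rabs_pos_eq; lra.
Qed.

Lemma square_boundary_dist' (x y r : R) (z : C) : 0 < r -> Cmod (z - (x, y)) < r / 2 ->
  on_boundary (fun w => r / 2 <= Cmod (w - z)) (x - r) (x + r) (y - r) (y + r).
Proof.
intros Hr Hz. generalize (square_boundary_dist x y r Hr). apply on_boundary_imp. intros w Hw.
assert (H := Cmod_triangle (w - z) (z - (x, y))).
replace (w - z + (z - (x, y)))%C with (w - (x, y))%C in H by ring. lra.
Qed.

(** Here [u = w - z] and [e] is the displacement of [z]; the remainder equals
    [e^2 / ((u - e) u^2)]. *)
Lemma kernel1_remainder (u e : C) (r : R) : 0 < r -> r <= Cmod u -> r <= Cmod (u - e) ->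
  Cmod (/ (u - e) - / u - e * (/ u * / u)) <= / r * / r * / r * Cmod e ^ 2.
Proof.
intros Hr Hu Hue.
assert (N1 : u <> 0%C) by (apply Cmod_gt_0; lra).
assert (N2 : (u - e)%C <> 0%C) by (apply Cmod_gt_0; lra).
replace (/ (u - e) - / u - e * (/ u * / u))%C with (/ (u - e) * / u * / u * (e * e))%C.
2: { field. now split. }
rewrite !Cmod_mult. apply Cmod_inv_le in Hu; trivial. apply Cmod_inv_le in Hue; trivial.
replace (Cmod e ^ 2) with (Cmod e * Cmod e) by ring.
apply Rmult_le_compat_r; [apply Rmult_le_pos; apply Cmod_ge_0|].
repeat apply Rmult_le_compat; try (repeat apply Rmult_le_pos; apply Cmod_ge_0); trivial.
Qed.

(** The remainder equals [e^2 (3 - 2 e / u) / ((u - e)^2 u^2)], and [|e| <= r <= |u|] bounds the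
    bracket by 5. *)
Lemma kernel2_remainder (u e : C) (r : R) : 0 < r -> r <= Cmod u -> r <= Cmod (u - e) ->
  Cmod e <= r ->
  Cmod (/ (u - e) * / (u - e) - / u * / u - e * (2 * (/ u * / u * / u)))
    <= 5 * (/ r * / r * / r * / r) * Cmod e ^ 2.
Proof.
intros Hr Hu Hue He.
assert (N1 : u <> 0%C) by (apply Cmod_gt_0; lra).
assert (N2 : (u - e)%C <> 0%C) by (apply Cmod_gt_0; lra).
replace (/ (u - e) * / (u - e) - / u * / u - e * (2 * (/ u * / u * / u)))%C
  with (/ (u - e) * / (u - e) * / u * / u * (3 - 2 * e * / u) * (e * e))%C.
2: { field. now split. }
rewrite !Cmod_mult. apply Cmod_inv_le in Hu; trivial. apply Cmod_inv_le in Hue; trivial.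
replace (Cmod e ^ 2) with (Cmod e * Cmod e) by ring.
apply Rmult_le_compat_r; [apply Rmult_le_pos; apply Cmod_ge_0|].
rewrite (Rmult_comm 5).
apply Rmult_le_compat; [repeat apply Rmult_le_pos; apply Cmod_ge_0|apply Cmod_ge_0| |].
- repeat apply Rmult_le_compat; try (repeat apply Rmult_le_pos; apply Cmod_ge_0); trivial.
- unfold Cminus. eapply Rle_trans; [apply Cmod_triangle|].
  rewrite Cmod_opp, !Cmod_mult, !Cmod_R, !Rabs_pos_eq by lra.
  assert (Cmod e * Cmod (/ u) <= r * / r) by (apply Rmult_le_compat; trivial; apply Cmod_ge_0).
  rewrite Rinv_r in H by lra. lra.
Qed.

(** * Cauchy integrals over a square, Cauchy's estimate, removable singularities *)

Section Square.
Variables (g : C -> C) (x y r B : R).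
Hypothesis Hr : 0 < r.
Hypothesis Hg : on_rect (fun w => ex_Cder g w /\ Cmod (g w) <= B) (x - r) (x + r) (y - r) (y + r).

Let z0 : C := (x, y).
Let RS (f : C -> C) : C := RIntC_rect f (x - r) (x + r) (y - r) (y + r).

Lemma square_bound_nonneg : 0 <= B.
Proof.
destruct (Hg x y) as [_ H]; try lra. apply Rle_trans with (2 := H), Cmod_ge_0.
Qed.

Lemma square_boundary_g :
  on_boundary (fun w => Ccont g w /\ Cmod (g w) <= B) (x - r) (x + r) (y - r) (y + r).
Proof.
apply on_rect_boundary; try lra. intros u v Hu Hv. destruct (Hg u v Hu Hv) as [H1 H2].
split; [now apply ex_Cder_cont|assumption].
Qed.

Lemma square_in_rect (z : C) : Cmod (z - z0) < r / 2 ->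
  in_rect z (x - r) (x + r) (y - r) (y + r).
Proof.
intros Hz. assert (H1 := fst_le_Cmod (z - z0)). assert (H2 := snd_le_Cmod (z - z0)).
simpl in H1, H2. destruct z as [u v]; unfold in_rect, Re, Im; simpl in *.
assert (H3 := Rle_lt_trans _ _ _ H1 Hz). assert (H4 := Rle_lt_trans _ _ _ H2 Hz).
apply Rabs_def2 in H3. apply Rabs_def2 in H4. lra.
Qed.

Lemma square_cont_kernel (k : C -> C) :
  on_boundary (Ccont k) (x - r) (x + r) (y - r) (y + r) ->
  on_boundary (Ccont (fun w => g w * k w)%C) (x - r) (x + r) (y - r) (y + r).
Proof.
intros Hk. generalize (on_boundary_and _ _ _ _ _ _ square_boundary_g Hk).
apply on_boundary_imp. intros w [[H1 _] H2]. now apply Ccont_mult.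
Qed.

Lemma square_cont_inv (z : C) : Cmod (z - z0) < r / 2 ->
  on_boundary (Ccont (fun w => / (w - z))%C) (x - r) (x + r) (y - r) (y + r).
Proof.
intros Hz. generalize (square_boundary_dist' x y r z Hr Hz). apply on_boundary_imp.
intros w Hw. apply Ccont_inv_minus. intros E. rewrite E in Hw.
unfold Cminus in Hw. rewrite Cplus_opp_r, Cmod_0 in Hw. lra.
Qed.

Lemma square_cont_inv2 (z : C) : Cmod (z - z0) < r / 2 ->
  on_boundary (Ccont (fun w => / (w - z) * / (w - z))%C) (x - r) (x + r) (y - r) (y + r).
Proof.
intros Hz. generalize (square_cont_inv z Hz). apply on_boundary_imp.
intros w Hw. now apply Ccont_mult.
Qed.

Lemma square_formula (z : C) : Cmod (z - z0) < r / 2 ->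
  RS (fun w => g w * / (w - z))%C = (2 * PI * Ci * g z)%C.
Proof.
intros Hz. unfold RS.
rewrite <- (Cauchy_formula g nil z (x - r) (x + r) (y - r) (y + r)).
- reflexivity.
- now apply square_in_rect.
- intros u v Hu Hv. apply ex_Cder_cont. now apply Hg.
- intros u v Hu Hv. right. now apply Hg.
- assert (H := square_in_rect z Hz). destruct H as [H1 H2].
  destruct z as [u v]. apply Hg; unfold Re, Im in *; simpl in *; lra.
Qed.

Lemma square_der1 (z : C) : Cmod (z - z0) < r / 2 ->
  is_Cder (fun z => RS (fun w => g w * / (w - z))%C) z
    (RS (fun w => g w * (/ (w - z) * / (w - z)))%C).
Proof.
intros Hz. assert (HB := square_bound_nonneg).
apply (RIntC_rect_differentiable g (fun w z => / (w - z))%C (fun w => / (w - z) * / (w - z))%C z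
  _ _ _ _ (r / 2 - Cmod (z - z0)) (B * (/ (r / 2) * / (r / 2) * / (r / 2)))); try lra.
- assert (0 < / (r / 2)) by (apply Rinv_0_lt_compat; lra). repeat apply Rmult_le_pos; lra.
- intros z' Hz'. apply square_cont_kernel, square_cont_inv.
  assert (H := Cmod_triangle (z' - z) (z - z0)).
  replace (z' - z + (z - z0))%C with (z' - z0)%C in H by ring. lra.
- now apply square_cont_kernel, square_cont_inv2.
- generalize (on_boundary_and _ _ _ _ _ _ square_boundary_g
    (square_boundary_dist x y r Hr)). apply on_boundary_imp. intros w [[_ Hw1] Hw2] z' Hz'.
  assert (D1 : r / 2 <= Cmod (w - z)).
  { assert (H := Cmod_triangle (w - z) (z - z0)).
    replace (w - z + (z - z0))%C with (w - z0)%C in H by ring. unfold z0 in *; lra. }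
  assert (D2 : r / 2 <= Cmod (w - z - (z' - z))).
  { assert (H := Cmod_triangle (w - z - (z' - z)) (z' - z + (z - z0))).
    assert (H' := Cmod_triangle (z' - z) (z - z0)).
    replace (w - z - (z' - z) + (z' - z + (z - z0)))%C with (w - z0)%C in H by ring.
    unfold z0 in *; lra. }
  rewrite Cmod_mult, Rmult_assoc. apply Rmult_le_compat; try apply Cmod_ge_0; trivial.
  replace (w - z')%C with (w - z - (z' - z))%C by ring.
  apply kernel1_remainder; trivial; lra.
Qed.

Lemma square_der2 :
  is_Cder (fun z => RS (fun w => g w * (/ (w - z) * / (w - z)))%C) z0
    (RS (fun w => g w * (2 * (/ (w - z0) * / (w - z0) * / (w - z0))))%C).
Proof.
assert (HB := square_bound_nonneg).
assert (Hz0 : Cmod (z0 - z0) < r / 2) by (unfold Cminus; rewrite Cplus_opp_r, Cmod_0; lra).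
apply (RIntC_rect_differentiable g (fun w z => / (w - z) * / (w - z))%C
  (fun w => 2 * (/ (w - z0) * / (w - z0) * / (w - z0)))%C z0
  _ _ _ _ (r / 2) (B * (5 * (/ (r / 2) * / (r / 2) * / (r / 2) * / (r / 2))))); try lra.
- assert (0 < / (r / 2)) by (apply Rinv_0_lt_compat; lra). repeat apply Rmult_le_pos; lra.
- intros z' Hz'. now apply square_cont_kernel, square_cont_inv2.
- apply square_cont_kernel. generalize (square_cont_inv z0 Hz0). apply on_boundary_imp.
  intros w Hw. apply (Ccont_mult (fun _ => RtoC 2)); [apply ex_Cder_cont, ex_Cder_const|].
  apply (Ccont_mult (fun w => / (w - z0) * / (w - z0))%C); [now apply Ccont_mult|exact Hw].
- generalize (on_boundary_and _ _ _ _ _ _ square_boundary_g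
    (square_boundary_dist x y r Hr)). apply on_boundary_imp. intros w [[_ Hw1] Hw2] z' Hz'.
  assert (D2 : r / 2 <= Cmod (w - z0 - (z' - z0))).
  { assert (H := Cmod_triangle (w - z0 - (z' - z0)) (z' - z0)).
    replace (w - z0 - (z' - z0) + (z' - z0))%C with (w - z0)%C in H by ring.
    unfold z0 in *; lra. }
  rewrite Cmod_mult, Rmult_assoc. apply Rmult_le_compat; try apply Cmod_ge_0; trivial.
  replace (w - z')%C with (w - z0 - (z' - z0))%C by ring.
  apply kernel2_remainder; trivial; unfold z0 in *; lra.
Qed.

Lemma two_pi_i_neq_0 : (2 * PI * Ci)%C <> 0%C.
Proof.
apply Cmod_gt_0. rewrite !Cmod_mult, Cmod_Ci, !Cmod_R. assert (H := PI_RGT_0).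
rewrite !Rabs_pos_eq; lra.
Qed.

Lemma is_Cder_scal_l (k : C) (f : C -> C) (z l : C) : is_Cder f z l ->
  is_Cder (fun w => k * f w)%C z (k * l)%C.
Proof.
intros H. assert (E := is_Cder_mult (fun _ => k) f z _ _ (is_Cder_const k z) H).
cbv beta in E. replace (k * l)%C with (0 * f z + k * l)%C by ring. exact E.
Qed.

Lemma square_der (z : C) : Cmod (z - z0) < r / 2 ->
  is_Cder g z (/ (2 * PI * Ci) * RS (fun w => g w * (/ (w - z) * / (w - z))))%C.
Proof.
intros Hz. apply is_Cder_ext_loc with (fun z => / (2 * PI * Ci) * RS (fun w => g w * / (w - z)))%C.
- exists (r / 2 - Cmod (z - z0)). split; [lra|]. intros v Hv.
  rewrite square_formula.
  + field. split; intros E; apply two_pi_i_neq_0; rewrite E; ring.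
  + assert (H := Cmod_triangle (v - z) (z - z0)).
    replace (v - z + (z - z0))%C with (v - z0)%C in H by ring. lra.
- apply is_Cder_scal_l. now apply square_der1.
Qed.

(** On the whole disc of radius [r / 2] the derivative of [g] is the Cauchy integral with squared
    kernel, which can be differentiated under the integral sign once more. *)
Lemma square_C_derive_ex : ex_Cder (C_derive g) z0.
Proof.
eexists. apply is_Cder_ext_loc with
  (fun z => / (2 * PI * Ci) * RS (fun w => g w * (/ (w - z) * / (w - z))))%C.
- exists (r / 2). split; [lra|]. intros z Hz. symmetry. apply C_derive_is_Cder.
  now apply square_der.
- apply is_Cder_scal_l, square_der2.
Qed.

Lemma square_C_derive_bound : Cmod (C_derive g z0) <= 3 * B / r.
Proof.
assert (HB := square_bound_nonneg).
assert (Hz0 : Cmod (z0 - z0) < r / 2) by (unfold Cminus; rewrite Cplus_opp_r, Cmod_0; lra).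
rewrite (C_derive_is_Cder _ _ _ (square_der z0 Hz0)).
rewrite Cmod_mult, Cmod_inv by apply two_pi_i_neq_0.
rewrite !Cmod_mult, Cmod_Ci, !Cmod_R. assert (Hpi := PI_RGT_0).
rewrite !Rabs_pos_eq by lra.
assert (H : Cmod (RS (fun w => g w * (/ (w - z0) * / (w - z0)))%C) <= 16 * (B * / r)).
{ replace (16 * (B * / r)) with (4 * (B * (/ r * / r)) * ((x + r) - (x - r) + ((y + r) - (y - r))))
    by (field; lra).
  unfold RS. apply (RIntC_rect_bound (x - r) (x + r) (y - r) (y + r)); try lra.
  - apply (square_cont_kernel (fun w => / (w - z0) * / (w - z0))%C). now apply square_cont_inv2.
  - generalize (on_boundary_and _ _ _ _ _ _ square_boundary_g
      (square_boundary_dist x y r Hr)). apply on_boundary_imp. intros w [[_ Hw1] Hw2].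
    apply Cmod_inv_le in Hw2; trivial.
    rewrite !Cmod_mult. repeat apply Rmult_le_compat; try apply Rmult_le_pos; try apply Cmod_ge_0; trivial. }
(* [PI > 3] gives [2 PI >= 16 / 3], so [16 B / (2 PI r) <= 3 B / r]. *)
assert (H1 : / (2 * PI * 1) <= 3 / 16).
{ assert (H3 := PI2_3_2). unfold PI2 in H3. replace (3 / 16) with (/ (16 / 3)) by field.
  apply Rinv_le_contravar; lra. }
assert (H2 : 0 < / r) by now apply Rinv_0_lt_compat.
apply Rle_trans with (3 / 16 * (16 * (B * / r))).
- apply Rmult_le_compat; trivial; [|apply Cmod_ge_0].
  left. apply Rinv_0_lt_compat. lra.
- right. unfold Rdiv. field. lra.
Qed.

End Square.

Lemma holomorphic_square (g : C -> C) (x y R0 : R) :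
  0 < R0 -> (forall w : C, Cmod (w - (x, y)) < R0 -> ex_Cder g w) ->
  exists r B, 0 < r < R0 /\
    on_rect (fun w => ex_Cder g w /\ Cmod (g w) <= B) (x - r) (x + r) (y - r) (y + r).
Proof.
intros HR H.
assert (Hc : Ccont g (x, y)).
{ apply ex_Cder_cont, H. unfold Cminus. now rewrite Cplus_opp_r, Cmod_0. }
rewrite Ccont_eps in Hc. destruct (Hc 1 Rlt_0_1) as [del [Hd Hdel]].
set (r := Rmin (R0 / 4) (del / 4)).
assert (H1 : r <= R0 / 4) by apply Rmin_l. assert (H2 : r <= del / 4) by apply Rmin_r.
assert (H0 : 0 < r) by (apply Rmin_pos; lra).
exists r, (1 + Cmod (g (x, y))). split; [lra|].
intros u v Hu Hv. assert (E : Cmod ((u, v) - (x, y)) <= r + r) by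
  (apply Cmod_rect_le; apply Rabs_le; lra).
split; [apply H; lra|].
specialize (Hdel (u, v) ltac:(lra)).
assert (T := Cmod_triangle (g (u, v) - g (x, y)) (g (x, y))).
replace (g (u, v) - g (x, y) + g (x, y))%C with (g (u, v)) in T by ring. lra.
Qed.

Definition holomorphic_near (g : C -> C) (z : C) : Prop :=
  exists delta, 0 < delta /\ forall w : C, Cmod (w - z) < delta -> ex_Cder g w.

Theorem ex_Cder_C_derive (g : C -> C) (z : C) :
  holomorphic_near g z -> ex_Cder (C_derive g) z.
Proof.
intros [R0 [HR H]]. destruct z as [x y].
destruct (holomorphic_square g x y R0 HR H) as [r [B [Hr Hg]]].
apply (square_C_derive_ex g x y r B); [lra|assumption].
Qed.

Theorem Cauchy_estimate (g : C -> C) (z : C) (r B : R) : 0 < r ->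
  (forall w : C, Rabs (Re w - Re z) <= r -> Rabs (Im w - Im z) <= r ->
     ex_Cder g w /\ Cmod (g w) <= B) ->
  Cmod (C_derive g z) <= 3 * B / r.
Proof.
intros Hr H. destruct z as [x y]. apply square_C_derive_bound; trivial.
intros u v Hu Hv. apply H; unfold Re, Im; simpl; apply Rabs_le; lra.
Qed.

(** Near [a] the completed difference quotient is the Cauchy integral of the density
    [g w / (w - a)], at [z = a] by the formula for the derivative and elsewhere by Cauchy's formula
    at [z] and at [a]. Such an integral is differentiable at [a]. *)
Theorem ex_Cder_diff_quot (g : C -> C) (a : C) : holomorphic_near g a ->
  ex_Cder (diff_quot g a (C_derive g a)) a.
Proof.
intros [R0 [HR H]]. destruct a as [x y].
destruct (holomorphic_square g x y R0 HR H) as [r [B [Hr Hg]]].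
assert (Hr0 : 0 < r) by lra. set (a := (x, y) : C) in *.
assert (Hza : Cmod (a - a) < r / 2) by (unfold Cminus; rewrite Cplus_opp_r, Cmod_0; lra).
assert (HB := square_bound_nonneg g x y r B Hr0 Hg).
assert (Hgk : on_boundary (fun w => Ccont (fun w => g w * / (w - a))%C w) (x - r) (x + r) (y - r) (y + r)).
{ apply (square_cont_kernel g x y r B Hr0 Hg (fun w => / (w - a))%C).
  now apply (square_cont_inv x y r Hr0). }
set (Q := fun z => RIntC_rect (fun w => (g w * / (w - a)) * / (w - z))%C (x - r) (x + r) (y - r) (y + r)).
assert (HQ : is_Cder Q a (RIntC_rect (fun w => (g w * / (w - a)) * (/ (w - a) * / (w - a)))%C
                            (x - r) (x + r) (y - r) (y + r))).
{ apply (RIntC_rect_differentiable (fun w => g w * / (w - a))%C (fun w z => / (w - z))%C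
   (fun w => / (w - a) * / (w - a))%C a _ _ _ _ (r / 2)
   (B * / r * (/ (r / 2) * / (r / 2) * / (r / 2)))); try lra.
  - assert (0 < / (r / 2)) by (apply Rinv_0_lt_compat; lra).
    assert (0 < / r) by now apply Rinv_0_lt_compat. repeat apply Rmult_le_pos; lra.
  - intros z' Hz'. generalize (on_boundary_and _ _ _ _ _ _ Hgk (square_cont_inv x y r Hr0 z' Hz')).
    apply on_boundary_imp. intros w [H1 H2]. now apply Ccont_mult.
  - generalize (on_boundary_and _ _ _ _ _ _ Hgk (square_cont_inv2 x y r Hr0 a Hza)).
    apply on_boundary_imp. intros w [H1 H2]. now apply Ccont_mult.
  - generalize (on_boundary_and _ _ _ _ _ _ (square_boundary_g g x y r B Hr0 Hg)
      (square_boundary_dist x y r Hr0)). apply on_boundary_imp. intros w [[_ Hw1] Hw2] z' Hz'.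
    fold a in Hw2.
    assert (D2 : r / 2 <= Cmod (w - a - (z' - a))).
    { assert (T := Cmod_triangle (w - a - (z' - a)) (z' - a)).
      replace (w - a - (z' - a) + (z' - a))%C with (w - a)%C in T by ring. lra. }
    rewrite Cmod_mult, Rmult_assoc.
    apply Rmult_le_compat; try apply Cmod_ge_0.
    + rewrite Cmod_mult. apply Rmult_le_compat; try apply Cmod_ge_0; trivial.
      now apply Cmod_inv_le.
    + replace (w - z')%C with (w - a - (z' - a))%C by ring.
      apply kernel1_remainder; trivial; lra. }
exists (/ (2 * PI * Ci) * RIntC_rect (fun w => (g w * / (w - a)) * (/ (w - a) * / (w - a)))%C
                            (x - r) (x + r) (y - r) (y + r))%C.
apply is_Cder_ext_loc with (2 := is_Cder_scal_l _ _ _ _ HQ).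
exists (r / 2). split; [lra|]. intros z Hz. unfold Q, diff_quot.
destruct (excluded_middle_informative (z = a)) as [->|n].
- rewrite (C_derive_is_Cder _ _ _ (square_der g x y r B Hr0 Hg a Hza)).
  f_equal. apply RIntC_rect_ext; try lra. apply on_rect_boundary; try lra. intros u v _ _. ring.
- assert (Hza' := Cminus_neq_0 _ _ n).
  assert (F1 := square_formula g x y r B Hr0 Hg z Hz).
  assert (F2 := square_formula g x y r B Hr0 Hg a Hza).
  (* Partial fractions in [w] separate the poles at [z] and [a]. *)
  rewrite (RIntC_rect_ext (x - r) (x + r) (y - r) (y + r) ltac:(lra) ltac:(lra) _
    (fun w => / (z - a) * (g w * / (w - z) + - (1) * (g w * / (w - a))))%C).
  + rewrite RIntC_rect_scal, RIntC_rect_plus, RIntC_rect_scal, F1, F2; trivial; try lra.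
    * field. split; [assumption|]. split; intros E; apply two_pi_i_neq_0; rewrite E; ring.
    * apply (square_cont_kernel g x y r B Hr0 Hg (fun w => / (w - z))%C).
      now apply (square_cont_inv x y r Hr0).
    * revert Hgk. apply on_boundary_imp. intros w Hw.
      apply (Ccont_mult (fun _ => - (1))%C); [apply ex_Cder_cont, ex_Cder_const|exact Hw].
    * generalize (on_boundary_and _ _ _ _ _ _ Hgk (square_cont_kernel g x y r B Hr0 Hg (fun w => / (w - z))%C
        (square_cont_inv x y r Hr0 z Hz))).
      apply on_boundary_imp. intros w [H1 H2]. apply Ccont_plus; [exact H2|].
      apply (Ccont_mult (fun _ => - (1))%C); [apply ex_Cder_cont, ex_Cder_const|exact H1].
  + generalize (on_boundary_and _ _ _ _ _ _ (square_boundary_dist' x y r z Hr0 Hz)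
      (square_boundary_dist' x y r a Hr0 Hza)).
    apply on_boundary_imp. intros w [H1 H2].
    field. repeat split; first [assumption | apply Cmod_gt_0; lra].
Qed.

(** * Holomorphic functions on strips *)

Lemma strip_open (rho : R) (z : C) : strip rho z ->
  exists delta, 0 < delta /\ forall w : C, Cmod (w - z) < delta -> strip rho w.
Proof.
intros Hz. unfold strip in *. exists (rho - Rabs (Im z)). split; [lra|]. intros w Hw.
assert (H := Im_le_Cmod (w - z)).
replace (Im w) with (Im z + Im (w - z)) by (unfold Im; simpl; ring).
eapply Rle_lt_trans; [apply Rabs_triang|]. lra.
Qed.

Definition holo_strip (rho : R) (g : C -> C) : Prop := forall z, strip rho z -> ex_Cder g z.

Lemma holo_strip_near (rho : R) (g : C -> C) (z : C) :
  holo_strip rho g -> strip rho z -> holomorphic_near g z.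
Proof.
intros Hg Hz. destruct (strip_open rho z Hz) as [del [Hd H]].
exists del. split; [assumption|]. intros w Hw. now apply Hg, H.
Qed.

Lemma holo_strip_C_derive (rho : R) (g : C -> C) : holo_strip rho g -> holo_strip rho (C_derive g).
Proof. intros Hg z Hz. apply ex_Cder_C_derive. eapply holo_strip_near; eassumption. Qed.

Lemma holo_strip_C_derive_n (rho : R) (g : C -> C) (m : nat) :
  holo_strip rho g -> holo_strip rho (C_derive_n g m).
Proof.
intros Hg. induction m as [|m IH]; [exact Hg|]. now apply holo_strip_C_derive.
Qed.

Lemma C_derive_n_S (g : C -> C) (m : nat) : C_derive_n g (S m) = C_derive (C_derive_n g m).
Proof. reflexivity. Qed.

Lemma C_derive_ext_strip (rho : R) (f g : C -> C) (z : C) : holo_strip rho f ->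
  (forall w, strip rho w -> f w = g w) -> strip rho z -> C_derive f z = C_derive g z.
Proof.
intros Hf H Hz. symmetry. apply C_derive_is_Cder. apply is_Cder_ext_loc with f.
- destruct (strip_open rho z Hz) as [del [Hd Hs]]. exists del. split; [assumption|].
  intros w Hw. now apply H, Hs.
- now apply is_Cder_C_derive, Hf.
Qed.

Lemma C_derive_n_plus (rho : R) (f g : C -> C) (m : nat) : holo_strip rho f -> holo_strip rho g ->
  forall z, strip rho z ->
  C_derive_n (fun w => f w + g w)%C m z = (C_derive_n f m z + C_derive_n g m z)%C.
Proof.
intros Hf Hg. induction m as [|m IH]; intros z Hz; [reflexivity|].
assert (Hf' := holo_strip_C_derive_n rho f m Hf). assert (Hg' := holo_strip_C_derive_n rho g m Hg).
assert (H := is_Cder_plus _ _ _ _ _ (is_Cder_C_derive _ _ (Hf' z Hz)) (is_Cder_C_derive _ _ (Hg' z Hz))).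
rewrite !C_derive_n_S. rewrite <- (C_derive_is_Cder _ _ _ H).
symmetry. apply (C_derive_ext_strip rho); trivial.
- intros w Hw. apply ex_Cder_plus; [exact (Hf' w Hw)|exact (Hg' w Hw)].
- intros w Hw. symmetry. exact (IH w Hw).
Qed.

Lemma C_derive_n_scal (rho : R) (k : C) (f : C -> C) (m : nat) : holo_strip rho f ->
  forall z, strip rho z ->
  C_derive_n (fun w => k * f w)%C m z = (k * C_derive_n f m z)%C.
Proof.
intros Hf. induction m as [|m IH]; intros z Hz; [reflexivity|].
assert (Hf' := holo_strip_C_derive_n rho f m Hf).
assert (H := is_Cder_scal_l k _ _ _ (is_Cder_C_derive _ _ (Hf' z Hz))).
rewrite !C_derive_n_S. rewrite <- (C_derive_is_Cder _ _ _ H).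
symmetry. apply (C_derive_ext_strip rho); trivial.
- intros w Hw. apply ex_Cder_mult; [apply ex_Cder_const|exact (Hf' w Hw)].
- intros w Hw. symmetry. exact (IH w Hw).
Qed.

Lemma C_derive_n_0 (m : nat) (z : C) : C_derive_n (fun _ => 0%C) m z = 0%C.
Proof.
revert z. induction m as [|m IH]; intros z; [reflexivity|].
rewrite C_derive_n_S. apply C_derive_is_Cder.
apply is_Cder_ext_loc with (fun _ => 0%C); [|apply is_Cder_const].
exists 1. split; [lra|]. intros w _. now rewrite IH.
Qed.

(** Starting at 1 makes [Csum_Z] an instance by conversion. *)
Definition Csum (F : nat -> C) (n : nat) : C := sum_n_m (G := C_AbelianMonoid) F 1 n.

Lemma Csum_0 (F : nat -> C) : Csum F 0 = 0%C.
Proof. unfold Csum. rewrite sum_n_m_zero; [reflexivity|lia]. Qed.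

Lemma Csum_S (F : nat -> C) (n : nat) : Csum F (S n) = (Csum F n + F (S n))%C.
Proof. unfold Csum. rewrite sum_n_Sm; [reflexivity|lia]. Qed.

Lemma ex_Cder_Csum (F : nat -> C -> C) (n : nat) (z : C) :
  (forall j, ex_Cder (F j) z) -> ex_Cder (fun w => Csum (fun j => F j w) n) z.
Proof.
intros H. induction n as [|n IH].
- apply ex_Cder_ext_loc with (fun _ => 0%C); [|apply ex_Cder_const].
  exists 1. split; [lra|]. intros w _. now rewrite Csum_0.
- apply ex_Cder_ext_loc with (fun w => Csum (fun j => F j w) n + F (S n) w)%C.
  + exists 1. split; [lra|]. intros w _. now rewrite Csum_S.
  + now apply ex_Cder_plus.
Qed.

Lemma C_derive_n_ext_strip (rho : R) (f g : C -> C) (m : nat) : holo_strip rho f ->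
  (forall w, strip rho w -> f w = g w) ->
  forall z, strip rho z -> C_derive_n f m z = C_derive_n g m z.
Proof.
intros Hf H. induction m as [|m IH]; intros z Hz; [now apply H|].
rewrite !C_derive_n_S. apply C_derive_ext_strip with rho; trivial.
now apply holo_strip_C_derive_n.
Qed.

Lemma C_derive_n_Csum (rho : R) (F : nat -> C -> C) (n m : nat) :
  (forall j, holo_strip rho (F j)) -> forall z, strip rho z ->
  C_derive_n (fun w => Csum (fun j => F j w) n) m z = Csum (fun j => C_derive_n (F j) m z) n.
Proof.
intros H. induction n as [|n IH]; intros z Hz.
- rewrite Csum_0. transitivity (C_derive_n (fun _ => 0%C) m z); [|apply C_derive_n_0].
  symmetry. apply (C_derive_n_ext_strip rho); trivial.
  intros w _. apply ex_Cder_const.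
- rewrite Csum_S, <- IH, <- (C_derive_n_plus rho); trivial.
  + symmetry. apply (C_derive_n_ext_strip rho); trivial.
    * intros w Hw. apply ex_Cder_plus; [|now apply H]. apply ex_Cder_Csum. intros j. now apply H.
    * intros w _. now rewrite Csum_S.
  + intros w Hw. apply ex_Cder_Csum. intros j. now apply H.
Qed.

(** This identifies the real derivatives of [Sinc k h] composed with [phi4_inv] in the theorem with
    complex derivatives of their holomorphic extension. *)
Lemma C_derive_n_RtoC (rho : R) (g : C -> C) (g0 : R -> R) (m : nat) : 0 < rho ->
  holo_strip rho g -> (forall s : R, g (RtoC s) = RtoC (g0 s)) ->
  forall t : R, C_derive_n g m (RtoC t) = RtoC (Derive_n g0 m t).
Proof.
intros Hrho Hg H. induction m as [|m IH]; intros t; [apply H|].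
assert (Ht : strip rho (RtoC t)) by (unfold strip, Im; simpl; rewrite Rabs_R0; lra).
rewrite C_derive_n_S. simpl Derive_n.
assert (D := is_Cder_C_derive _ _ (holo_strip_C_derive_n rho g m Hg _ Ht)).
destruct (is_derive_horizontal _ t 0 _ D) as [D1 D2].
apply injective_projections.
- symmetry. simpl. apply is_derive_unique.
  apply is_derive_ext with (2 := D1). intros s. change (s, 0) with (RtoC s). now rewrite IH.
(* The imaginary part is the derivative of a function that vanishes along the real line. *)
- transitivity 0; [|reflexivity].
  transitivity (Derive (fun s => snd (C_derive_n g m (s, 0))) t);
    [symmetry; exact (is_derive_unique _ _ _ D2)|].
  transitivity (Derive (fun _ => 0) t); [|apply Derive_const].
  apply Derive_ext. intros s. change (s, 0) with (RtoC s). now rewrite IH.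
Qed.

Lemma strip_Cauchy_estimate (rho r B : R) (g : C -> C) (m : nat) :
  0 < r <= rho -> holo_strip rho g -> (forall z, strip r z -> Cmod (g z) <= B) ->
  forall t : R, Cmod (C_derive_n g m (RtoC t)) <= (3 * (INR m + 1) / r) ^ m * B.
Proof.
intros Hr Hg HB.
assert (Hm := pos_INR m).
(* Each derivative consumes a width [de]. Dividing by [m + 1] leaves a strip of width [de] after [m]
   steps, so it still contains the real line, and covers [m = 0]. *)
set (de := r / (INR m + 1)).
assert (Hde : 0 < de) by (apply Rdiv_lt_0_compat; lra).
assert (Hrd : r = (INR m + 1) * de) by (unfold de; field; lra).
assert (Hk : forall k, (k <= m)%nat -> forall z, strip (r - INR k * de) z ->
  Cmod (C_derive_n g k z) <= (3 / de) ^ k * B).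
{ induction k as [|k IH]; intros Hkm z Hz.
  - simpl. rewrite Rmult_1_l. apply HB. simpl in Hz. now rewrite Rmult_0_l, Rminus_0_r in Hz.
  - rewrite C_derive_n_S.
    replace ((3 / de) ^ S k * B) with (3 * ((3 / de) ^ k * B) / de) by (simpl; field; lra).
    apply Cauchy_estimate; trivial. intros w _ Hw.
    assert (Hw' : strip (r - INR k * de) w).
    { unfold strip in *. rewrite S_INR in Hz.
      replace (Im w) with (Im w - Im z + Im z) by ring.
      eapply Rle_lt_trans; [apply Rabs_triang|]. lra. }
    split; [|apply IH; trivial; lia].
    apply holo_strip_C_derive_n with rho; trivial.
    assert (Hk := pos_INR k). assert (0 <= INR k * de) by (apply Rmult_le_pos; lra).
    unfold strip in *. lra. }
intros t. replace (3 * (INR m + 1) / r) with (3 / de) by (unfold de; field; lra).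
apply Hk; trivial. unfold strip, Im; simpl. rewrite Rabs_R0. lra.
Qed.

(** * The complex sinc function *)

Definition Csin (z : C) : C := ((Cexp (Ci * z) - Cexp (- Ci * z)) / (2 * Ci))%C.
Definition Ccos (z : C) : C := ((Cexp (Ci * z) + Cexp (- Ci * z)) / 2)%C.

Lemma Ci_neq_0 : Ci <> 0%C.
Proof. intros E. apply (f_equal snd) in E. simpl in E. lra. Qed.

Lemma Ci_mult_pair (a b : R) : (Ci * (a, b))%C = (- b, a).
Proof. unfold Ci, Cmult; simpl. f_equal; ring. Qed.

Lemma Csin_pair (a b : R) : Csin (a, b) = (sin a * cosh b, cos a * sinh b).
Proof.
assert (H : (2 * Ci * Csin (a, b))%C = (2 * Ci * ((sin a * cosh b)%R, (cos a * sinh b)%R))%C).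
{ unfold Csin. replace (2 * Ci * ((Cexp (Ci * (a, b)) - Cexp (- Ci * (a, b))) / (2 * Ci)))%C
    with (Cexp (Ci * (a, b)) - Cexp (- (Ci * (a, b))))%C.
  - rewrite Ci_mult_pair. unfold Cexp, Copp, Re, Im, Cminus, Cplus, RtoC, Ci, Cmult, cosh, sinh; simpl.
    rewrite cos_neg, sin_neg, Ropp_involutive. f_equal; field.
  - replace (- (Ci * (a, b)))%C with (- Ci * (a, b))%C by ring.
    field. apply Ci_neq_0. }
assert (E : forall u : C, u = (2 * Ci * u / (2 * Ci))%C).
{ intros u. field. apply Ci_neq_0. }
rewrite (E (Csin (a, b))), H. symmetry. apply E.
Qed.

Lemma is_Cder_Csin (z : C) : is_Cder Csin z (Ccos z).
Proof.
assert (D : forall k : C, is_Cder (fun z => Cexp (k * z))%C z (k * Cexp (k * z))%C).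
{ intros k. apply (is_Cder_comp Cexp (fun z => k * z)%C); [apply is_Cder_Cexp|].
  assert (H := is_Cder_scal_l k (fun z => z) z _ (is_Cder_id z)). rewrite Cmult_1_r in H. exact H. }
assert (H := is_Cder_scal_l (/ (2 * Ci))%C _ z _ (is_Cder_minus _ _ z _ _ (D Ci) (D (- Ci)%C))).
replace (Ccos z) with (/ (2 * Ci) * (Ci * Cexp (Ci * z) - - Ci * Cexp (- Ci * z)))%C.
- apply is_Cder_ext_loc with (2 := H). exists 1. split; [lra|]. intros w _.
  unfold Csin, Cdiv. ring.
- unfold Ccos. field. apply Ci_neq_0.
Qed.

Lemma Csin_Ccos_sqr (z : C) : (Csin z * Csin z + Ccos z * Ccos z = 1)%C.
Proof.
assert (H : (Cexp (Ci * z) * Cexp (- Ci * z) = 1)%C).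
{ replace (- Ci * z)%C with (- (Ci * z))%C by ring. apply Cexp_opp. }
assert (I2 : (Ci * Ci = - (1))%C) by (unfold Ci, Cmult, Copp, RtoC; simpl; f_equal; ring).
unfold Csin, Ccos. set (u := Cexp (Ci * z)) in *. set (v := Cexp (- Ci * z)%C) in *.
transitivity (((u - v) * (u - v) / (4 * (Ci * Ci))) + (u + v) * (u + v) / 4)%C.
- field. apply Ci_neq_0.
- rewrite I2. transitivity (u * v)%C; [|exact H]. field.
Qed.

Lemma Csin_0 : Csin 0 = 0%C.
Proof. change (RtoC 0) with ((0, 0) : C). rewrite Csin_pair, sin_0, sinh_0. f_equal; ring. Qed.

Lemma Ccos_0 : Ccos 0 = 1%C.
Proof.
unfold Ccos. replace (Ci * 0)%C with (RtoC 0) by ring. replace (- Ci * 0)%C with (RtoC 0) by ring.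
rewrite Cexp_RtoC, exp_0. field. 
Qed.

Lemma cosh_sqr (b : R) : cosh b ^ 2 = 1 + sinh b ^ 2.
Proof.
unfold cosh, sinh. assert (H : exp b * exp (- b) = 1) by (rewrite <- exp_plus, Rplus_opp_r; apply exp_0).
transitivity ((exp b ^ 2 - 2 * (exp b * exp (- b)) + exp (- b) ^ 2) / 4 + exp b * exp (- b)); [field|].
rewrite H at 2. field.
Qed.

Lemma cosh_pos (b : R) : 1 <= cosh b.
Proof.
assert (H := cosh_sqr b). assert (H0 := pow2_ge_0 (sinh b)).
assert (0 < cosh b) by (unfold cosh; assert (H1 := exp_pos b); assert (H2 := exp_pos (- b)); lra).
nra.
Qed.

Lemma cosh_Rabs (b : R) : cosh (Rabs b) = cosh b.
Proof.
unfold Rabs. destruct Rcase_abs; trivial. unfold cosh. rewrite Ropp_involutive. lra.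
Qed.

Lemma sinh_Rabs (b : R) : sinh (Rabs b) = Rabs (sinh b).
Proof.
assert (H : forall t, 0 <= t -> 0 <= sinh t).
{ intros t Ht. unfold sinh. assert (exp (- t) <= exp t) by (destruct (Req_dec t 0) as [->|n];
    [rewrite Ropp_0; lra|left; apply exp_increasing; lra]). lra. }
unfold Rabs at 1. destruct (Rcase_abs b) as [Hb|Hb].
- assert (E : sinh (- b) = - sinh b) by (unfold sinh; rewrite Ropp_involutive; field).
  assert (H1 := H (- b) ltac:(lra)). rewrite E in *. rewrite Rabs_left1; lra.
- rewrite Rabs_pos_eq; trivial. apply H. lra.
Qed.

(** The source of the zeros of [Csin] and of its bounds on the contour: dropping one term gives
    lower bounds, by [sinh] on horizontal sides and by [sin] on vertical ones, and [sin^2 <= 1]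
    gives the upper bound [cosh]. *)
Lemma Cmod_Csin_sqr (z : C) : Cmod (Csin z) ^ 2 = sin (Re z) ^ 2 + sinh (Im z) ^ 2.
Proof.
destruct z as [a b]. rewrite Csin_pair, Cmod2_alt. unfold Re, Im; simpl fst; simpl snd.
rewrite !Rpow_mult_distr, cosh_sqr. assert (H := sin2_cos2 a). unfold Rsqr in H.
replace (cos a ^ 2) with (1 - sin a ^ 2) by (simpl; lra). ring.
Qed.

Lemma Cmod_Csin_le (z : C) : Cmod (Csin z) <= cosh (Im z).
Proof.
apply Rsqr_incr_0_var; [|assert (H := cosh_pos (Im z)); lra].
rewrite !Rsqr_pow2, Cmod_Csin_sqr, cosh_sqr.
assert (H := sin2_cos2 (Re z)). unfold Rsqr in H. assert (H1 := pow2_ge_0 (cos (Re z))). simpl in *. lra.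
Qed.

Lemma Cmod_Csin_ge_sinh (z : C) : sinh (Rabs (Im z)) <= Cmod (Csin z).
Proof.
rewrite sinh_Rabs. apply Rsqr_incr_0_var; [|apply Cmod_ge_0].
rewrite !Rsqr_pow2, Cmod_Csin_sqr, pow2_abs. assert (H := pow2_ge_0 (sin (Re z))). lra.
Qed.

Lemma Cmod_Csin_ge_sin (z : C) : Rabs (sin (Re z)) <= Cmod (Csin z).
Proof.
apply Rsqr_incr_0_var; [|apply Cmod_ge_0].
rewrite !Rsqr_pow2, Cmod_Csin_sqr, pow2_abs. assert (H := pow2_ge_0 (sinh (Im z))). lra.
Qed.

Lemma Rabs_sinh_le (b : R) : Rabs (sinh b) <= Rabs b * cosh b.
Proof.
rewrite <- sinh_Rabs, <- cosh_Rabs. set (t := Rabs b). assert (Ht : 0 <= t) by apply Rabs_pos.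
destruct (MVT_gen sinh 0 t cosh) as [c [Hc Ec]].
- intros x _. unfold sinh, cosh. auto_derive; trivial. field.
- intros x _. apply derivable_continuous_pt. exists (cosh x). apply derivable_pt_lim_sinh.
- rewrite sinh_0, !Rminus_0_r in Ec. rewrite Ec, Rmult_comm. apply Rmult_le_compat_l; trivial.
  rewrite Rmin_left, Rmax_right in Hc by assumption.
  apply Rsqr_incr_0_var; [|assert (H := cosh_pos t); lra].
  rewrite !Rsqr_pow2, !cosh_sqr. apply Rplus_le_compat_l, pow_incr.
  unfold sinh. assert (E : forall u v, u <= v -> exp u <= exp v).
  { intros u v Huv. destruct Huv as [Huv| ->]; [left; now apply exp_increasing|lra]. }
  assert (E1 := E c t ltac:(lra)). assert (E2 := E (- t) (- c) ltac:(lra)).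
  assert (E3 := E (- c) c ltac:(lra)). lra.
Qed.

Lemma Cmod_Csin_le_linear (z : C) : Cmod (Csin z) <= 2 * Cmod z * cosh (Im z).
Proof.
assert (H1 := re_le_Cmod z). assert (H2 := Im_le_Cmod z).
destruct z as [a b]. unfold Re, Im in *; simpl in *. set (r := Cmod (a, b)) in *.
rewrite Csin_pair. eapply Rle_trans; [apply Cmod_le_Re_Im|]. unfold Re, Im; simpl.
rewrite !Rabs_mult. assert (H3 := cosh_pos b). rewrite (Rabs_pos_eq (cosh b)) by lra.
assert (H4 := Rabs_sin_le a). assert (H5 := Rabs_sinh_le b).
assert (H6 : Rabs (cos a) <= 1) by (apply Rabs_le; assert (H := COS_bound a); lra).
assert (Rabs (sin a) * cosh b <= r * cosh b) by (apply Rmult_le_compat_r; lra).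
assert (Rabs (cos a) * Rabs (sinh b) <= 1 * (r * cosh b)).
{ apply Rmult_le_compat; trivial; try apply Rabs_pos.
  apply Rle_trans with (1 := H5). apply Rmult_le_compat_r; lra. }
lra.
Qed.

Lemma Csin_eq_0 (z : C) : Csin z = 0%C -> exists k : Z, z = RtoC (IZR k * PI).
Proof.
intros H. assert (E := Cmod_Csin_sqr z). rewrite H, Cmod_0 in E.
assert (H1 := pow2_ge_0 (sin (Re z))). assert (H2 := pow2_ge_0 (sinh (Im z))).
assert (Es : sin (Re z) = 0) by nra. assert (Eh : sinh (Im z) = 0) by nra.
destruct (sin_eq_0_0 _ Es) as [k Hk]. exists k. destruct z as [a b].
unfold Re, Im in *; simpl in *. unfold RtoC. f_equal; trivial.
assert (Hexp : exp b = exp (- b)) by (unfold sinh in Eh; lra).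
apply exp_inv in Hexp. lra.
Qed.

Lemma Csin_minus_PI (z : C) (k : Z) : Csin (z - RtoC (IZR k * PI)) = (RtoC (cos (IZR k * PI)) * Csin z)%C.
Proof.
destruct z as [a b]. replace ((a, b) - RtoC (IZR k * PI))%C with ((a - IZR k * PI, b) : C).
2: { unfold RtoC, Cminus, Cplus, Copp; simpl. f_equal; ring. }
rewrite !Csin_pair. rewrite sin_minus, cos_minus.
rewrite (sin_eq_0_1 (IZR k * PI)) by now exists k.
unfold RtoC, Cmult; simpl. f_equal; ring.
Qed.

Definition SincC (w : C) : C :=
  if excluded_middle_informative (w = 0%C) then 1%C else (Csin w / w)%C.

Lemma SincC_neq_0 (w : C) : w <> 0%C -> SincC w = (Csin w / w)%C.
Proof. intros H. unfold SincC. now destruct excluded_middle_informative. Qed.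

(** At 0, [SincC] is the completed difference quotient of [Csin], whose derivative there is
    [Ccos 0 = 1]. *)
Lemma ex_Cder_SincC (w : C) : ex_Cder SincC w.
Proof.
destruct (classic (w = 0%C)) as [->|n].
- assert (H : holomorphic_near Csin 0).
  { exists 1. split; [lra|]. intros z _. exists (Ccos z). apply is_Cder_Csin. }
  apply ex_Cder_ext_loc with (2 := ex_Cder_diff_quot Csin 0 H).
  exists 1. split; [lra|]. intros v _. unfold SincC, diff_quot. destruct excluded_middle_informative as [e|n].
  + rewrite (C_derive_is_Cder _ _ _ (is_Cder_Csin 0)). apply Ccos_0.
  + rewrite Csin_0. field. assumption.
- apply ex_Cder_ext_loc with (fun w => Csin w / w)%C.
  + exists (Cmod w). split; [now apply Cmod_gt_0|]. intros v Hv. symmetry. apply SincC_neq_0.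
    intros E. rewrite E in Hv. replace (0 - w)%C with (- w)%C in Hv by ring.
    rewrite Cmod_opp in Hv. lra.
  + apply ex_Cder_div; [assumption| |apply ex_Cder_id]. exists (Ccos w). apply is_Cder_Csin.
Qed.

Lemma Cmod_SincC_le (w : C) : Cmod (SincC w) <= 2 * cosh (Im w).
Proof.
assert (Hc := cosh_pos (Im w)). unfold SincC.
destruct excluded_middle_informative as [e|n]; [rewrite Cmod_1; lra|].
rewrite Cmod_div by assumption. apply Cmod_gt_0 in n.
apply Rmult_le_reg_r with (Cmod w); trivial. unfold Rdiv. rewrite Rmult_assoc, Rinv_l by lra.
assert (H := Cmod_Csin_le_linear w). lra.
Qed.

Lemma SincC_PI (k : Z) : k <> 0%Z -> SincC (RtoC (IZR k * PI)) = 0%C.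
Proof.
intros Hk. rewrite SincC_neq_0.
- assert (E := Csin_minus_PI 0 (- k)). rewrite opp_IZR, Csin_0 in E.
  replace (0 - RtoC (- IZR k * PI))%C with (RtoC (IZR k * PI)) in E.
  2: { unfold RtoC, Cminus, Cplus, Copp; simpl. f_equal; ring. }
  rewrite E. unfold Cdiv. ring.
- intros E. apply (f_equal fst) in E. simpl in E. assert (H := PI_RGT_0).
  apply Rmult_integral in E. destruct E as [E|E]; [|lra]. apply Hk. now apply eq_IZR.
Qed.

Definition SincZ (k : Z) (h : R) (z : C) : C := SincC (RtoC (PI / h) * (z - RtoC (IZR k * h)))%C.

Lemma ex_Cder_SincZ (k : Z) (h : R) (z : C) : ex_Cder (SincZ k h) z.
Proof.
apply (ex_Cder_comp SincC (fun z => RtoC (PI / h) * (z - RtoC (IZR k * h)))%C);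
  [apply ex_Cder_SincC|].
apply ex_Cder_mult; [apply ex_Cder_const|].
apply ex_Cder_minus; [apply ex_Cder_id|apply ex_Cder_const].
Qed.

Lemma SincZ_RtoC (k : Z) (h x : R) : 0 < h -> SincZ k h (RtoC x) = RtoC (Sinc k h x).
Proof.
intros Hh. assert (Hpi := PI_RGT_0). unfold SincZ, Sinc.
replace (RtoC (PI / h) * (RtoC x - RtoC (IZR k * h)))%C with (RtoC (PI / h * (x - IZR k * h)))
  by now rewrite RtoC_mult, RtoC_minus.
destruct (Req_EM_T x (IZR k * h)) as [e|n].
- rewrite e, Rminus_diag, Rmult_0_r. unfold SincC. now destruct excluded_middle_informative.
- assert (Hp : 0 < PI / h) by now apply Rdiv_lt_0_compat.
  assert (Hn : PI / h * (x - IZR k * h) <> 0) by (apply Rmult_integral_contrapositive; split; lra).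
  rewrite SincC_neq_0 by (intros E; apply RtoC_inj in E; contradiction).
  replace (PI * (x - IZR k * h) / h) with (PI / h * (x - IZR k * h)) by (field; lra).
  unfold RtoC at 1. rewrite Csin_pair, sinh_0, cosh_0, Rmult_1_r, Rmult_0_r.
  change ((sin (PI / h * (x - IZR k * h)), 0) : C) with (RtoC (sin (PI / h * (x - IZR k * h)))).
  now rewrite RtoC_div.
Qed.

Lemma Cmod_SincZ_le (k : Z) (h : R) (z : C) : Cmod (SincZ k h z) <= 2 * cosh (PI / h * Im z).
Proof.
eapply Rle_trans; [apply Cmod_SincC_le|]. apply Req_le. do 2 f_equal.
unfold Im; simpl. ring.
Qed.

Lemma SincZ_node (j k : Z) (h : R) : 0 < h ->
  SincZ j h (RtoC (IZR k * h)) = if Z.eq_dec j k then 1%C else 0%C.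
Proof.
intros Hh. unfold SincZ.
replace (RtoC (PI / h) * (RtoC (IZR k * h) - RtoC (IZR j * h)))%C with (RtoC (IZR (k - j) * PI)).
2: { rewrite <- RtoC_minus, <- RtoC_mult, minus_IZR. f_equal. field. lra. }
destruct (Z.eq_dec j k) as [->|n].
- rewrite Z.sub_diag, Rmult_0_l. unfold SincC. now destruct excluded_middle_informative.
- apply SincC_PI. lia.
Qed.

(** Since [sin (PI z / h - k PI) = (-1)^k sin (PI z / h)], with [(-1)^k] written [cos (k PI)],
    dividing a sinc by the common sine leaves one simple pole. The interpolant over the sine is thus
    a partial fraction sum. *)
Lemma SincZ_div_Csin (k : Z) (h : R) (z : C) : 0 < h -> Csin (RtoC (PI / h) * z) <> 0%C ->
  (SincZ k h z / Csin (RtoC (PI / h) * z) =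
   RtoC (cos (IZR k * PI)) * RtoC (h / PI) * / (z - RtoC (IZR k * h)))%C /\ z <> RtoC (IZR k * h).
Proof.
intros Hh Hz. assert (Hpi := PI_RGT_0).
assert (Hp : 0 < PI / h) by now apply Rdiv_lt_0_compat.
assert (Hp' : RtoC (PI / h) <> 0%C) by (intros E; apply RtoC_inj in E; lra).
assert (E1 : Csin (RtoC (PI / h) * (z - RtoC (IZR k * h)))%C =
   (RtoC (cos (IZR k * PI)) * Csin (RtoC (PI / h) * z))%C).
{ rewrite <- Csin_minus_PI. f_equal. replace (IZR k * PI) with (PI / h * (IZR k * h)) by (field; lra).
  rewrite !RtoC_mult. ring. }
assert (Hn : z <> RtoC (IZR k * h)).
{ intros E. apply Hz. rewrite E, <- RtoC_mult.
  replace (PI / h * (IZR k * h)) with (IZR k * PI) by (field; lra).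
  unfold RtoC. rewrite Csin_pair, sinh_0. rewrite (sin_eq_0_1 (IZR k * PI)) by now exists k.
  f_equal; ring. }
split; trivial. assert (Hn' := Cminus_neq_0 _ _ Hn).
unfold SincZ. rewrite SincC_neq_0 by now apply Cmult_neq_0.
rewrite E1. replace (RtoC (h / PI)) with (/ RtoC (PI / h))%C.
- field. repeat split; trivial.
- rewrite <- RtoC_inv by lra. f_equal. field. lra.
Qed.

Lemma Csum_ext (F G : nat -> C) (n : nat) :
  (forall j, (1 <= j <= n)%nat -> F j = G j) -> Csum F n = Csum G n.
Proof. intros H. unfold Csum. apply sum_n_m_ext_loc. intros k Hk. apply H. lia. Qed.

Lemma Csum_single (F : nat -> C) (n j : nat) : (1 <= j <= n)%nat ->
  (forall i, i <> j -> F i = 0%C) -> Csum F n = F j.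
Proof.
intros Hj H. induction n as [|n IH]; [lia|]. rewrite Csum_S.
destruct (Nat.eq_dec j (S n)) as [->|n0].
- rewrite (Csum_ext F (fun _ => 0%C)).
  + assert (E0 : forall p, Csum (fun _ => 0%C) p = 0%C).
    { intros p. induction p as [|p IHp]; [apply Csum_0|]. rewrite Csum_S, IHp. apply Cplus_0_l. }
    rewrite E0. apply Cplus_0_l.
  + intros i Hi. apply H. lia.
- rewrite IH by lia. rewrite (H (S n)) by congruence. apply Cplus_0_r.
Qed.

(** * Sinc interpolation of a function holomorphic on a strip *)

Lemma Ccont_neq_0 (g : C -> C) (z : C) : Ccont g z -> g z <> 0%C ->
  exists delta, 0 < delta /\ forall w : C, Cmod (w - z) < delta -> g w <> 0%C.
Proof.
intros Hc Hz. rewrite Ccont_eps in Hc.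
destruct (Hc (Cmod (g z))) as [del [Hd H]]; [now apply Cmod_gt_0|].
exists del. split; trivial. intros w Hw E. specialize (H w Hw). rewrite E in H.
replace (0 - g z)%C with (- g z)%C in H by ring. rewrite Cmod_opp in H. lra.
Qed.

(** The two residues are opposite. This removes the whole interpolation sum from the contour
    integral. *)
Lemma RIntC_rect_pole_pair (x z : C) (a b c d : R) : x <> z -> in_rect x a b c d -> in_rect z a b c d ->
  on_boundary (Ccont (fun w => / (w - x) * / (w - z))%C) a b c d /\
  RIntC_rect (fun w => / (w - x) * / (w - z))%C a b c d = 0%C.
Proof.
intros Hn Hx Hz. assert (Bx := boundary_neq _ _ _ _ _ Hx). assert (Bz := boundary_neq _ _ _ _ _ Hz).
assert (Cx : on_boundary (Ccont (fun w => / (w - x))%C) a b c d).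
{ revert Bx. apply on_boundary_imp. intros w. apply Ccont_inv_minus. }
assert (Cz : on_boundary (Ccont (fun w => / (w - z))%C) a b c d).
{ revert Bz. apply on_boundary_imp. intros w. apply Ccont_inv_minus. }
assert (Hab : a <= b) by (destruct Hx; lra). assert (Hcd : c <= d) by (destruct Hx; lra).
split.
- generalize (on_boundary_and _ _ _ _ _ _ Cx Cz). apply on_boundary_imp.
  intros w [H1 H2]. now apply Ccont_mult.
- assert (Cz' : on_boundary (Ccont (fun w => - (1) * / (w - z))%C) a b c d).
  { revert Cz. apply on_boundary_imp. intros w H.
    apply (Ccont_mult (fun _ => - (1))%C); [apply ex_Cder_cont, ex_Cder_const|exact H]. }
  assert (Cxz : on_boundary (Ccont (fun w => / (w - x) + - (1) * / (w - z))%C) a b c d).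
  { generalize (on_boundary_and _ _ _ _ _ _ Cx Cz'). apply on_boundary_imp.
    intros w [H1 H2]. now apply Ccont_plus. }
  rewrite (RIntC_rect_ext a b c d Hab Hcd _
    (fun w => / (x - z) * (/ (w - x) + - (1) * / (w - z)))%C).
  + rewrite RIntC_rect_scal, RIntC_rect_plus, RIntC_rect_scal, !RIntC_rect_winding; trivial. ring.
  + generalize (on_boundary_and _ _ _ _ _ _ Bx Bz). apply on_boundary_imp. intros w [H1 H2].
    field. repeat split; now apply Cminus_neq_0.
Qed.

Lemma RIntC_rect_Csum_0 (f : nat -> C -> C) (n : nat) (a b c d : R) : a <= b -> c <= d ->
  (forall j, (1 <= j <= n)%nat ->
     on_boundary (Ccont (f j)) a b c d /\ RIntC_rect (f j) a b c d = 0%C) ->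
  on_boundary (Ccont (fun w => Csum (fun j => f j w) n)) a b c d /\
  RIntC_rect (fun w => Csum (fun j => f j w) n) a b c d = 0%C.
Proof.
intros Hab Hcd. induction n as [|n IH]; intros H.
- assert (E : forall w, Csum (fun j => f j w) 0 = 0%C) by (intros w; apply Csum_0). split.
  + apply on_rect_boundary; trivial. intros x y _ _.
    apply Ccont_ext_loc with (fun _ => 0%C); [|apply ex_Cder_cont, ex_Cder_const].
    exists 1. split; [lra|]. intros w _. symmetry. apply E.
  + rewrite (RIntC_rect_ext a b c d Hab Hcd _ (fun z => 0 + 0 * z)%C).
    * now apply RIntC_rect_affine.
    * apply on_rect_boundary; trivial. intros x y _ _. rewrite E. ring.
- destruct IH as [C1 E1]; [intros j Hj; apply H; lia|].
  destruct (H (S n)) as [C2 E2]; [lia|].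
  assert (E : forall w, Csum (fun j => f j w) (S n) = (Csum (fun j => f j w) n + f (S n) w)%C)
    by (intros w; apply Csum_S).
  split.
  + generalize (on_boundary_and _ _ _ _ _ _ C1 C2). apply on_boundary_imp. intros w [H1 H2].
    apply Ccont_ext_loc with (fun w => Csum (fun j => f j w) n + f (S n) w)%C.
    * exists 1. split; [lra|]. intros v _. symmetry. apply E.
    * now apply Ccont_plus.
  + rewrite (RIntC_rect_ext a b c d Hab Hcd _ (fun w => Csum (fun j => f j w) n + f (S n) w)%C).
    * rewrite RIntC_rect_plus, E1, E2; trivial. apply Cplus_0_l.
    * apply on_rect_boundary; trivial. intros x y _ _. apply E.
Qed.

Lemma Csum_scal (k : C) (F : nat -> C) (n : nat) : Csum (fun j => k * F j)%C n = (k * Csum F n)%C.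
Proof.
induction n as [|n IH]; [rewrite !Csum_0; symmetry; apply Cmult_0_r|].
rewrite !Csum_S, IH. symmetry. apply Cmult_plus_distr_l.
Qed.

Section Contour.
Variables (F : C -> C) (d h d' : R) (L : nat).
Hypothesis HF : holo_strip d F.
Hypothesis Hh : 0 < h.
Hypothesis Hd' : 0 < d' < d.

(** Midway between the nodes [L h] and [(L + 1) h], where [|sin (PI A / h)| = 1]. *)
Let A : R := (INR L + / 2) * h.
Let n : nat := (2 * L + 1)%nat.
(** Since [Csum] starts at index 1, this runs from [- L] to [L]. *)
Let kappa (j : nat) : Z := (- Z.of_nat L + Z.of_nat j - 1)%Z.
Let node (j : nat) : C := RtoC (IZR (kappa j) * h).
Let Sn (w : C) : C := Csin (RtoC (PI / h) * w)%C.

Definition sinc_remainder (z : C) : C :=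
  (F z - Csum (fun j => F (node j) * SincZ (kappa j) h z) n)%C.

Lemma A_pos : 0 < A.
Proof. unfold A. assert (H := pos_INR L). apply Rmult_lt_0_compat; lra. Qed.

Lemma scale_pos : 0 < PI / h.
Proof. apply Rdiv_lt_0_compat; [apply PI_RGT_0|assumption]. Qed.

Lemma scale_Re (w : C) : Re (RtoC (PI / h) * w) = PI / h * Re w.
Proof. unfold Re; simpl. ring. Qed.

Lemma scale_Im (w : C) : Im (RtoC (PI / h) * w) = PI / h * Im w.
Proof. unfold Im; simpl. ring. Qed.

Lemma is_Cder_Sn (w : C) : is_Cder Sn w (RtoC (PI / h) * Ccos (RtoC (PI / h) * w))%C.
Proof.
apply (is_Cder_comp Csin (fun w => RtoC (PI / h) * w)%C); [apply is_Cder_Csin|].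
assert (H := is_Cder_scal_l (RtoC (PI / h)) (fun z => z) w _ (is_Cder_id w)).
rewrite Cmult_1_r in H. exact H.
Qed.

Lemma Sn_zero (w : C) : Sn w = 0%C -> exists k : Z, w = RtoC (IZR k * h).
Proof.
intros H. destruct (Csin_eq_0 _ H) as [k Hk]. exists k. assert (Hp := scale_pos).
assert (Hpi := PI_RGT_0).
assert (Hp' : RtoC (PI / h) <> 0%C) by (intros E; apply RtoC_inj in E; lra).
replace w with (RtoC (PI / h) * w / RtoC (PI / h))%C by now field. rewrite Hk.
rewrite <- RtoC_div by lra. f_equal. field. lra.
Qed.

(** The zeros of [Sn] are simple because [sin^2 + cos^2 = 1]. *)
Lemma Sn_node_der (w : C) : Sn w = 0%C -> (RtoC (PI / h) * Ccos (RtoC (PI / h) * w))%C <> 0%C.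
Proof.
intros H. assert (Hp := scale_pos). apply Cmult_neq_0.
- intros E; apply RtoC_inj in E; lra.
- intros E. assert (H1 := Csin_Ccos_sqr (RtoC (PI / h) * w)). fold (Sn w) in H1.
  rewrite H, E in H1. apply (f_equal fst) in H1. simpl in H1. lra.
Qed.

Lemma Cmod_Sn_horizontal (w : C) : Rabs (Im w) = d' -> sinh (PI / h * d') <= Cmod (Sn w).
Proof.
intros H. eapply Rle_trans; [|apply Cmod_Csin_ge_sinh]. right. f_equal.
rewrite scale_Im, Rabs_mult, H. rewrite Rabs_pos_eq; trivial. assert (Hp := scale_pos). lra.
Qed.

Lemma sinh_scale_pos : 0 < sinh (PI / h * d').
Proof.
assert (Hp := scale_pos). rewrite <- sinh_0. apply sinh_lt. apply Rmult_lt_0_compat; lra.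
Qed.

Lemma Cmod_Sn_vertical (w : C) : Rabs (Re w) = A -> 1 <= Cmod (Sn w).
Proof.
intros H. eapply Rle_trans; [|apply Cmod_Csin_ge_sin].
rewrite scale_Re.
assert (E : Rabs (sin (PI / h * Re w)) = Rabs (sin (PI / h * A))).
{ rewrite <- H. unfold Rabs at 3. destruct (Rcase_abs (Re w)); trivial.
  rewrite <- Ropp_mult_distr_r, sin_neg, Rabs_Ropp. reflexivity. }
rewrite E. replace (PI / h * A) with (IZR (Z.of_nat L) * PI + PI / 2).
2: { unfold A. rewrite <- INR_IZR_INZ. field. lra. }
rewrite sin_plus, cos_PI2, sin_PI2.
assert (H1 := sin2_cos2 (IZR (Z.of_nat L) * PI)).
rewrite (sin_eq_0_1 (IZR (Z.of_nat L) * PI)) in * by (now exists (Z.of_nat L)).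
unfold Rsqr in H1. rewrite Rmult_0_l, Rplus_0_l, Rmult_1_r.
destruct (Rle_lt_dec 1 (Rabs (cos (IZR (Z.of_nat L) * PI)))) as [|Hl]; trivial.
apply Rabs_def2 in Hl. nra.
Qed.

Lemma Sn_boundary : on_boundary (fun w => Sn w <> 0%C) (- A) A (- d') d'.
Proof.
assert (HA := A_pos). assert (Hs := sinh_scale_pos).
split; intros t Ht; split; apply Cmod_gt_0.
- eapply Rlt_le_trans; [exact Hs|]. apply Cmod_Sn_horizontal. unfold Im; simpl.
  rewrite Rabs_Ropp, Rabs_pos_eq; lra.
- eapply Rlt_le_trans; [exact Hs|]. apply Cmod_Sn_horizontal. unfold Im; simpl.
  rewrite Rabs_pos_eq; lra.
- eapply Rlt_le_trans; [exact Rlt_0_1|]. apply Cmod_Sn_vertical. unfold Re; simpl.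
  rewrite Rabs_Ropp, Rabs_pos_eq; lra.
- eapply Rlt_le_trans; [exact Rlt_0_1|]. apply Cmod_Sn_vertical. unfold Re; simpl.
  rewrite Rabs_pos_eq; lra.
Qed.

Lemma rect_strip (x y : R) : - d' <= y <= d' -> strip d (x, y).
Proof. intros H. unfold strip, Im; simpl. apply Rabs_def1; lra. Qed.

(** Hence every zero of [Sn] in the rectangle is a node of the interpolation, where the remainder
    vanishes as well. *)
Lemma node_in_rect (k : Z) : - A <= IZR k * h <= A ->
  exists j, (1 <= j <= n)%nat /\ kappa j = k.
Proof.
intros [H1 H2]. unfold A in *.
assert (B1 : - (INR L + / 2) <= IZR k) by (apply Rmult_le_reg_r with h; lra).
assert (B2 : IZR k <= INR L + / 2) by (apply Rmult_le_reg_r with h; lra).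
rewrite INR_IZR_INZ in B1, B2.
assert (C1 : (- Z.of_nat L - 1 < k)%Z) by (apply lt_IZR; rewrite minus_IZR, opp_IZR; lra).
assert (C2 : (k < Z.of_nat L + 1)%Z) by (apply lt_IZR; rewrite plus_IZR; lra).
exists (Z.to_nat (k + Z.of_nat L + 1)). unfold n, kappa. split; lia.
Qed.

Lemma node_in_rect_conv (j : nat) : (1 <= j <= n)%nat -> in_rect (node j) (- A) A (- d') d'.
Proof.
intros Hj. unfold in_rect, node, n, kappa in *. unfold Re, Im; simpl. split; [|lra].
set (k := (- Z.of_nat L + Z.of_nat j - 1)%Z).
assert (C1 : (- Z.of_nat L <= k)%Z) by (unfold k; lia).
assert (C2 : (k <= Z.of_nat L)%Z) by (unfold k; lia).
apply IZR_le in C1. apply IZR_le in C2. rewrite opp_IZR in C1. rewrite <- INR_IZR_INZ in C1, C2.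
unfold A. split; [rewrite Ropp_mult_distr_l|]; apply Rmult_lt_compat_r; lra.
Qed.

Lemma sinc_remainder_node (j : nat) : (1 <= j <= n)%nat -> sinc_remainder (node j) = 0%C.
Proof.
intros Hj. unfold sinc_remainder. rewrite (Csum_single _ n j Hj).
- unfold node at 3. rewrite SincZ_node by assumption.
  destruct (Z.eq_dec (kappa j) (kappa j)); [ring|easy].
- intros i Hi. unfold node at 2. rewrite SincZ_node by assumption.
  destruct (Z.eq_dec (kappa i) (kappa j)) as [e|_]; [|ring].
  exfalso. apply Hi. unfold kappa in e. lia.
Qed.

Lemma holo_sinc_remainder : holo_strip d sinc_remainder.
Proof.
intros z Hz. apply ex_Cder_minus; [now apply HF|].
apply (ex_Cder_Csum (fun j z => F (node j) * SincZ (kappa j) h z)%C). intros j.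
apply ex_Cder_mult; [apply ex_Cder_const|apply ex_Cder_SincZ].
Qed.

(** The quotient of the remainder by [Sn], its removable singularities filled by the quotient of the
    derivatives. At zeros of [Sn] outside the rectangle the value is arbitrary. *)
Let q (w : C) : C :=
  if excluded_middle_informative (Sn w = 0%C)
  then (C_derive sinc_remainder w / (RtoC (PI / h) * Ccos (RtoC (PI / h) * w)))%C
  else (sinc_remainder w / Sn w)%C.

Lemma q_regular (w : C) : Sn w <> 0%C -> q w = (sinc_remainder w / Sn w)%C.
Proof. intros H. unfold q. now destruct excluded_middle_informative. Qed.

Lemma ex_Cder_q (w : C) : strip d w -> Sn w <> 0%C -> ex_Cder q w.
Proof.
intros Hw H.
assert (HS : ex_Cder Sn w) by (eexists; apply is_Cder_Sn).
apply ex_Cder_ext_loc with (fun w => sinc_remainder w / Sn w)%C.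
- destruct (Ccont_neq_0 Sn w (ex_Cder_cont _ _ HS) H) as [del [Hd Hdel]].
  exists del. split; trivial. intros v Hv. symmetry. apply q_regular. now apply Hdel.
- apply ex_Cder_div; trivial. now apply holo_sinc_remainder.
Qed.

(** Numerator and denominator both vanish at the node, so [q] is locally the quotient of their
    completed difference quotients. Continuity is all that Goursat's theorem asks for at the
    nodes. *)
Lemma Ccont_q_node (j : nat) : (1 <= j <= n)%nat -> Sn (node j) = 0%C -> Ccont q (node j).
Proof.
intros Hj H0. set (a := node j) in *.
assert (Ha : strip d a) by (unfold a, node, strip, Im; simpl; rewrite Rabs_R0; lra).
assert (HE := is_Cder_C_derive _ _ (holo_sinc_remainder a Ha)).
assert (HS := is_Cder_Sn a). assert (Hn := Sn_node_der a H0).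
assert (CE := Ccont_diff_quot _ _ _ HE). assert (CS := Ccont_diff_quot _ _ _ HS).
set (QE := diff_quot _ _ _) in CE. set (QS := diff_quot _ _ _) in CS.
assert (QSa : QS a = (RtoC (PI / h) * Ccos (RtoC (PI / h) * a))%C).
{ apply diff_quot_same. }
assert (QSn : QS a <> 0%C) by now rewrite QSa.
apply Ccont_ext_loc with (fun w => QE w / QS w)%C; [|now apply Ccont_div].
destruct (Ccont_neq_0 QS a CS QSn) as [del [Hd Hdel]]. exists del. split; trivial.
intros w Hw. specialize (Hdel w Hw).
destruct (classic (w = a)) as [->|nw].
- unfold QE, QS, q. rewrite !diff_quot_same. now destruct excluded_middle_informative.
- assert (Hwa := Cminus_neq_0 _ _ nw). unfold QS in Hdel. rewrite diff_quot_neq in Hdel by assumption.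
  assert (e : Sn w <> 0%C).
  { intros e. apply Hdel. rewrite e, H0. unfold Cdiv, Cminus.
    rewrite Cplus_opp_r. apply Cmult_0_l. }
  rewrite q_regular by assumption. unfold QE, QS. rewrite !diff_quot_neq by assumption.
  unfold a at 1. rewrite (sinc_remainder_node j Hj). rewrite H0.
  field. repeat split; trivial.
Qed.

Let nodes : list C := map node (seq 1 n).

Lemma q_rect : on_rect (fun w => Ccont q w /\ (In w nodes \/ ex_Cder q w)) (- A) A (- d') d'.
Proof.
intros x y Hx Hy. destruct (classic (Sn (x, y) = 0%C)) as [e|e].
- destruct (Sn_zero _ e) as [k Hk].
  assert (Ek : x = IZR k * h) by (apply (f_equal fst) in Hk; exact Hk).
  destruct (node_in_rect k) as [j [Hj Ej]]; [lra|].
  assert (E : ((x, y) : C) = node j) by (unfold node; rewrite Ej; exact Hk).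
  rewrite E in *. split; [now apply Ccont_q_node|]. left.
  apply in_map. apply in_seq. lia.
- assert (H := ex_Cder_q (x, y) (rect_strip x y Hy) e). split; [now apply ex_Cder_cont|now right].
Qed.

(** Cauchy's formula for [q] at [x]. On the boundary, [q w / (w - x)] is the integrand with [F]
    minus a sum of pole pairs at a node and at [x], each of integral zero; only the values of [F] on
    the contour survive. *)
Lemma contour_identity (x : C) : in_rect x (- A) A (- d') d' -> Sn x <> 0%C ->
  (2 * PI * Ci * sinc_remainder x)%C =
  (Sn x * RIntC_rect (fun w => F w * / (Sn w * (w - x))) (- A) A (- d') d')%C.
Proof.
intros Hx HSx. assert (HA := A_pos).
assert (Hxs : strip d x).
{ destruct Hx as [_ Hx]. destruct x as [u v]. apply rect_strip. unfold Im in Hx; simpl in Hx. lra. }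
assert (CF := Cauchy_formula q nodes x (- A) A (- d') d' Hx
  (fun u v Hu Hv => proj1 (q_rect u v Hu Hv)) (fun u v Hu Hv => proj2 (q_rect u v Hu Hv))
  (ex_Cder_q x Hxs HSx)).
set (co := fun j => (F (node j) * (RtoC (cos (IZR (kappa j) * PI)) * RtoC (h / PI)))%C).
set (f := fun (j : nat) (w : C) => (co j * (/ (w - node j) * / (w - x)))%C).
assert (Hf := RIntC_rect_Csum_0 f n (- A) A (- d') d' ltac:(lra) ltac:(lra)).
destruct Hf as [Cf Ef].
{ intros j Hj. assert (Hne : node j <> x).
  { intros E. apply HSx. rewrite <- E.
    (* If [Sn] did not vanish at the node, [SincZ_div_Csin] would make the node differ from
       itself. *)
    apply NNPP. intros Hne. destruct (SincZ_div_Csin (kappa j) h (node j) Hh Hne) as [_ Hbad].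
    now apply Hbad. }
  destruct (RIntC_rect_pole_pair (node j) x (- A) A (- d') d' Hne (node_in_rect_conv j Hj) Hx) as [C1 E1].
  split.
  - revert C1. apply on_boundary_imp. intros w Hw.
    apply (Ccont_mult (fun _ => co j)); [apply ex_Cder_cont, ex_Cder_const|exact Hw].
  - unfold f. rewrite RIntC_rect_scal; trivial; try lra. rewrite E1. ring. }
assert (CG : on_boundary (Ccont (fun w => F w * / (Sn w * (w - x)))%C) (- A) A (- d') d').
{ assert (Hs : on_boundary (strip d) (- A) A (- d') d').
  { apply on_rect_boundary; try lra. intros u v _ Hv. now apply rect_strip. }
  generalize (on_boundary_and _ _ _ _ _ _ Hs (on_boundary_and _ _ _ _ _ _ Sn_boundary
     (boundary_neq x _ _ _ _ Hx))). apply on_boundary_imp. intros w [H1 [H2 H3]].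
  apply ex_Cder_cont. apply (ex_Cder_div F (fun w => Sn w * (w - x))%C).
  - apply Cmult_neq_0; [assumption|now apply Cminus_neq_0].
  - now apply HF.
  - apply ex_Cder_mult; [eexists; apply is_Cder_Sn|].
    apply ex_Cder_minus; [apply ex_Cder_id|apply ex_Cder_const]. }
assert (Cf' : on_boundary (Ccont (fun w => - (1) * Csum (fun j => f j w) n)%C) (- A) A (- d') d').
{ revert Cf. apply on_boundary_imp. intros w Hw.
  apply (Ccont_mult (fun _ => - (1))%C); [apply ex_Cder_cont, ex_Cder_const|exact Hw]. }
rewrite (RIntC_rect_ext (- A) A (- d') d' ltac:(lra) ltac:(lra) _
  (fun w => F w * / (Sn w * (w - x)) + - (1) * Csum (fun j => f j w) n)%C) in CF.
- rewrite RIntC_rect_plus, RIntC_rect_scal, Ef in CF; trivial; try lra.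
  rewrite (q_regular x HSx) in CF.
  set (I := RIntC_rect _ _ _ _ _) in *.
  replace I with (I + - (1) * 0)%C by ring. rewrite CF. field. assumption.
- generalize (on_boundary_and _ _ _ _ _ _ Sn_boundary (boundary_neq x _ _ _ _ Hx)).
  apply on_boundary_imp. intros w [H1 H2]. rewrite (q_regular w H1).
  assert (H2' := Cminus_neq_0 _ _ H2).
  rewrite <- Csum_scal.
  assert (E : Csum (fun j => - (1) * f j w)%C n =
    (- (1) * (/ (w - x) * / Sn w) * Csum (fun j => F (node j) * SincZ (kappa j) h w) n)%C).
  { rewrite <- Csum_scal. apply Csum_ext. intros j Hj. unfold f, co.
    destruct (SincZ_div_Csin (kappa j) h w Hh H1) as [E1 _]. fold (Sn w) in E1. fold (node j) in E1.
    replace (- (1) * (/ (w - x) * / Sn w) * (F (node j) * SincZ (kappa j) h w))%C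
      with (- (1) * / (w - x) * F (node j) * (SincZ (kappa j) h w / Sn w))%C by (unfold Cdiv; ring).
    rewrite E1. ring. }
  rewrite E. unfold sinc_remainder. field. now split.
Qed.

Lemma RInt_inv_1_sqr (K a : R) : 0 <= K -> 0 <= a ->
  ex_RInt (fun t => K / (1 + t ^ 2)) (- a) a /\ RInt (fun t => K / (1 + t ^ 2)) (- a) a <= K * PI.
Proof.
intros HK Ha.
assert (D : forall t, is_derive (fun t => K * atan t) t (K / (1 + t ^ 2))).
{ intros t. replace (K / (1 + t ^ 2)) with (K * / (1 + t²))
    by (unfold Rdiv, Rsqr; do 2 f_equal; ring).
  apply is_derive_scal, is_derive_atan. }
assert (H : is_RInt (fun t => K / (1 + t ^ 2)) (- a) a (minus (K * atan a) (K * atan (- a)))).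
{ apply (is_RInt_derive (fun t => K * atan t)); intros t _; [apply D|].
  apply (ex_derive_continuous (V := R_NormedModule)). auto_derive. assert (H := pow2_ge_0 t). simpl in *. lra. }
split; [eexists; exact H|]. rewrite (is_RInt_unique _ _ _ _ H).
rewrite atan_opp. unfold minus, plus, opp; simpl. assert (B := atan_bound a). nra.
Qed.

Variable CF : R.
Hypothesis HCF : forall w, strip d w -> Cmod (F w) <= CF / (1 + Re w ^ 2).

(** On horizontal sides [|Sn| >= sinh (PI d' / h)], and the quadratic decay of [F] has integral at
    most [PI CF] whatever [A] is. On vertical sides [|Sn|] and [|w - x|] are at least 1, and the
    contribution tends to 0 as [A] grows. The factor [cosh] bounds [Sn x]. *)
Lemma contour_bound (x : C) : Rabs (Im x) < d' -> Rabs (Re x) + 1 <= A -> Sn x <> 0%C ->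
  Cmod (sinc_remainder x) <= cosh (PI / h * Im x) *
    (2 * CF / (sinh (PI / h * d') * (d' - Rabs (Im x))) + 2 * d' * CF / (1 + A ^ 2)).
Proof.
intros Hi Hr HSx. assert (HA := A_pos). assert (Hsh := sinh_scale_pos). assert (Hpi := PI_RGT_0).
assert (Hx : in_rect x (- A) A (- d') d').
{ assert (H1 := proj1 (Rabs_le_between (Re x) (A - 1)) ltac:(lra)).
  apply Rabs_def2 in Hi. split; lra. }
assert (HCF0 : 0 <= CF).
{ assert (H := HCF 0%C). unfold strip, Im, Re in H; simpl in H. rewrite Rabs_R0 in H.
  specialize (H ltac:(lra)). assert (H1 := Cmod_ge_0 (F 0)).
  replace (CF / (1 + 0 * (0 * 1))) with CF in H by field. lra. }
assert (E := contour_identity x Hx HSx).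
set (G := fun w => (F w * / (Sn w * (w - x)))%C) in *.
assert (CG : on_boundary (Ccont G) (- A) A (- d') d').
{ assert (Hs : on_boundary (strip d) (- A) A (- d') d').
  { apply on_rect_boundary; try lra. intros u v _ Hv. now apply rect_strip. }
  generalize (on_boundary_and _ _ _ _ _ _ Hs (on_boundary_and _ _ _ _ _ _ Sn_boundary
     (boundary_neq x _ _ _ _ Hx))). apply on_boundary_imp. intros w [H1 [H2 H3]].
  apply ex_Cder_cont. apply (ex_Cder_div F (fun w => Sn w * (w - x))%C).
  - apply Cmult_neq_0; [assumption|now apply Cminus_neq_0].
  - now apply HF.
  - apply ex_Cder_mult; [eexists; apply is_Cder_Sn|].
    apply ex_Cder_minus; [apply ex_Cder_id|apply ex_Cder_const]. }
destruct (ex_RIntC_boundary G (- A) A (- d') d' ltac:(lra) ltac:(lra) CG) as [X1 [X2 [X3 X4]]].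
set (dd := sinh (PI / h * d') * (d' - Rabs (Im x))).
assert (Hdd : 0 < dd) by (apply Rmult_lt_0_compat; lra).
set (K := CF / dd). assert (HK : 0 <= K) by (apply Rdiv_le_0_compat; lra).
assert (GH : forall t y, Rabs y = d' -> Cmod (G (t, y)) <= K / (1 + t ^ 2)).
{ intros t y Hy. unfold G.
  assert (Hs := Cmod_Sn_horizontal (t, y) Hy).
  assert (Hd : d' - Rabs (Im x) <= Cmod ((t, y) - x)).
  { eapply Rle_trans; [|apply snd_le_Cmod]. simpl.
    assert (T := Rabs_triang_inv y (Im x)). unfold Im in *. rewrite Hy in T. exact T. }
  assert (Hprod : dd <= Cmod (Sn (t, y) * ((t, y) - x))).
  { rewrite Cmod_mult. apply Rmult_le_compat; lra. }
  apply Cmod_inv_le in Hprod; trivial. rewrite Cmod_mult.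
  apply Rle_trans with (CF / (1 + t ^ 2) * / dd).
  - apply Rmult_le_compat; try apply Cmod_ge_0; trivial.
    apply (HCF (t, y)). unfold strip, Im; simpl. lra.
  - right. unfold K, Rdiv. ring. }
assert (GV : forall u t, Rabs u = A -> - d' <= t <= d' -> Cmod (G (u, t)) <= CF / (1 + A ^ 2)).
{ intros u t Hu Ht. unfold G.
  assert (Hs := Cmod_Sn_vertical (u, t) Hu).
  assert (Hd : 1 <= Cmod ((u, t) - x)).
  { eapply Rle_trans; [|apply fst_le_Cmod]. simpl.
    assert (T := Rabs_triang_inv u (Re x)). unfold Re in *. rewrite Hu in T. unfold Rminus in T. lra. }
  assert (Hprod : 1 <= Cmod (Sn (u, t) * ((u, t) - x))) by (rewrite Cmod_mult; nra).
  apply Cmod_inv_le in Hprod; [|lra]. rewrite Cmod_mult, <- (Rmult_1_r (CF / _)).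
  apply Rmult_le_compat; try apply Cmod_ge_0.
  - rewrite <- Hu, pow2_abs. apply (HCF (u, t)). now apply rect_strip.
  - rewrite Rinv_1 in Hprod. exact Hprod. }
destruct (RInt_inv_1_sqr K A HK ltac:(lra)) as [Y1 Y2].
assert (HAA : - A <= A) by lra. assert (HDD : - d' <= d') by lra.
assert (N1 : Rabs (- d') = d') by (rewrite Rabs_Ropp; apply Rabs_pos_eq; lra).
assert (N2 : Rabs d' = d') by (apply Rabs_pos_eq; lra).
assert (N3 : Rabs (- A) = A) by (rewrite Rabs_Ropp; apply Rabs_pos_eq; lra).
assert (N4 : Rabs A = A) by (apply Rabs_pos_eq; lra).
assert (B1 := RIntC_le _ _ _ _ HAA X1 Y1 (fun t _ => GH t (- d') N1)).
assert (B2 := RIntC_le _ _ _ _ HAA X2 Y1 (fun t _ => GH t d' N2)).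
assert (B3 := RIntC_bound _ _ _ _ HDD X3 (fun t Ht => GV (- A) t N3 Ht)).
assert (B4 := RIntC_bound _ _ _ _ HDD X4 (fun t Ht => GV A t N4 Ht)).
set (V := CF / (1 + A ^ 2)) in *.
assert (HV : 0 <= V) by (apply Rdiv_le_0_compat; [lra|]; assert (H := pow2_ge_0 A); lra).
assert (BR : Cmod (RIntC_rect G (- A) A (- d') d') <= 4 * (K * PI) + 8 * d' * V).
{ unfold RIntC_rect, Cminus.
  eapply Rle_trans; [apply Cmod_triangle|]. rewrite Cmod_opp, Cmod_mult, Cmod_Ci, Rmult_1_l.
  eapply Rle_trans; [apply Rplus_le_compat_r, Cmod_triangle|]. rewrite Cmod_opp.
  eapply Rle_trans; [apply Rplus_le_compat_r, Rplus_le_compat_r, Cmod_triangle|].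
  rewrite Cmod_mult, Cmod_Ci, Rmult_1_l. lra. }
apply (f_equal Cmod) in E. rewrite !Cmod_mult, Cmod_Ci, !Cmod_R in E.
rewrite !Rabs_pos_eq in E by lra.
assert (BS := Cmod_Csin_le (RtoC (PI / h) * x)). rewrite scale_Im in BS. fold (Sn x) in BS.
assert (Hcosh := cosh_pos (PI / h * Im x)).
apply Rmult_le_reg_l with (2 * PI * 1); [lra|]. rewrite E.
apply Rle_trans with (cosh (PI / h * Im x) * (4 * (K * PI) + 8 * d' * V)).
- apply Rmult_le_compat; try apply Cmod_ge_0; trivial.
- set (B := 2 * CF / dd + 2 * d' * CF / (1 + A ^ 2)).
  replace (2 * PI * 1 * (cosh (PI / h * Im x) * B)) with (cosh (PI / h * Im x) * (2 * PI * 1 * B)) by ring.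
  apply Rmult_le_compat_l; [lra|]. unfold B.
  replace (2 * PI * 1 * (2 * CF / dd + 2 * d' * CF / (1 + A ^ 2))) with
    (4 * (K * PI) + 4 * PI * (d' * V)).
  (* The vertical sides leave [8 d' V <= 4 PI d' V]. *)
  + assert (H3 := PI2_3_2). unfold PI2 in H3. assert (0 <= d' * V) by (apply Rmult_le_pos; lra). nra.
  + unfold K, V, Rdiv. ring.
Qed.

End Contour.

(** * The decay of f o phi4 *)

(** Lower bounds for [w] and [w + 1] or [w - 1], where [w = Clog (1 + Cexp zeta)], are read off from
    their exponentials, which are explicit in [zeta]. *)
Lemma Cexp_minus_1_lower (v : C) (delta : R) : delta <= Cmod (Cexp v - 1) -> Rmin (1 / 2) (delta / 5) <= Cmod v.
Proof.
intros H. destruct (Rle_lt_dec (Cmod v) (1 / 2)) as [Hv|Hv].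
- assert (B := Cexp_minus_1_bound v Hv). eapply Rle_trans; [apply Rmin_r|]. lra.
- eapply Rle_trans; [apply Rmin_l|]. lra.
Qed.

Lemma strip_RtoC (rho x : R) : 0 < rho -> strip rho (RtoC x).
Proof. intros H. unfold strip, Im; simpl. now rewrite Rabs_R0. Qed.

Section Phi4.
Variable d : R.
Hypothesis Hd : 0 < d < PI.

(** This is [cos (d / 2)], positive because [d < PI]. *)
Let c : R := sqrt ((1 + cos d) / 2).

Lemma cos_d_gt : -1 < cos d.
Proof. rewrite <- cos_PI. apply cos_decreasing_1; lra. Qed.

Lemma c_bounds : 0 < c <= 1.
Proof.
assert (H := cos_d_gt). split; [apply sqrt_lt_R0; lra|].
assert (B := COS_bound d). apply Rle_trans with (sqrt 1); [apply sqrt_le_1_alt; lra|].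
rewrite sqrt_1. lra.
Qed.

Lemma cos_strip (eta : R) : Rabs eta < d -> cos d <= cos eta.
Proof.
intros H. replace (cos eta) with (cos (Rabs eta)).
- assert (Hp := Rabs_pos eta). apply cos_decr_1; lra.
- unfold Rabs. destruct Rcase_abs; now rewrite ?cos_neg.
Qed.

(** With [r = exp (Re zeta)], the squares differ by at least [(1 - cos d) (k - r)^2 / 2]. *)
Lemma Cmod_plus_Cexp_ge (k : R) (zeta : C) : 0 <= k -> strip d zeta ->
  c * (k + exp (Re zeta)) <= Cmod (k + Cexp zeta).
Proof.
intros Hk Hz. apply cos_strip in Hz. assert (Hc := c_bounds). assert (Hcd := cos_d_gt).
destruct zeta as [x y]. unfold strip, Re, Im in *; simpl in *.
assert (Hr := exp_pos x). set (r := exp x) in *.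
apply Rsqr_incr_0_var; [|apply Cmod_ge_0].
rewrite !Rsqr_pow2, Cmod2_alt, Rpow_mult_distr.
unfold c at 1. rewrite pow2_sqrt by lra.
unfold Cexp, Re, Im; simpl fst; simpl snd. fold r. rewrite Rplus_0_l.
assert (H := sin2_cos2 y). unfold Rsqr in H.
replace ((k + r * cos y) ^ 2 + (r * sin y) ^ 2) with
  (k ^ 2 + 2 * k * r * cos y + r ^ 2 * (sin y * sin y + cos y * cos y)) by ring.
rewrite H.
assert (H1 : 0 <= k * r) by (apply Rmult_le_pos; lra).
assert (H2 : k * r * cos d <= k * r * cos y) by (apply Rmult_le_compat_l; lra).
assert (H3 := pow2_ge_0 (k - r)).
assert (B := COS_bound d). assert (H4 : 0 <= (1 - cos d) * (k - r) ^ 2) by (apply Rmult_le_pos; lra).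
nra.
Qed.

(** For [|Im zeta| < PI] the value is real only when [Im zeta = 0], and then it exceeds 1; so the
    cut of the logarithm is avoided. *)
Lemma one_plus_Cexp_slit (zeta : C) : strip d zeta ->
  Im (1 + Cexp zeta) <> 0 \/ 0 < Re (1 + Cexp zeta).
Proof.
intros Hz. destruct zeta as [x y]. unfold strip, Re, Im in *; simpl in *.
apply Rabs_def2 in Hz. assert (Hr := exp_pos x).
destruct (Req_dec y 0) as [->|n].
- right. rewrite cos_0. lra.
- left. rewrite Rplus_0_l. apply Rmult_integral_contrapositive. split; [lra|].
  destruct (Rlt_dec 0 y).
  + assert (H := sin_gt_0 y ltac:(lra) ltac:(lra)). lra.
  + assert (H := sin_gt_0 (- y) ltac:(lra) ltac:(lra)). rewrite sin_neg in H. lra.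
Qed.

Lemma slit_neq_0 (z : C) : Im z <> 0 \/ 0 < Re z -> z <> 0%C.
Proof. intros H E. rewrite E in H. unfold Re, Im in H; simpl in H. lra. Qed.

Lemma Cexp_Clog_one_plus (zeta : C) : strip d zeta ->
  Cexp (Clog (1 + Cexp zeta)) = (1 + Cexp zeta)%C.
Proof. intros Hz. apply Cexp_Clog, slit_neq_0, one_plus_Cexp_slit, Hz. Qed.

Lemma Clog_one_plus_neq_0 (zeta : C) : strip d zeta -> Clog (1 + Cexp zeta) <> 0%C.
Proof.
intros Hz E. assert (H := Cexp_Clog_one_plus zeta Hz). rewrite E, Cexp_RtoC, exp_0 in H.
apply (Cexp_neq_0 zeta). replace (Cexp zeta) with (1 + Cexp zeta - 1)%C by ring.
rewrite <- H. ring.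
Qed.

Lemma holo_phi4 : holo_strip d phi4.
Proof.
intros z Hz.
apply ex_Cder_ext_loc with (fun zeta => Clog (1 + Cexp zeta) - 1 / Clog (1 + Cexp zeta))%C.
- destruct (strip_open d z Hz) as [del [Hdel H]]. exists del. split; trivial. intros w Hw.
  rewrite phi4_alt by now apply Clog_one_plus_neq_0, H. unfold Cdiv. ring.
- assert (D : ex_Cder (fun zeta => Clog (1 + Cexp zeta))%C z).
  { apply (ex_Cder_comp Clog (fun zeta => 1 + Cexp zeta)%C).
    - now apply ex_Cder_Clog, one_plus_Cexp_slit.
    - apply ex_Cder_plus; [apply ex_Cder_const|apply ex_Cder_Cexp]. }
  apply ex_Cder_minus; trivial. apply ex_Cder_div; trivial; [|apply ex_Cder_const].
  now apply Clog_one_plus_neq_0.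
Qed.

Variables (f : C -> C) (K alpha beta : R).
Hypothesis Hf : analytic_in (image phi4 (strip d)) f.
Hypotheses (HK : 0 < K) (Ha : 0 < alpha) (Hb : 0 < beta).
Hypothesis Hpos : forall z : C, image phi4 (strip_pos d) z ->
     Cmod (f z) <= K * Rpower (Cmod (Cexp (- z)%C)) beta.
Hypothesis Hneg : forall z : C, image phi4 (strip_neg d) z ->
     Cmod (f z) <= K * (1 / Rpower (Cmod z) alpha).

Lemma holo_f_phi4 : holo_strip d (fun zeta => f (phi4 zeta)).
Proof.
intros z Hz. apply (ex_Cder_comp f phi4); [|now apply holo_phi4].
destruct (Hf (phi4 z)) as [l Hl]; [now exists z|]. exists l. now apply is_Cder_is_derive.
Qed.

(** With [w = Clog (1 + Cexp zeta)], [|exp (- phi4 zeta)| = exp (- Re w + Re (1 / w))]. Here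
    [Re w = ln |1 + e^zeta| >= ln c + Re zeta], and [1 / w] stays bounded. *)
Lemma decay_right : exists B, 0 < B /\ forall zeta, strip d zeta -> 0 <= Re zeta ->
  Cmod (f (phi4 zeta)) <= B * exp (- beta * Re zeta).
Proof.
assert (Hc := c_bounds).
exists (K * exp (beta * (10 - ln c))). split; [apply Rmult_lt_0_compat; [assumption|apply exp_pos]|].
intros zeta Hz H0.
eapply Rle_trans; [apply Hpos; exists zeta; now split|].
rewrite Rmult_assoc, <- exp_plus. apply Rmult_le_compat_l; [lra|].
rewrite Cmod_Cexp. unfold Rpower. rewrite ln_exp.
set (w := Clog (1 + Cexp zeta)).
assert (Hw : phi4 zeta = (w - / w)%C) by now apply phi4_alt, Clog_one_plus_neq_0.
assert (Hew := Cexp_Clog_one_plus zeta Hz). fold w in Hew.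
(* Here [|e^w - 1| = |e^zeta| >= 1]. The resulting [|1 / w| <= 10] is the 10 in the constant. *)
assert (Hwl : 1 / 10 <= Cmod w).
{ assert (L := Cexp_minus_1_lower w 1). rewrite Rmin_right in L by lra.
  apply Rle_trans with (1 / 5); [lra|]. apply L. rewrite Hew.
  replace (1 + Cexp zeta - 1)%C with (Cexp zeta) by ring. rewrite Cmod_Cexp, <- exp_0.
  destruct H0 as [H0| <-]; [left; now apply exp_increasing|lra]. }
assert (Hinv : Re (/ w) <= 10).
{ eapply Rle_trans; [apply Rle_abs|]. eapply Rle_trans; [apply re_le_Cmod|].
  eapply Rle_trans; [apply Cmod_inv_le with (2 := Hwl); lra|]. lra. }
assert (Hre : ln c + Re zeta <= Re w).
{ unfold w, Clog, Re at 2; simpl. rewrite <- (ln_exp (Re zeta)), <- ln_mult by (try apply exp_pos; lra).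
  apply ln_le; [apply Rmult_lt_0_compat; [lra|apply exp_pos]|].
  eapply Rle_trans; [|apply (Cmod_plus_Cexp_ge 1 zeta); trivial; lra].
  apply Rmult_le_compat_l; lra. }
assert (E : Re (- phi4 zeta) = - Re w + Re (/ w)).
{ rewrite Hw. unfold Re; simpl. ring. }
assert (Hle : beta * Re (- phi4 zeta) <= beta * (10 - ln c) + - beta * Re zeta).
{ rewrite E. replace (beta * (10 - ln c) + - beta * Re zeta) with (beta * (10 - ln c - Re zeta)) by ring.
  apply Rmult_le_compat_l; lra. }
destruct Hle as [Hlt| ->]; [left; now apply exp_increasing|lra].
Qed.

(** For [r = exp (Re zeta) <= 1 / 2] the bound [4 r] is [Clog_small]. For [r > 1 / 2] even the
    trivial [|Carg| <= PI] is below [2 PI r], and the logarithm of the modulus is at most [r / c] in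
    absolute value. *)
Lemma Cmod_Clog_one_plus_le (zeta : C) : strip d zeta -> Re zeta < 0 ->
  Cmod (Clog (1 + Cexp zeta)) <= (4 + / c + 2 * PI) * exp (Re zeta).
Proof.
intros Hz H0. assert (Hc := c_bounds). assert (Hpi := PI_RGT_0).
assert (Hr0 := exp_pos (Re zeta)). assert (Hr1 : exp (Re zeta) < 1)
  by (rewrite <- exp_0; now apply exp_increasing).
set (r := exp (Re zeta)) in *.
assert (Hr : Cmod (Cexp zeta) = r) by apply Cmod_Cexp.
assert (Hic : 0 < / c) by (apply Rinv_0_lt_compat; lra).
destruct (Rle_lt_dec r (1 / 2)) as [Hl|Hl].
- eapply Rle_trans; [apply Clog_small|];
  replace (1 + Cexp zeta - 1)%C with (Cexp zeta) by ring; rewrite Hr; trivial.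
  apply Rmult_le_compat_r; lra.
- eapply Rle_trans; [apply Cmod_le_Re_Im|]. unfold Clog, Re, Im; simpl fst; simpl snd.
  assert (Barg : Rabs (Carg (1 + Cexp zeta)) <= PI) by (apply Rabs_le, Carg_bound).
  set (v := Cmod (1 + Cexp zeta)).
  assert (Hv1 : c <= v).
  { eapply Rle_trans; [|apply (Cmod_plus_Cexp_ge 1 zeta); trivial; lra]. fold r. nra. }
  assert (Hv2 : v <= 1 + r).
  { eapply Rle_trans; [apply Cmod_triangle|]. rewrite Cmod_1, Hr. lra. }
  assert (Hv3 : 1 - r <= v).
  { eapply Rle_trans; [|apply Cmod_triangle_rev]. rewrite Cmod_1, Hr. lra. }
  assert (Hln1 := exp_ineq1_le (ln v)). rewrite exp_ln in Hln1 by lra.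
  assert (Hln2 := exp_ineq1_le (- ln v)). rewrite exp_Ropp, exp_ln in Hln2 by lra.
  assert (Hiv : / v - 1 <= / c * r).
  { apply Rmult_le_reg_r with v; [lra|]. rewrite Rmult_minus_distr_r, Rinv_l by lra.
    assert (1 <= / c * v).
    { apply Rmult_le_reg_l with c; [lra|]. rewrite <- Rmult_assoc, Rinv_r by lra. lra. }
    nra. }
  assert (Hic1 : 1 <= / c).
  { rewrite <- Rinv_1. apply Rinv_le_contravar; lra. }
  assert (Hln : Rabs (ln v) <= / c * r) by (apply Rabs_le; split; nra).
  nra.
Qed.

(** Since [phi4 zeta = (w - 1) (w + 1) / w] with [w = O (exp (Re zeta))], it grows like
    [exp (- Re zeta)] once [w] is kept away from 1 and -1. The value 1 would need
    [e^zeta = e - 1 > 1], the value -1 a negative [e^zeta]; both are excluded on the left half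
    strip. *)
Lemma decay_left : exists B, 0 < B /\ forall zeta, strip d zeta -> Re zeta < 0 ->
  Cmod (f (phi4 zeta)) <= B * exp (alpha * Re zeta).
Proof.
assert (Hc := c_bounds). assert (Hpi := PI_RGT_0).
set (e := exp 1). assert (He : 2 < e) by (assert (H := exp_ineq1 1 ltac:(lra)); unfold e; lra).
(* Lower bounds of [|e^(w-1) - 1| = |1 - e + e^zeta| / e], where [|e^zeta| < 1], and of
   [|e^(w+1) - 1| = e |1 - 1/e + e^zeta|], by [Cmod_plus_Cexp_ge] with [k = 1 - 1/e]. *)
set (d1 := (e - 2) / e). set (d2 := e * (c * (1 - / e))).
assert (Hie : 0 < / e < 1) by (split; [apply Rinv_0_lt_compat; lra|];
  rewrite <- Rinv_1; apply Rinv_lt_contravar; lra).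
assert (Hd1 : 0 < d1) by (apply Rdiv_lt_0_compat; lra).
assert (Hd2 : 0 < d2) by (repeat apply Rmult_lt_0_compat; lra).
set (m1 := Rmin (1 / 2) (d1 / 5)). set (m2 := Rmin (1 / 2) (d2 / 5)).
assert (Hm1 : 0 < m1) by (apply Rmin_pos; lra).
assert (Hm2 : 0 < m2) by (apply Rmin_pos; lra).
set (Cw := 4 + / c + 2 * PI).
assert (HCw : 0 < Cw) by (assert (0 < / c) by (apply Rinv_0_lt_compat; lra); unfold Cw; lra).
set (c3 := m1 * m2 / Cw).
assert (Hc3 : 0 < c3) by (apply Rdiv_lt_0_compat; trivial; now apply Rmult_lt_0_compat).
exists (K * exp (- alpha * ln c3)). split; [apply Rmult_lt_0_compat; [assumption|apply exp_pos]|].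
intros zeta Hz H0.
eapply Rle_trans; [apply Hneg; exists zeta; now split|].
rewrite Rmult_assoc, <- exp_plus. apply Rmult_le_compat_l; [lra|].
set (w := Clog (1 + Cexp zeta)).
assert (Hw0 : w <> 0%C) by now apply Clog_one_plus_neq_0.
assert (Hw : phi4 zeta = ((w - 1) * (w + 1) / w)%C).
{ rewrite phi4_alt by assumption. fold w. field. assumption. }
assert (Hew := Cexp_Clog_one_plus zeta Hz). fold w in Hew.
assert (Hwu := Cmod_Clog_one_plus_le zeta Hz H0). fold w Cw in Hwu.
assert (Hr0 := exp_pos (Re zeta)). assert (Hr1 : exp (Re zeta) < 1)
  by (rewrite <- exp_0; now apply exp_increasing).
assert (Hr : Cmod (Cexp zeta) = exp (Re zeta)) by apply Cmod_Cexp.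
assert (L1 : m1 <= Cmod (w - 1)).
{ apply Cexp_minus_1_lower.
  replace (w - 1)%C with (w + RtoC (- (1)))%C by (rewrite RtoC_opp; ring).
  rewrite Cexp_plus, Hew, Cexp_RtoC, exp_Ropp. fold e.
  replace ((1 + Cexp zeta) * RtoC (/ e) - 1)%C with (RtoC (/ e) * (RtoC (1 - e) + Cexp zeta))%C.
  2: { rewrite RtoC_minus, RtoC_inv by lra. field. intros E; apply RtoC_inj in E; lra. }
  rewrite Cmod_mult, Cmod_R, Rabs_pos_eq by lra. unfold d1, Rdiv. rewrite Rmult_comm.
  apply Rmult_le_compat_l; [lra|]. eapply Rle_trans; [|apply Cmod_triangle_rev].
  rewrite Cmod_R, Rabs_left by lra. lra. }
assert (L2 : m2 <= Cmod (w + 1)).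
{ apply Cexp_minus_1_lower.
  rewrite Cexp_plus, Hew, Cexp_RtoC. fold e.
  replace ((1 + Cexp zeta) * RtoC e - 1)%C with (RtoC e * (RtoC (1 - / e) + Cexp zeta))%C.
  2: { rewrite RtoC_minus, RtoC_inv by lra. field. intros E; apply RtoC_inj in E; lra. }
  rewrite Cmod_mult, Cmod_R, Rabs_pos_eq by lra. unfold d2.
  apply Rmult_le_compat_l; [lra|].
  eapply Rle_trans; [|apply (Cmod_plus_Cexp_ge (1 - / e) zeta); trivial; lra].
  apply Rmult_le_compat_l; lra. }
assert (Hwp : 0 < Cmod w) by now apply Cmod_gt_0.
assert (Hz3 : c3 * exp (- Re zeta) <= Cmod (phi4 zeta)).
{ rewrite Hw, Cmod_div, Cmod_mult by assumption.
  rewrite exp_Ropp. unfold c3.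
  replace (m1 * m2 / Cw * / exp (Re zeta)) with (m1 * m2 * / (Cw * exp (Re zeta))) by (field; lra).
  apply Rmult_le_compat.
  - apply Rmult_le_pos; lra.
  - left. apply Rinv_0_lt_compat, Rmult_lt_0_compat; lra.
  - apply Rmult_le_compat; lra.
  - apply Rinv_le_contravar; lra. }
assert (Hz4 : 0 < c3 * exp (- Re zeta)) by (apply Rmult_lt_0_compat; [lra|apply exp_pos]).
assert (Hln := ln_le _ _ Hz4 Hz3). rewrite ln_mult, ln_exp in Hln by (try apply exp_pos; lra).
unfold Rpower, Rdiv. rewrite Rmult_1_l, <- exp_Ropp.
assert (Hle : - (alpha * ln (Cmod (phi4 zeta))) <= - alpha * ln c3 + alpha * Re zeta).
{ replace (- alpha * ln c3 + alpha * Re zeta) with (- (alpha * (ln c3 + - Re zeta))) by ring.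
  apply Ropp_le_contravar, Rmult_le_compat_l; lra. }
destruct Hle as [Hlt| ->]; [left; now apply exp_increasing|lra].
Qed.

Lemma decay_rational : exists CF, forall zeta, strip d zeta ->
  Cmod (f (phi4 zeta)) <= CF / (1 + Re zeta ^ 2).
Proof.
destruct decay_right as [B1 [HB1 H1]]. destruct decay_left as [B2 [HB2 H2]].
(* Sum of [1 <= exp (a t)] and [(a t)^2 / 4 <= exp (a t)], the latter by squaring
   [1 + s / 2 <= exp (s / 2)]. One majorant then serves both ends of the contour. *)
assert (key : forall a t, 0 < a -> 0 <= t -> exp (- a * t) <= (1 + 4 / (a * a)) / (1 + t ^ 2)).
{ intros a t Hat Ht.
  assert (Hy : 0 <= a * t) by (apply Rmult_le_pos; lra).
  assert (E1 := exp_ineq1_le (a * t / 2)).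
  assert (E2 : exp (a * t) = exp (a * t / 2) * exp (a * t / 2)) by (rewrite <- exp_plus; f_equal; field).
  assert (E3 : 1 <= exp (a * t)) by (rewrite <- exp_0; destruct Hy as [Hy| <-]; [left; now apply exp_increasing|lra]).
  assert (E4 : (a * t) * (a * t) / 4 <= exp (a * t)) by (rewrite E2; nra).
  assert (P := pow2_ge_0 t).
  replace (- a * t) with (- (a * t)) by ring. rewrite exp_Ropp.
  assert (Hp := exp_pos (a * t)).
  apply Rmult_le_reg_r with (exp (a * t)); trivial. rewrite Rinv_l by lra.
  apply Rmult_le_reg_r with (1 + t ^ 2); [lra|].
  replace ((1 + 4 / (a * a)) / (1 + t ^ 2) * exp (a * t) * (1 + t ^ 2))
    with (exp (a * t) + 4 / (a * a) * exp (a * t)) by (field; split; lra).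
  rewrite Rmult_1_l. apply Rplus_le_compat; trivial.
  replace (t ^ 2) with (4 / (a * a) * ((a * t) * (a * t) / 4)) by (field; lra).
  apply Rmult_le_compat_l; trivial.
  assert (0 < a * a) by now apply Rmult_lt_0_compat. apply Rlt_le, Rdiv_lt_0_compat; lra. }
assert (Kp : forall a, 0 < a -> 0 < 1 + 4 / (a * a)).
{ intros a Hat. assert (0 < a * a) by now apply Rmult_lt_0_compat.
  assert (0 < 4 / (a * a)) by (apply Rdiv_lt_0_compat; lra). lra. }
assert (Ka := Kp alpha Ha). assert (Kb := Kp beta Hb).
exists (B1 * (1 + 4 / (beta * beta)) + B2 * (1 + 4 / (alpha * alpha))).
intros zeta Hz. assert (P := pow2_ge_0 (Re zeta)).
assert (Q1 : 0 <= B1 * (1 + 4 / (beta * beta))) by (apply Rmult_le_pos; lra).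
assert (Q2 : 0 <= B2 * (1 + 4 / (alpha * alpha))) by (apply Rmult_le_pos; lra).
destruct (Rle_lt_dec 0 (Re zeta)) as [H0|H0].
- eapply Rle_trans; [now apply H1|].
  apply Rle_trans with (B1 * ((1 + 4 / (beta * beta)) / (1 + Re zeta ^ 2))).
  + apply Rmult_le_compat_l; [lra|]. now apply key.
  + unfold Rdiv. rewrite <- Rmult_assoc. apply Rmult_le_compat_r; [|lra].
    left. apply Rinv_0_lt_compat. lra.
- eapply Rle_trans; [now apply H2|].
  apply Rle_trans with (B2 * ((1 + 4 / (alpha * alpha)) / (1 + Re zeta ^ 2))).
  + apply Rmult_le_compat_l; [lra|].
    replace (alpha * Re zeta) with (- alpha * (- Re zeta)) by ring.
    replace (Re zeta ^ 2) with ((- Re zeta) ^ 2) by ring. apply key; lra.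
  + unfold Rdiv. rewrite <- Rmult_assoc. apply Rmult_le_compat_r; [|lra].
    left. apply Rinv_0_lt_compat. lra.
Qed.

End Phi4.

(** * The inverse of phi4 near the real line *)

Definition sqrt_4_plus_sqr (z : C) : C := Cexp (/ 2 * Clog (4 + z * z)).
Definition p_of (z : C) : C := (/ 2 * (z + sqrt_4_plus_sqr z))%C.
Definition psi (z : C) : C := Clog (Cexp (p_of z) - 1).

Lemma four_plus_sqr_slit (z : C) : strip (3 / 8) z ->
  Im (4 + z * z) <> 0 \/ 0 < Re (4 + z * z).
Proof.
intros Hz. right. destruct z as [x y]. unfold strip, Re, Im in *; simpl in *.
apply Rabs_def2 in Hz. nra.
Qed.

Lemma sqrt_4_plus_sqr_spec (z : C) : strip (3 / 8) z ->
  (sqrt_4_plus_sqr z * sqrt_4_plus_sqr z = 4 + z * z)%C /\ 0 < Re (sqrt_4_plus_sqr z).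
Proof.
intros Hz. assert (Hs := four_plus_sqr_slit z Hz). unfold sqrt_4_plus_sqr. split.
- rewrite <- Cexp_plus. rewrite <- (Cexp_Clog (4 + z * z)) at 3 by now apply slit_neq_0.
  f_equal. field.
- apply Carg_slit in Hs. apply Rabs_def2 in Hs. unfold Cexp, Re at 1; simpl fst.
  apply Rmult_lt_0_compat; [apply exp_pos|].
  apply cos_gt_0; unfold Im, Clog; simpl; lra.
Qed.

(** With [s] the square root, [s^2 - z^2 = 4] makes [(s - z) / 2] the inverse of [p]. Then
    [p + 1/p = s] has positive real part, and [Re p] and [Re (1/p)] have the same sign. *)
Lemma p_of_spec (z : C) : strip (3 / 8) z ->
  p_of z <> 0%C /\ (p_of z - / p_of z = z)%C /\ 0 < Re (p_of z).
Proof.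
intros Hz. destruct (sqrt_4_plus_sqr_spec z Hz) as [H1 H2].
unfold p_of. set (s := sqrt_4_plus_sqr z) in *.
set (p := (/ 2 * (z + s))%C).
assert (E : (p * (/ 2 * (s - z)) = 1)%C).
{ unfold p. transitivity (/ 4 * (s * s - z * z))%C; [field|]. rewrite H1. field. }
assert (Hp : p <> 0%C).
{ intros E0. rewrite E0 in E. apply (f_equal fst) in E. simpl in E. lra. }
assert (Ei : (/ p = / 2 * (s - z))%C).
{ replace (/ 2 * (s - z))%C with (p * (/ 2 * (s - z)) / p)%C by now field. rewrite E. field. assumption. }
split; [assumption|split].
- rewrite Ei. unfold p. field.
- assert (Es : (p + / p = s)%C) by (rewrite Ei; unfold p; field).
  clearbody p s. destruct p as [a b], s as [s1 s2].
  assert (Hm : 0 < a ^ 2 + b ^ 2).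
  { change (0 < Re (a, b) ^ 2 + Im (a, b) ^ 2). rewrite <- Cmod2_alt. apply pow_lt. now apply Cmod_gt_0. }
  apply (f_equal fst) in Es. unfold Re in *. cbn [fst snd Cplus Cinv] in Es, H2 |- *.
  apply Rnot_le_lt. intros Hneg.
  assert (a / (a ^ 2 + b ^ 2) <= 0).
  { apply Rmult_le_reg_r with (a ^ 2 + b ^ 2); trivial. unfold Rdiv.
    rewrite Rmult_assoc, Rinv_l by lra. lra. }
  lra.
Qed.

Lemma Im_minus_inv (p : C) : Im (p - / p) = Im p + Im p / (Re p ^ 2 + Im p ^ 2).
Proof. destruct p as [a b]. unfold Re, Im. cbn [fst snd Cminus Cplus Copp Cinv]. unfold Rdiv. ring. Qed.

(** Taking imaginary parts in [p - 1/p = z] gives [|b| = |Im z| v / (1 + v)] with [v = |p|^2]. The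
    first bound replaces [v / (1 + v)] by a multiple of [a / (1 + a)]: it makes [b] as small as [a]
    where [p] is near 0. *)
Lemma p_of_Im (z : C) : strip (3 / 8) z ->
  let a := Re (p_of z) in let b := Im (p_of z) in
  Rabs b * (1 + a) <= 8 / 3 * Rabs (Im z) * a /\ Rabs b <= Rabs (Im z).
Proof.
intros Hz a b. destruct (p_of_spec z Hz) as [H1 [H2 H3]]. fold a in H3.
set (v := a ^ 2 + b ^ 2). assert (Hb2 := pow2_ge_0 b).
assert (Ha2 : 0 < a ^ 2) by now apply pow_lt.
assert (Hv : 0 < v) by (unfold v; lra).
assert (Ey : Im z * v = b * (1 + v)).
{ rewrite <- H2 at 1. rewrite Im_minus_inv. fold a b v. field. lra. }
assert (Eabs : Rabs (Im z) * v = Rabs b * (1 + v)).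
{ rewrite <- (Rabs_pos_eq v) at 1 by lra. rewrite <- (Rabs_pos_eq (1 + v)) by lra.
  now rewrite <- !Rabs_mult, Ey. }
unfold strip in Hz. set (Y := Rabs (Im z)) in *. assert (HY : 0 <= Y) by apply Rabs_pos.
assert (EB : b ^ 2 = Rabs b ^ 2) by (symmetry; apply pow2_abs).
set (B := Rabs b) in *. assert (HB : 0 <= B) by apply Rabs_pos.
(* From [4 v <= (1 + v)^2] and [|Im z| <= 1/2] one gets [b^2 <= v / 16], so [p] lies in a narrow
   sector and [v] is comparable to [a^2]. *)
assert (Hb3 : b ^ 2 <= a ^ 2 / 3).
{ assert (B1 : B ^ 2 * (1 + v) ^ 2 = Y ^ 2 * v ^ 2) by (rewrite <- !Rpow_mult_distr; now rewrite Eabs).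
  assert (B2 : Y ^ 2 <= 1 / 4) by nra.
  assert (B3 : v ^ 2 * 4 <= v * (1 + v) ^ 2) by (assert (0 <= v * (1 - v) ^ 2) by (apply Rmult_le_pos; [lra|apply pow2_ge_0]); nra).
  assert (B4 : B ^ 2 * (1 + v) ^ 2 <= v / 16 * (1 + v) ^ 2).
  { rewrite B1. apply Rle_trans with (1 / 4 * v ^ 2); [apply Rmult_le_compat_r; [apply pow2_ge_0|lra]|lra]. }
  assert (B5 : B ^ 2 <= v / 16).
  { apply Rmult_le_reg_r with ((1 + v) ^ 2); trivial. apply pow_lt. lra. }
  rewrite <- EB in B5. unfold v in B5. lra. }
split.
- assert (Hva : 3 * (v * (1 + a)) <= 8 * a * (1 + v)).
  { assert (Hv1 : v <= 4 / 3 * a ^ 2) by (unfold v; lra).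
    (* For [a >= 3/5], [3 v <= 5 a v] is enough; for smaller [a], [v <= 4/3 a^2] is. *)
    destruct (Rle_lt_dec (3 / 5) a); [nra|]. nra. }
  apply Rmult_le_reg_r with (1 + v); [lra|].
  replace (B * (1 + a) * (1 + v)) with (Y * v * (1 + a)) by (rewrite Eabs; ring).
  replace (Y * v * (1 + a)) with (Y * (v * (1 + a))) by ring.
  replace (8 / 3 * Y * a * (1 + v)) with (Y * (8 * a * (1 + v) / 3)) by field.
  apply Rmult_le_compat_l; lra.
- apply Rmult_le_reg_r with (1 + v); [lra|]. rewrite <- Eabs. nra.
Qed.

(** Both parts are compared with [e * tau], [e = exp a], [tau = a / (1 + a)]: the real part is at
    least [e tau / 2], the imaginary part at most [8/3 |Im z| e tau]. Since [8/3 <= 3], the ratio is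
    at most [6 |Im z|]. *)
Lemma Cexp_p_minus_1 (z : C) : strip (3 / 8) z ->
  0 < Re (Cexp (p_of z) - 1) /\
  Rabs (Im (Cexp (p_of z) - 1)) <= 6 * Rabs (Im z) * Re (Cexp (p_of z) - 1).
Proof.
intros Hz. destruct (p_of_spec z Hz) as [_ [_ Ha]]. destruct (p_of_Im z Hz) as [H1 H2].
unfold strip in Hz. set (Y := Rabs (Im z)) in *. assert (HY : 0 <= Y) by apply Rabs_pos.
replace (Re (Cexp (p_of z) - 1)) with (exp (Re (p_of z)) * cos (Im (p_of z)) - 1)
  by (unfold Cexp, Re; simpl; ring).
replace (Im (Cexp (p_of z) - 1)) with (exp (Re (p_of z)) * sin (Im (p_of z)))
  by (unfold Cexp, Im; simpl; ring).
set (a := Re (p_of z)) in *. set (b := Im (p_of z)) in *.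
set (tau := a / (1 + a)).
assert (Ht : tau * (1 + a) = a) by (unfold tau; field; lra).
assert (Ht0 : 0 < tau) by (apply Rdiv_lt_0_compat; lra).
assert (Ht1 : tau < 1) by nra.
assert (Hb : Rabs b <= 8 / 3 * Y * tau).
{ apply Rmult_le_reg_r with (1 + a); [lra|]. rewrite Rmult_assoc, Ht. exact H1. }
assert (Hb2 : b ^ 2 <= tau).
(* The width [3/8] of the strip cancels the constant [8/3], so [|b| <= tau < 1]; then
   [cos b >= 1 - tau / 2]. *)
{ rewrite <- pow2_abs. assert (B1 : Rabs b <= tau) by nra. assert (B0 := Rabs_pos b). nra. }
assert (Hcos := one_minus_cos_bounds b). assert (He := exp_ineq1_le a).
assert (Hp := exp_pos a). set (e := exp a) in *.
assert (E1 : 1 <= e * (1 - tau)).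
{ apply Rmult_le_reg_r with (1 + a); [lra|]. rewrite Rmult_assoc, Rmult_minus_distr_r, Ht. lra. }
assert (E2 : e * (tau / 2) <= e * cos b - 1).
{ assert (e * (1 - tau / 2) <= e * cos b) by (apply Rmult_le_compat_l; lra). lra. }
assert (E3 : 0 < e * (tau / 2)) by (apply Rmult_lt_0_compat; lra).
split; [lra|]. rewrite Rabs_mult, (Rabs_pos_eq e) by lra.
assert (Hs := Rabs_sin_le b).
apply Rle_trans with (e * (8 / 3 * Y * tau)); [apply Rmult_le_compat_l; lra|].
apply Rle_trans with (6 * Y * (e * (tau / 2))).
- replace (6 * Y * (e * (tau / 2))) with (e * (3 * Y * tau)) by field.
  apply Rmult_le_compat_l; [lra|]. apply Rmult_le_compat_r; lra.
- apply Rmult_le_compat_l; lra.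
Qed.

Lemma psi_Im (z : C) : strip (3 / 8) z -> Rabs (Im (psi z)) <= 6 * Rabs (Im z).
Proof.
intros Hz. destruct (Cexp_p_minus_1 z Hz) as [H1 H2].
unfold psi. change (Rabs (Carg (Cexp (p_of z) - 1)) <= 6 * Rabs (Im z)).
eapply Rle_trans; [now apply Carg_le_ratio|].
apply Rmult_le_reg_r with (Re (Cexp (p_of z) - 1)); trivial.
unfold Rdiv. rewrite Rmult_assoc, Rinv_l by lra. lra.
Qed.

Lemma phi4_psi (z : C) : strip (3 / 8) z -> phi4 (psi z) = z.
Proof.
intros Hz. destruct (p_of_spec z Hz) as [H1 [H2 _]]. destruct (p_of_Im z Hz) as [_ H4].
destruct (Cexp_p_minus_1 z Hz) as [H5 _].
assert (E : Clog (1 + Cexp (psi z)) = p_of z).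
{ unfold psi. rewrite Cexp_Clog by now apply Re_pos_neq_0.
  replace (1 + (Cexp (p_of z) - 1))%C with (Cexp (p_of z)) by ring.
  apply Clog_Cexp. unfold strip in Hz. assert (H := PI2_3_2). unfold PI2 in H. lra. }
rewrite phi4_alt; rewrite E; trivial.
Qed.

(** The bound on [Im psi] makes [psi] real on the real line. There it is a preimage of [t] under
    [phi4], and real preimages are unique. *)
Lemma psi_RtoC (t : R) : psi (RtoC t) = RtoC (phi4_inv t).
Proof.
assert (Ht : strip (3 / 8) (RtoC t)) by (apply strip_RtoC; lra).
assert (HI : Rabs (Im (psi (RtoC t))) <= 0).
{ eapply Rle_trans; [now apply psi_Im|]. change (Im (RtoC t)) with 0. rewrite Rabs_R0. lra. }
assert (E : psi (RtoC t) = RtoC (Re (psi (RtoC t)))).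
{ assert (H0 : Im (psi (RtoC t)) = 0).
  { apply Rabs_le_between in HI. lra. }
  unfold RtoC at 2. rewrite <- H0. apply surjective_pairing. }
rewrite E. f_equal. symmetry. apply phi4_inv_l. rewrite <- E. now apply phi4_psi.
Qed.

Lemma holo_psi : holo_strip (3 / 8) psi.
Proof.
intros z Hz. destruct (Cexp_p_minus_1 z Hz) as [H1 _].
apply (ex_Cder_comp Clog (fun z => Cexp (p_of z) - 1)%C).
{ apply ex_Cder_Clog. now right. }
apply ex_Cder_minus; [|apply ex_Cder_const].
apply (ex_Cder_comp Cexp p_of); [apply ex_Cder_Cexp|].
apply (ex_Cder_mult (fun _ => (/ 2)%C)); [apply ex_Cder_const|].
apply ex_Cder_plus; [apply ex_Cder_id|].
apply (ex_Cder_comp Cexp (fun z => / 2 * Clog (4 + z * z))%C); [apply ex_Cder_Cexp|].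
apply (ex_Cder_mult (fun _ => (/ 2)%C)); [apply ex_Cder_const|].
apply (ex_Cder_comp Clog (fun z => 4 + z * z)%C).
{ now apply ex_Cder_Clog, four_plus_sqr_slit. }
apply ex_Cder_plus; [apply ex_Cder_const|].
apply (ex_Cder_mult (fun z => z) (fun z => z)); apply ex_Cder_id.
Qed.

(** * The truncated sinc series *)

Lemma Csum_Z_Csum (G : Z -> C) (a b : Z) :
  Csum_Z G a b = Csum (fun j => G (a + Z.of_nat j - 1)%Z) (Z.to_nat (b - a + 1)).
Proof. reflexivity. Qed.

Lemma Csum_add (F : nat -> C) (p q : nat) :
  Csum F (p + q) = (Csum F p + Csum (fun j => F (p + j)%nat) q)%C.
Proof.
induction q as [|q IH].
- rewrite Nat.add_0_r, Csum_0. symmetry. apply Cplus_0_r.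
- rewrite Nat.add_succ_r, !Csum_S, IH, Nat.add_succ_r. symmetry. apply Cplus_assoc.
Qed.

Lemma Csum_Z_split (G : Z -> C) (a b c : Z) : (a <= b + 1)%Z -> (b <= c)%Z ->
  Csum_Z G a c = (Csum_Z G a b + Csum_Z G (b + 1) c)%C.
Proof.
intros H1 H2. rewrite !Csum_Z_Csum.
replace (Z.to_nat (c - a + 1)) with (Z.to_nat (b - a + 1) + Z.to_nat (c - (b + 1) + 1))%nat by lia.
rewrite Csum_add. f_equal. apply Csum_ext. intros j Hj. f_equal. lia.
Qed.

Lemma exp_minus_1_ge (s : R) : s <= exp s - 1.
Proof. assert (H := exp_ineq1_le s). lra. Qed.

(** The induction runs with the exact denominator [exp s - 1], relaxed to [s] only at the start.
    With [s = alpha h] this is where the truncation loses [1 / h]. *)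
Lemma Csum_geometric_up (F : nat -> C) (A s : R) (p : nat) : 0 < s -> 0 <= A ->
  (forall j, (1 <= j <= p)%nat -> Cmod (F j) <= A * exp (s * INR j)) ->
  Cmod (Csum F p) <= A * exp (s * (INR p + 1)) / s.
Proof.
intros Hs HA H. assert (HD := exp_minus_1_ge s). set (D := exp s - 1) in *.
apply Rle_trans with (A * exp (s * (INR p + 1)) / D).
2: { unfold Rdiv. apply Rmult_le_compat_l; [apply Rmult_le_pos; [assumption|left; apply exp_pos]|].
  apply Rinv_le_contravar; lra. }
induction p as [|p IH].
- rewrite Csum_0, Cmod_0. apply Rdiv_le_0_compat; [|lra].
  apply Rmult_le_pos; [assumption|left; apply exp_pos].
- rewrite Csum_S. eapply Rle_trans; [apply Cmod_triangle|].
  eapply Rle_trans; [apply Rplus_le_compat; [apply IH|apply H]|].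
  + intros j Hj. apply H. lia.
  + lia.
  + rewrite S_INR. right.
    replace (exp (s * (INR p + 1 + 1))) with (exp (s * (INR p + 1)) * (D + 1)).
    * field. lra.
    * unfold D. replace (exp s - 1 + 1) with (exp s) by ring. rewrite <- exp_plus. f_equal. ring.
Qed.

Lemma Csum_geometric_down (F : nat -> C) (A s : R) (p : nat) : 0 < s -> 0 <= A ->
  (forall j, (1 <= j <= p)%nat -> Cmod (F j) <= A * exp (- s * INR j)) ->
  Cmod (Csum F p) <= A / s.
Proof.
intros Hs HA H. assert (HD := exp_minus_1_ge s). set (D := exp s - 1) in *.
apply Rle_trans with (A * (1 - exp (- s * INR p)) / D).
2: { assert (P := exp_pos (- s * INR p)). unfold Rdiv. apply Rmult_le_compat.
  - apply Rmult_le_pos; [assumption|].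
    assert (Hp : - s * INR p <= 0) by (assert (I := pos_INR p); nra).
    assert (exp (- s * INR p) <= 1).
    { rewrite <- exp_0. destruct Hp as [Hp| ->]; [left; now apply exp_increasing|lra]. }
    lra.
  - left. apply Rinv_0_lt_compat. lra.
  - nra.
  - apply Rinv_le_contravar; lra. }
induction p as [|p IH].
- rewrite Csum_0, Cmod_0. simpl. rewrite Rmult_0_r, exp_0. right. unfold Rdiv. ring.
- rewrite Csum_S. eapply Rle_trans; [apply Cmod_triangle|].
  eapply Rle_trans; [apply Rplus_le_compat; [apply IH|apply H]|].
  + intros j Hj. apply H. lia.
  + lia.
  + rewrite S_INR. right.
    replace (exp (- s * INR p)) with (exp (- s * (INR p + 1)) * (D + 1)).
    * field. lra.
    * unfold D. replace (exp s - 1 + 1) with (exp s) by ring. rewrite <- exp_plus. f_equal. ring.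
Qed.

Lemma cosh_le (u v : R) : Rabs u <= v -> cosh u <= cosh v.
Proof.
intros H. rewrite <- cosh_Rabs. assert (Hu := Rabs_pos u).
assert (E : exp (Rabs u) * exp (- Rabs u) = 1) by (rewrite <- exp_plus, Rplus_opp_r; apply exp_0).
assert (E' : exp v * exp (- v) = 1) by (rewrite <- exp_plus, Rplus_opp_r; apply exp_0).
destruct H as [H| ->]; [|lra].
assert (H1 := exp_increasing _ _ H).
assert (H2 : 1 <= exp (Rabs u)) by (assert (I := exp_ineq1_le (Rabs u)); lra).
unfold cosh. set (p := exp (Rabs u)) in *. set (q := exp v) in *.
assert (Ep : exp (- Rabs u) = / p) by (unfold p; apply exp_Ropp).
assert (Eq : exp (- v) = / q) by (unfold q; apply exp_Ropp).
rewrite Ep, Eq. 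
assert (Hq : 0 <= (q - p) * (1 - / p * / q)).
{ apply Rmult_le_pos; [lra|].
  assert (/ p <= 1) by (rewrite <- Rinv_1; apply Rinv_le_contravar; lra).
  assert (/ q <= 1) by (rewrite <- Rinv_1; apply Rinv_le_contravar; lra).
  assert (0 < / p) by (apply Rinv_0_lt_compat; lra). assert (0 < / q) by (apply Rinv_0_lt_compat; lra).
  nra. }
assert (Eqq : (q - p) * (1 - / p * / q) = (q + / q) - (p + / p)) by (field; lra).
lra.
Qed.

(** [C5] precedes [h], [M], [N] and [x], whereas the contour may depend on all of them. The error
    splits into the remainder over a large symmetric window [- L .. L] and the two tails outside
    [- M .. N]. *)
Lemma strip_error_bound (F : C -> C) (d alpha beta B1 B2 CF hmax : R) :
  0 < d -> 0 < alpha -> 0 < beta -> 0 < hmax -> 0 < B1 -> 0 < B2 ->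
  holo_strip d F ->
  (forall w, strip d w -> 0 <= Re w -> Cmod (F w) <= B1 * exp (- beta * Re w)) ->
  (forall w, strip d w -> Re w < 0 -> Cmod (F w) <= B2 * exp (alpha * Re w)) ->
  (forall w, strip d w -> Cmod (F w) <= CF / (1 + Re w ^ 2)) ->
  exists C5, forall (h : R) (M N : Z) (x : C), 0 < h <= hmax -> (0 <= M)%Z -> (0 <= N)%Z ->
    PI * d / h <= alpha * IZR M * h -> PI * d / h <= beta * IZR N * h ->
    Rabs (Im x) <= h -> Rabs (Im x) <= d / 2 ->
    Cmod (F x - Csum_Z (fun k => F (RtoC (IZR k * h)) * SincZ k h x)%C (- M) N)
      <= C5 / h * exp (- (PI * d / h)).
Proof.
intros Hd Ha Hb Hmax HB1 HB2 HF H1 H2 HCF. assert (Hpi := PI_RGT_0).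
assert (HCF0 : 0 <= CF).
{ assert (H := HCF 0%C (strip_RtoC d 0 Hd)). assert (H0 := Cmod_ge_0 (F 0)).
  change (Re 0) with 0 in H. replace (CF / (1 + 0 ^ 2)) with CF in H by field. lra. }
(* On [|Im x| <= h] this bounds [sin (PI x / h)], and [2 T] bounds every sinc. *)
set (T := cosh PI). assert (HT : 1 <= T) by apply cosh_pos.
assert (ET : T = cosh PI) by reflexivity. clearbody T.
(* A lower bound of [PI d' / h] for all [h <= hmax], so that [sinh u >= c0 * exp u] with [c0]
   independent of [h]. *)
set (u0 := PI * (3 * d / 4) / hmax).
assert (Hu0 : 0 < u0) by (apply Rdiv_lt_0_compat; [apply Rmult_lt_0_compat; lra|lra]).
set (c0 := (1 - exp (- 2 * u0)) / 2).
assert (Hc0 : 0 < c0).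
{ unfold c0. assert (exp (- 2 * u0) < 1) by (rewrite <- exp_0; apply exp_increasing; lra). lra. }
(* [exp 1] pays for the shifted lines, [1 / c0] for [sinh], and [4 / d] for the distance
   [d' - |Im x| >= d / 4]. *)
set (C4 := exp 1 / c0 * (4 / d)).
exists (T * (2 * CF * C4 + 1) * hmax + 2 * T * B1 / beta + 2 * T * B2 / alpha).
intros h M N x Hh HM HN HMX HNX Hx1 Hx2.
set (X := PI * d / h) in *. assert (HeX := exp_pos (- X)).
assert (HX : exp X * exp (- X) = 1) by (rewrite <- exp_plus, Rplus_opp_r; apply exp_0).
(* [h / PI] keeps [PI d' / h >= PI d / h - 1]; [d / 4] keeps the lines away from
   [|Im x| <= d / 2]. *)
set (d' := d - Rmin (d / 4) (h / PI)).
assert (Hhpi : 0 < h / PI) by (apply Rdiv_lt_0_compat; lra).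
assert (Hd'1 : 0 < Rmin (d / 4) (h / PI)) by (apply Rmin_pos; lra).
assert (Hd'2 := Rmin_l (d / 4) (h / PI)). assert (Hd'3 := Rmin_r (d / 4) (h / PI)).
assert (Hd' : 0 < d' < d) by (unfold d'; lra).
assert (Hd'4 : d - d' <= h / PI) by (unfold d'; lra).
assert (Hd'5 : 3 * d / 4 <= d') by (unfold d'; lra).
assert (Hih : 0 < / h) by (apply Rinv_0_lt_compat; lra).
assert (Hcosh : cosh (PI / h * Im x) <= T).
{ rewrite ET. apply cosh_le. rewrite Rabs_mult, Rabs_pos_eq by (left; apply Rdiv_lt_0_compat; lra).
  apply Rle_trans with (PI / h * h); [|right; field; lra].
  apply Rmult_le_compat_l; trivial. left; apply Rdiv_lt_0_compat; lra. }
assert (Hcosh1 := cosh_pos (PI / h * Im x)).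
assert (Hsinh : c0 * exp (X - 1) <= sinh (PI / h * d')).
{ set (u := PI / h * d').
  assert (Hu1 : u0 <= u).
  { unfold u0, u, Rdiv. replace (PI * / h * d') with (PI * d' * / h) by ring.
    apply Rmult_le_compat.
    - apply Rmult_le_pos; lra.
    - left. apply Rinv_0_lt_compat. lra.
    - apply Rmult_le_compat_l; lra.
    - apply Rinv_le_contravar; lra. }
  assert (Hu2 : X - 1 <= u).
  { unfold X, u. replace (PI * d / h - 1) with (PI / h * (d - h / PI)) by (field; lra).
    apply Rmult_le_compat_l; [left; apply Rdiv_lt_0_compat; lra|lra]. }
  assert (E1 : exp (X - 1) <= exp u) by (destruct Hu2 as [Hu2| ->]; [left; now apply exp_increasing|lra]).
  assert (E2 : exp (- 2 * u) <= exp (- 2 * u0)).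
  { destruct Hu1 as [Hu1| ->]; [left; apply exp_increasing; lra|lra]. }
  unfold sinh. replace (exp (- u)) with (exp u * exp (- 2 * u)) by (rewrite <- exp_plus; f_equal; ring).
  replace ((exp u - exp u * exp (- 2 * u)) / 2) with ((1 - exp (- 2 * u)) / 2 * exp u) by field.
  apply Rmult_le_compat; try lra; [left; apply exp_pos|]. unfold c0. lra. }
assert (HeX1 : 0 < exp (X - 1)) by apply exp_pos.
(* With [A >= V], the vertical sides are at distance at least 1 from [x] and contribute at most
   [exp (- X)]. *)
set (V := Rmax (Rabs (Re x) + 1) (2 * d * CF * exp X + 1)).
assert (HV1 : Rabs (Re x) + 1 <= V) by apply Rmax_l.
assert (HV2 : 2 * d * CF * exp X + 1 <= V) by apply Rmax_r.
destruct (archimed_cor1 (h / (V + 1))) as [L0 [HL0 HL0']].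
{ apply Rdiv_lt_0_compat; [lra|]. assert (P := Rabs_pos (Re x)). lra. }
assert (HVp : 0 < V) by (assert (P := Rabs_pos (Re x)); lra).
set (L := (L0 + Z.to_nat M + Z.to_nat N)%nat).
set (A := (INR L + / 2) * h).
assert (HA : V <= A).
{ assert (I0 : 0 < INR L0) by (apply lt_0_INR; lia).
  assert (V + 1 <= INR L0 * h).
  { apply Rmult_lt_compat_l with (r := INR L0 * (V + 1)) in HL0; [|apply Rmult_lt_0_compat; lra].
    replace (INR L0 * (V + 1) * / INR L0) with (V + 1) in HL0 by (field; lra).
    replace (INR L0 * (V + 1) * (h / (V + 1))) with (INR L0 * h) in HL0 by (field; lra). lra. }
  assert (INR L0 <= INR L) by (apply le_INR; unfold L; lia).
  assert (INR L0 * h <= INR L * h) by (apply Rmult_le_compat_r; lra).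
  unfold A. lra. }
set (G := fun k => (F (RtoC (IZR k * h)) * SincZ k h x)%C).
assert (HG : forall k, Cmod (G k) <= Cmod (F (RtoC (IZR k * h))) * (2 * T)).
{ intros k. unfold G. rewrite Cmod_mult. apply Rmult_le_compat_l; [apply Cmod_ge_0|].
  eapply Rle_trans; [apply Cmod_SincZ_le|]. lra. }
assert (Hrem : Cmod (sinc_remainder F h L x) <= T * (2 * CF * C4 + 1) * exp (- X)).
(* The contour bound excludes zeros of the sine; these are nodes, where the remainder is 0. *)
{ destruct (classic (Csin (RtoC (PI / h) * x) = 0%C)) as [e|e].
  - destruct (Sn_zero h (proj1 Hh) x e) as [k Hk].
    destruct (node_in_rect h L (proj1 Hh) k) as [j [Hj Ej]].
    { replace (IZR k * h) with (Re x) by (rewrite Hk; reflexivity). fold A.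
      assert (P := proj1 (Rabs_le_between (Re x) (A - 1)) ltac:(lra)). lra. }
    rewrite Hk, <- Ej.
    rewrite (sinc_remainder_node F h L (proj1 Hh) j Hj), Cmod_0.
    assert (0 < C4).
    { apply Rmult_lt_0_compat; apply Rdiv_lt_0_compat; try lra. apply exp_pos. }
    apply Rmult_le_pos; [|lra]. apply Rmult_le_pos; [lra|].
    assert (0 <= CF * C4) by (apply Rmult_le_pos; lra). lra.
  - eapply Rle_trans.
    + apply (contour_bound F d h d' L HF (proj1 Hh) Hd' CF HCF x); trivial; fold A; lra.
    + fold A. rewrite (Rmult_assoc T). set (sh := sinh (PI / h * d')) in *.
      assert (Q0 : 0 < sh * (d' - Rabs (Im x))).
      { apply Rmult_lt_0_compat; [|lra]. assert (0 < c0 * exp (X - 1)) by (apply Rmult_lt_0_compat; lra). lra. }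
      assert (Q1 : 2 * CF / (sh * (d' - Rabs (Im x))) <= 2 * CF * C4 * exp (- X)).
      { unfold Rdiv. rewrite (Rmult_assoc (2 * CF)). apply Rmult_le_compat_l; [lra|].
        apply Rle_trans with (/ ((c0 * exp (X - 1)) * (d / 4))).
        - apply Rinv_le_contravar.
          + apply Rmult_lt_0_compat; [now apply Rmult_lt_0_compat|lra].
          + apply Rmult_le_compat; try lra. left. apply Rmult_lt_0_compat; lra.
        - right. unfold C4, Rminus. rewrite exp_plus, !exp_Ropp.
          assert (0 < exp 1) by apply exp_pos. assert (0 < exp X) by apply exp_pos.
          field. repeat split; lra. }
      assert (Q2 : 2 * d' * CF / (1 + A ^ 2) <= exp (- X)).
      { assert (P : 0 < exp X) by apply exp_pos.
        assert (0 <= d * CF * exp X) by (repeat apply Rmult_le_pos; lra).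
        assert (HA2 : 2 * d * CF * exp X <= 1 + A ^ 2) by nra.
        assert (HA3 := pow2_ge_0 A).
        apply Rmult_le_reg_r with (1 + A ^ 2); [lra|].
        unfold Rdiv. rewrite Rmult_assoc, Rinv_l, Rmult_1_r by lra.
        apply Rle_trans with (2 * d * CF).
        - apply Rmult_le_compat_r; lra.
        - replace (2 * d * CF) with (exp (- X) * (2 * d * CF * exp X)).
          + apply Rmult_le_compat_l; lra.
          + replace (exp (- X) * (2 * d * CF * exp X)) with (2 * d * CF * (exp X * exp (- X))) by ring.
            rewrite HX. ring. }
      apply Rmult_le_compat; [lra| |exact Hcosh|].
      * apply Rplus_le_le_0_compat; [apply Rdiv_le_0_compat; lra|].
        apply Rdiv_le_0_compat; [repeat apply Rmult_le_pos; lra|]. assert (P := pow2_ge_0 A). lra.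
      * rewrite Rmult_plus_distr_r, Rmult_1_l. now apply Rplus_le_compat. }
assert (Esum : sinc_remainder F h L x = (F x - Csum_Z G (- Z.of_nat L) (Z.of_nat L))%C).
{ unfold sinc_remainder. f_equal. f_equal. rewrite Csum_Z_Csum.
  replace (Z.to_nat (Z.of_nat L - - Z.of_nat L + 1)) with (2 * L + 1)%nat by lia. reflexivity. }
rewrite (Csum_Z_split G _ (- M - 1)) in Esum by (unfold L; lia).
rewrite (Csum_Z_split G (- M - 1 + 1) N) in Esum by (unfold L; lia).
replace (- M - 1 + 1)%Z with (- M)%Z in Esum by lia.
assert (Hleft : Cmod (Csum_Z G (- Z.of_nat L) (- M - 1)) <= 2 * T * B2 / alpha / h * exp (- X)).
{ rewrite Csum_Z_Csum. set (p := Z.to_nat _).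
  assert (Hah : 0 < alpha * h) by (apply Rmult_lt_0_compat; lra).
  eapply Rle_trans.
  - apply (Csum_geometric_up _ (2 * T * B2 * exp (alpha * h * (- INR L - 1))) (alpha * h) p Hah).
    + repeat apply Rmult_le_pos; try lra. left; apply exp_pos.
    + intros j Hj. eapply Rle_trans; [apply HG|].
      set (k := (- Z.of_nat L + Z.of_nat j - 1)%Z).
      assert (Hk : (k < 0)%Z) by (unfold k, p in *; lia). apply IZR_lt in Hk.
      assert (Hkh : IZR k * h < 0) by nra.
      assert (D := H2 (RtoC (IZR k * h)) (strip_RtoC d _ Hd) Hkh).
      change (Re (RtoC (IZR k * h))) with (IZR k * h) in D.
      apply Rle_trans with (B2 * exp (alpha * (IZR k * h)) * (2 * T)).
      * apply Rmult_le_compat_r; lra.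
      * right. rewrite (Rmult_assoc (2 * T * B2)), <- exp_plus.
        replace (alpha * h * (- INR L - 1) + alpha * h * INR j) with (alpha * (IZR k * h)); [ring|].
        unfold k. rewrite minus_IZR, plus_IZR, opp_IZR, <- !INR_IZR_INZ. ring.
  - rewrite (Rmult_assoc (2 * T * B2)), <- exp_plus.
    (* The left tail has [p = L - M] terms. *)
    assert (Ep : alpha * h * (- INR L - 1) + alpha * h * (INR p + 1) = - (alpha * IZR M * h)).
    { unfold p. rewrite (INR_IZR_INZ (Z.to_nat _)), Z2Nat.id by (unfold L; lia).
      rewrite plus_IZR, !minus_IZR, !opp_IZR, <- INR_IZR_INZ. ring. }
    rewrite Ep.
    assert (Ee : exp (- (alpha * IZR M * h)) <= exp (- X)).
    { destruct HMX as [HMX| ->]; [left; apply exp_increasing; lra|lra]. }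
    replace (2 * T * B2 / alpha / h * exp (- X)) with (2 * T * B2 * exp (- X) / (alpha * h)) by (field; lra).
    apply Rmult_le_compat_r; [left; now apply Rinv_0_lt_compat|].
    apply Rmult_le_compat_l; trivial. repeat apply Rmult_le_pos; lra. }
assert (Hright : Cmod (Csum_Z G (N + 1) (Z.of_nat L)) <= 2 * T * B1 / beta / h * exp (- X)).
{ rewrite Csum_Z_Csum. set (p := Z.to_nat _).
  assert (Hbh : 0 < beta * h) by (apply Rmult_lt_0_compat; lra).
  eapply Rle_trans.
  - apply (Csum_geometric_down _ (2 * T * B1 * exp (- (beta * IZR N * h))) (beta * h) p Hbh).
    + repeat apply Rmult_le_pos; try lra. left; apply exp_pos.
    + intros j Hj. eapply Rle_trans; [apply HG|].
      set (k := (N + 1 + Z.of_nat j - 1)%Z).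
      assert (Hk : (0 <= k)%Z) by (unfold k, p in *; lia). apply IZR_le in Hk.
      assert (Hkh : 0 <= IZR k * h) by (apply Rmult_le_pos; lra).
      assert (D := H1 (RtoC (IZR k * h)) (strip_RtoC d _ Hd) Hkh).
      change (Re (RtoC (IZR k * h))) with (IZR k * h) in D.
      apply Rle_trans with (B1 * exp (- beta * (IZR k * h)) * (2 * T)).
      * apply Rmult_le_compat_r; lra.
      * right. rewrite (Rmult_assoc (2 * T * B1)), <- exp_plus.
        replace (- (beta * IZR N * h) + - (beta * h) * INR j) with (- beta * (IZR k * h)); [ring|].
        unfold k. rewrite minus_IZR, !plus_IZR, <- !INR_IZR_INZ. ring.
  - assert (Ee : exp (- (beta * IZR N * h)) <= exp (- X)).
    { destruct HNX as [HNX| ->]; [left; apply exp_increasing; lra|lra]. }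
    replace (2 * T * B1 / beta / h * exp (- X)) with (2 * T * B1 * exp (- X) / (beta * h)) by (field; lra).
    apply Rmult_le_compat_r; [left; now apply Rinv_0_lt_compat|].
    apply Rmult_le_compat_l; trivial. repeat apply Rmult_le_pos; lra. }
assert (Efin : (F x - Csum_Z G (- M) N)%C = (sinc_remainder F h L x +
   (Csum_Z G (- Z.of_nat L) (- M - 1) + Csum_Z G (N + 1) (Z.of_nat L)))%C).
{ rewrite Esum. generalize (Csum_Z G (- Z.of_nat L) (- M - 1)) (Csum_Z G (- M) N)
    (Csum_Z G (N + 1) (Z.of_nat L)) (F x). intros; ring. }
rewrite Efin.
eapply Rle_trans; [apply Cmod_triangle|].
eapply Rle_trans; [apply Rplus_le_compat_l, Cmod_triangle|].
(* The remainder carries no [1 / h]; the factor [hmax / h >= 1] brings it to the form of the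
   tails. *)
assert (Hfirst : T * (2 * CF * C4 + 1) * exp (- X) <= T * (2 * CF * C4 + 1) * hmax / h * exp (- X)).
{ apply Rmult_le_compat_r; [lra|].
  assert (0 < C4) by (apply Rmult_lt_0_compat; apply Rdiv_lt_0_compat; try lra; apply exp_pos).
  assert (0 <= CF * C4) by (apply Rmult_le_pos; lra).
  assert (Hp : 0 <= T * (2 * CF * C4 + 1)) by (apply Rmult_le_pos; lra).
  set (W := T * (2 * CF * C4 + 1)) in *.
  apply Rle_trans with (W * (hmax / h)); [|right; unfold Rdiv; ring].
  rewrite <- (Rmult_1_r W) at 1. apply Rmult_le_compat_l; trivial.
  apply Rmult_le_reg_r with h; [lra|]. unfold Rdiv. rewrite Rmult_assoc, Rinv_l; lra. }
eapply Rle_trans; [apply Rplus_le_compat; [eapply Rle_trans; [exact Hrem|exact Hfirst]|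
  apply Rplus_le_compat; [exact Hleft|exact Hright]]|].
right. unfold Rdiv. ring.
Qed.

(** * From the strip bound to derivatives on the real line *)

Lemma strip_le (r rho : R) (z : C) : r <= rho -> strip r z -> strip rho z.
Proof. unfold strip. lra. Qed.

(** The expression of the theorem is thus a single complex derivative of the error function, to
    which Cauchy's estimate applies. *)
Lemma C_derive_n_sinc_error (rho h : R) (a b : Z) (f : C -> C) (co : Z -> C) (m : nat) (t : R) :
  0 < rho <= 3 / 8 -> 0 < h -> holo_strip rho f ->
  C_derive_n (fun z => f z - Csum_Z (fun k => co k * SincZ k h (psi z)) a b)%C m (RtoC t) =
  (C_derive_n f m (RtoC t)
   - Csum_Z (fun k => co k * RtoC (Derive_n (fun s => Sinc k h (phi4_inv s)) m t)) a b)%C.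
Proof.
intros Hrho Hh Hf.
assert (Hpsi : holo_strip rho psi).
{ intros z Hz. apply holo_psi. revert Hz. apply strip_le. lra. }
assert (Hs : forall k, holo_strip rho (fun z => SincZ k h (psi z))).
{ intros k z Hz. apply (ex_Cder_comp (SincZ k h) psi); [apply ex_Cder_SincZ|now apply Hpsi]. }
assert (Ht : strip rho (RtoC t)) by (apply strip_RtoC; lra).
set (G := fun (j : nat) (z : C) =>
  (co (a + Z.of_nat j - 1)%Z * SincZ (a + Z.of_nat j - 1) h (psi z))%C).
set (n := Z.to_nat (b - a + 1)).
assert (HG : forall j, holo_strip rho (G j)).
{ intros j z Hz. apply (ex_Cder_mult (fun _ => co (a + Z.of_nat j - 1)%Z)); [apply ex_Cder_const|].
  now apply (Hs (a + Z.of_nat j - 1)%Z). }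
assert (HGs : holo_strip rho (fun z => Csum (fun j => G j z) n)).
{ intros z Hz. apply ex_Cder_Csum. intros j. now apply HG. }
assert (HGs' : holo_strip rho (fun z => - (1) * Csum (fun j => G j z) n)%C).
{ intros z Hz. apply (ex_Cder_mult (fun _ => - (1))%C); [apply ex_Cder_const|now apply HGs]. }
rewrite (C_derive_n_ext_strip rho _ (fun z => f z + - (1) * Csum (fun j => G j z) n)%C); trivial.
- rewrite (C_derive_n_plus rho f _ m Hf HGs' _ Ht).
  rewrite (C_derive_n_scal rho _ _ m HGs _ Ht).
  rewrite (C_derive_n_Csum rho G n m HG _ Ht).
  rewrite Csum_Z_Csum. fold n.
  rewrite (Csum_ext (fun j => C_derive_n (G j) m (RtoC t))
    (fun j => co (a + Z.of_nat j - 1)%Z *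
       RtoC (Derive_n (fun s => Sinc (a + Z.of_nat j - 1) h (phi4_inv s)) m t))%C).
  + set (S1 := Csum _ n). set (D1 := C_derive_n f m (RtoC t)). clearbody S1 D1. ring.
  + intros j _. unfold G.
    rewrite (C_derive_n_scal rho _ _ m (Hs (a + Z.of_nat j - 1)%Z) _ Ht). f_equal.
    apply (C_derive_n_RtoC rho); trivial; [lra|].
    intros s. rewrite psi_RtoC. now apply SincZ_RtoC.
- intros z Hz. apply ex_Cder_minus; [now apply Hf|].
  apply (ex_Cder_ext_loc (fun z => Csum (fun j => G j z) n)); [|now apply HGs].
  exists 1. split; [lra|]. intros w _. reflexivity.
- intros z _. rewrite Csum_Z_Csum. fold n. change (Csum _ n) with (Csum (fun j => G j z) n) at 1.
  generalize (Csum (fun j => G j z) n) (f z). intros; ring.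
Qed.

Theorem theorem3p2 :
  forall (m : nat) (d : R), 0 < d < PI ->
  forall f : C -> C, analytic_in (image phi4 (strip d)) f ->
  forall K alpha beta : R, 0 < K -> 0 < alpha -> 0 < beta ->
  (forall z : C, image phi4 (strip_pos d) z ->
     Cmod (f z) <= K * Rpower (Cmod (Cexp (- z)%C)) beta) ->
  (forall z : C, image phi4 (strip_neg d) z ->
     Cmod (f z) <= K * (1 / Rpower (Cmod z) alpha)) ->
  let mu := Rmin alpha beta in
  exists C0 : R, forall n : nat, (1 <= n)%nat ->
    let M := Zceil (mu / alpha * INR n) in
    let N := Zceil (mu / beta * INR n) in
    let h := sqrt (PI * d / (mu * INR n)) in
    Rbar_le
      (Lub_Rbar (fun e : R => exists t : R,
         e = Cmod (C_derive_n f m (RtoC t)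
                   - Csum_Z (fun k : Z =>
                       f (phi4 (RtoC (IZR k * h)))
                       * RtoC (Derive_n (fun s : R => Sinc k h (phi4_inv s)) m t))
                     (- M)%Z N)%C))
      (Finite (C0 * Rpower (INR n) ((INR m + 1) / 2)
               * exp (- sqrt (PI * d * mu * INR n)))).
Proof.
intros m d Hd f Hf K alpha beta HK Ha Hb Hpos Hneg mu.
assert (Hpi := PI_RGT_0).
assert (Hmu : 0 < mu) by (apply Rmin_pos; lra).
destruct (decay_right d Hd f K beta HK Hb Hpos) as [B1 [HB1 H1]].
destruct (decay_left d Hd f K alpha HK Ha Hneg) as [B2 [HB2 H2]].
destruct (decay_rational d Hd f K alpha beta HK Ha Hb Hpos Hneg) as [CF HCF].
set (F := fun zeta => f (phi4 zeta)).
assert (HF : holo_strip d F) by exact (holo_f_phi4 d Hd f Hf).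
assert (Hpd : 0 < PI * d) by (apply Rmult_lt_0_compat; lra).
(* The value of [h] at [n = 1], the largest one. *)
set (hmax := sqrt (PI * d / mu)).
assert (Hmax : 0 < hmax) by (apply sqrt_lt_R0, Rdiv_lt_0_compat; lra).
destruct (strip_error_bound F d alpha beta B1 B2 CF hmax) as [C5 HC5]; trivial; try lra.
(* [3 / 8] is the strip of [psi]; [d / 12] gives [|Im (psi z)| <= 6 rho <= d / 2]. *)
set (rho := Rmin (3 / 8) (d / 12)).
assert (Hrho0 : 0 < rho) by (apply Rmin_pos; lra).
assert (Hrho1 : rho <= 3 / 8) by apply Rmin_l. assert (Hrho2 : rho <= d / 12) by apply Rmin_r.
(* On [|Im z| < kap * h], [1 / 6] gives [|Im (psi z)| <= h], and [rho / hmax] keeps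
   [kap * h <= rho]. *)
set (kap := Rmin (1 / 6) (rho / hmax)).
assert (Hkap0 : 0 < kap) by (apply Rmin_pos; [lra|]; apply Rdiv_lt_0_compat; lra).
assert (Hkap1 : kap <= 1 / 6) by apply Rmin_l. assert (Hkap2 : kap <= rho / hmax) by apply Rmin_r.
assert (Hfs : holo_strip rho f).
{ intros z Hz. assert (Hz' : strip (3 / 8) z) by (revert Hz; apply strip_le; lra).
  destruct (Hf z) as [l Hl].
  - exists (psi z). split; [|now apply phi4_psi]. unfold strip in *.
    assert (I := psi_Im z Hz'). lra.
  - exists l. now apply is_Cder_is_derive. }
(* Cauchy's estimate yields [(3 (m + 1) / (kap h))^m * C5 / h]; then [h = hmax / sqrt n] is
   substituted. *)
exists ((3 * (INR m + 1) / kap) ^ m * C5 / hmax ^ (m + 1)).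
intros n Hn M N h.
assert (Hn1 : 1 <= INR n) by (apply (le_INR 1); exact Hn).
set (X := sqrt (PI * d * mu * INR n)).
assert (Hmn : 0 < mu * INR n) by (apply Rmult_lt_0_compat; lra).
assert (Hsn : 0 < sqrt (INR n)) by (apply sqrt_lt_R0; lra).
assert (Hh0 : 0 < h) by (apply sqrt_lt_R0, Rdiv_lt_0_compat; lra).
assert (Eh : h = hmax / sqrt (INR n)).
{ unfold h, hmax. replace (PI * d / (mu * INR n)) with (PI * d / mu / INR n) by (field; lra).
  apply sqrt_div_alt. lra. }
assert (Hsn1 : 1 <= sqrt (INR n)).
{ rewrite <- sqrt_1. now apply sqrt_le_1_alt. }
assert (Hh1 : h <= hmax).
{ rewrite Eh. apply Rmult_le_reg_r with (sqrt (INR n)); trivial.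
  unfold Rdiv. rewrite Rmult_assoc, Rinv_l by lra. nra. }
assert (EX1 : X * h = PI * d).
{ unfold X, h. rewrite <- sqrt_mult_alt by (rewrite Rmult_assoc; apply Rmult_le_pos; lra).
  replace (PI * d * mu * INR n * (PI * d / (mu * INR n))) with (PI * d * (PI * d)) by (field; lra).
  apply sqrt_square. lra. }
(* The choice of [h] balances the errors: the truncation exponent [mu n h] equals the discretisation
   exponent [PI d / h]. *)
assert (EX2 : mu * INR n * h = X).
{ apply Rmult_eq_reg_r with h; [|lra]. rewrite EX1, Rmult_assoc.
  unfold h. rewrite sqrt_sqrt by (left; apply Rdiv_lt_0_compat; lra). field. lra. }
assert (EX : PI * d / h = X) by (rewrite <- EX1; field; lra).
assert (HMl : mu / alpha * INR n <= IZR M) by apply Zceil_bound.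
assert (HNl : mu / beta * INR n <= IZR N) by apply Zceil_bound.
assert (HM0 : (0 <= M)%Z).
{ apply le_IZR. eapply Rle_trans; [|exact HMl].
  apply Rmult_le_pos; [|lra]. left; apply Rdiv_lt_0_compat; lra. }
assert (HN0 : (0 <= N)%Z).
{ apply le_IZR. eapply Rle_trans; [|exact HNl].
  apply Rmult_le_pos; [|lra]. left; apply Rdiv_lt_0_compat; lra. }
assert (HMX : PI * d / h <= alpha * IZR M * h).
{ rewrite EX, <- EX2. apply Rmult_le_compat_r; [lra|].
  apply Rmult_le_compat_l with (r := alpha) in HMl; [|lra].
  replace (alpha * (mu / alpha * INR n)) with (mu * INR n) in HMl by (field; lra). exact HMl. }
assert (HNX : PI * d / h <= beta * IZR N * h).
{ rewrite EX, <- EX2. apply Rmult_le_compat_r; [lra|].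
  apply Rmult_le_compat_l with (r := beta) in HNl; [|lra].
  replace (beta * (mu / beta * INR n)) with (mu * INR n) in HNl by (field; lra). exact HNl. }
assert (Hkh0 : 0 < kap * h) by now apply Rmult_lt_0_compat.
assert (Hkh : kap * h <= rho).
{ apply Rle_trans with (rho / hmax * hmax); [|right; field; lra].
  apply Rmult_le_compat; lra. }
set (E := fun z => (f z - Csum_Z (fun k => f (phi4 (RtoC (IZR k * h))) * SincZ k h (psi z)) (- M) N)%C).
assert (HE : forall z, strip (kap * h) z -> Cmod (E z) <= C5 / h * exp (- X)).
{ intros z Hz. assert (Hz' : strip (3 / 8) z) by (revert Hz; apply strip_le; lra).
  assert (I := psi_Im z Hz'). unfold strip in Hz.
  assert (Hk6 : kap * h <= 1 / 6 * h) by (apply Rmult_le_compat_r; lra).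
  assert (B := HC5 h M N (psi z) (conj Hh0 Hh1) HM0 HN0 HMX HNX ltac:(lra) ltac:(lra)).
  rewrite EX in B. unfold F in B at 1. rewrite (phi4_psi z Hz') in B. exact B. }
assert (HhE : holo_strip rho E).
{ intros z Hz. apply ex_Cder_minus; [now apply Hfs|].
  apply (ex_Cder_Csum (fun j z => f (phi4 (RtoC (IZR (- M + Z.of_nat j - 1) * h))) *
     SincZ (- M + Z.of_nat j - 1) h (psi z))%C). intros j.
  apply (ex_Cder_mult (fun _ => f (phi4 (RtoC (IZR (- M + Z.of_nat j - 1) * h)))));
    [apply ex_Cder_const|].
  apply (ex_Cder_comp (SincZ (- M + Z.of_nat j - 1) h) psi); [apply ex_Cder_SincZ|].
  apply holo_psi. revert Hz. apply strip_le. lra. }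
assert (Hm := pos_INR m).
apply (proj2 (Lub_Rbar_correct _)). intros e [t ->].
rewrite <- (C_derive_n_sinc_error rho h (- M) N f (fun k => f (phi4 (RtoC (IZR k * h)))) m t
  (conj Hrho0 Hrho1) Hh0 Hfs).
fold E.
eapply Rle_trans; [apply (strip_Cauchy_estimate rho (kap * h) _ E m (conj Hkh0 Hkh) HhE HE)|].
right.
assert (ER : Rpower (INR n) ((INR m + 1) / 2) = sqrt (INR n) ^ (m + 1)).
{ rewrite <- Rpower_pow, <- Rpower_sqrt, Rpower_mult by lra. f_equal.
  rewrite plus_INR. simpl. field. }
rewrite ER, Eh.
replace (3 * (INR m + 1) / (kap * (hmax / sqrt (INR n)))) with
  (3 * (INR m + 1) / kap * (sqrt (INR n) / hmax)) by (field; repeat split; lra).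
rewrite Rpow_mult_distr.
replace ((sqrt (INR n) / hmax) ^ m) with (sqrt (INR n) ^ m / hmax ^ m).
- rewrite !pow_add, !pow_1. assert (0 < hmax ^ m) by now apply pow_lt.
  field. repeat split; lra.
- unfold Rdiv. rewrite Rpow_mult_distr, pow_inv. reflexivity.
Qed.
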